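(* Given $c,d\in\mathbb{R}$ with $c\le d$ and $s_c,s_d\in\mathbb{N}_{\mathrm{Sh}}$, there exists a map $F\in\mathcal{L}_1(S)$ such that $\mathrm{Rot}_{\mathbb{R}}(F)=\mathrm{Rot}(F)=[c,d]$ and $$\mathrm{Per}(F)=\Lambda(c,\mathrm{Sh}(s_c))\cup M(c,d)\cup\Lambda(d,\mathrm{Sh}(s_d)).$$
   Context: $\mathbb{N}=\{1,2,3,\dots\}$. $S=\mathbb{R}\cup B\subset\mathbb{C}$, where $B=\{z\in\mathbb{C}:\mathrm{Re}(z)\in\mathbb{Z},\ \mathrm{Im}(z)\in[0,1]\}$ and $\mathbb{R}$ is the real axis (so $S$ is the universal covering of a circle with a segment attached by one endpoint). $\mathcal{L}_1(S)$ is the set of continuous maps $F:S\to S$ of degree 1, i.e. $F(z+1)=F(z)+1$ for all $z\in S$. A point $z\in S$ is periodic (mod 1) for $F$ if $F^n(z)\in z+\mathbb{Z}$ for some $n\in\mathbb{N}$; the least such $n$ is its period (mod 1). $\mathrm{Per}(F)$ is the set of periods (mod 1) of all periodic (mod 1) points of $F$. The rotation number of $z\in S$ is $\rho_F(z)=\lim_{n\to\infty}\frac{\mathrm{Re}(F^n(z))-\mathrm{Re}(z)}{n}$ when the limit exists; $\mathrm{Rot}(F)=\{\rho_F(z):z\in S\}$ and $\mathrm{Rot}_{\mathbb{R}}(F)=\{\rho_F(z):z\in\mathbb{R}\}$ (over points for which the limit exists). $\mathbb{N}_{\mathrm{Sh}}=\mathbb{N}\cup\{2^\infty\}$ is totally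 ordered by the Sharkovsky ordering: $3>5>7>\cdots>2\cdot3>2\cdot5>2\cdot7>\cdots>2^2\cdot3>2^2\cdot5>\cdots>2^\infty>\cdots>2^n>\cdots>2^2>2>1$. For $s\in\mathbb{N}_{\mathrm{Sh}}$, $\mathrm{Sh}(s)=\{k\in\mathbb{N}: k\le_{\mathrm{Sh}} s\}$. For $c\le d$, $M(c,d)=\{n\in\mathbb{N}: c<k/n<d\text{ for some integer }k\}$ ($k,n$ not assumed coprime). For $\rho\in\mathbb{R}$ and $A\subset\mathbb{N}$, $\Lambda(\rho,A)=\emptyset$ if $\rho\notin\mathbb{Q}$, and $\Lambda(\rho,A)=\{nq:q\in A\}$ if $\rho=k/n$ with $k\in\mathbb{Z}$, $n\in\mathbb{N}$ coprime. *)

(* Defs.v *)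
From Stdlib Require Export Reals ZArith Znumtheory Arith.
From Coquelicot Require Export Coquelicot.

Open Scope R_scope.

Definition branches (z : C) : Prop :=
  (exists m : Z, Re z = IZR m) /\ 0 <= Im z <= 1.

Definition space_S (z : C) : Prop := Im z = 0 \/ branches z.

(** A map S -> S is represented by a total function on [C] of which only the
    restriction to S matters; [continuous_on] is continuity for the subspace
    topology of S. *)
Record degree_one_map (F : C -> C) : Prop := {
  degree_one_stable : forall z, space_S z -> space_S (F z);
  degree_one_continuous : continuous_on space_S F;
  degree_one_shift : forall z, space_S z ->
    F (Cplus z (RtoC 1)) = Cplus (F z) (RtoC 1)
}.

Definition returns_mod1 (F : C -> C) (z : C) (n : nat) : Prop :=
  exists k : Z, Nat.iter n F z = Cplus z (RtoC (IZR k)).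

Definition is_period_mod1 (F : C -> C) (z : C) (n : nat) : Prop :=
  (0 < n)%nat /\ returns_mod1 F z n /\
  forall m : nat, (0 < m < n)%nat -> ~ returns_mod1 F z m.

Definition Per (F : C -> C) (n : nat) : Prop :=
  exists z : C, space_S z /\ is_period_mod1 F z n.

(** The term of index 0 is the meaningless [0 / 0]; it does not affect the
    limit. *)
Definition is_rotation_number (F : C -> C) (z : C) (rho : R) : Prop :=
  is_lim_seq (fun n : nat => (Re (Nat.iter n F z) - Re z) / INR n) (Finite rho).

Definition Rot (F : C -> C) (rho : R) : Prop :=
  exists z : C, space_S z /\ is_rotation_number F z rho.

Definition Rot_R (F : C -> C) (rho : R) : Prop :=
  exists x : R, is_rotation_number F (RtoC x) rho.

Inductive NSh : Type :=
| NSh_nat (n : nat) (n_pos : (0 < n)%nat)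
| NSh_two_inf.

Definition odd_gt1 (p : nat) : Prop := Nat.Odd p /\ (1 < p)%nat.

Inductive sh_gt_nat : nat -> nat -> Prop :=
| sh_gt_same_level (e p q : nat) :
    odd_gt1 p -> odd_gt1 q -> (p < q)%nat ->
    sh_gt_nat (2 ^ e * p) (2 ^ e * q)
| sh_gt_lower_level (e f p q : nat) :
    odd_gt1 p -> odd_gt1 q -> (e < f)%nat ->
    sh_gt_nat (2 ^ e * p) (2 ^ f * q)
| sh_gt_odd_pow2 (e f p : nat) :
    odd_gt1 p -> sh_gt_nat (2 ^ e * p) (2 ^ f)
| sh_gt_pow2 (e f : nat) :
    (f < e)%nat -> sh_gt_nat (2 ^ e) (2 ^ f).

Definition sh_gt (a b : NSh) : Prop :=
  match a, b with
  | NSh_nat m _, NSh_nat n _ => sh_gt_nat m n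
  | NSh_nat m _, NSh_two_inf =>
      exists e p : nat, odd_gt1 p /\ m = (2 ^ e * p)%nat
  | NSh_two_inf, NSh_nat n _ => exists f : nat, n = (2 ^ f)%nat
  | NSh_two_inf, NSh_two_inf => False
  end.

Definition sh_le (a b : NSh) : Prop := a = b \/ sh_gt b a.

Definition Sh (s : NSh) (k : nat) : Prop :=
  exists k_pos : (0 < k)%nat, sh_le (NSh_nat k k_pos) s.

Definition M (c d : R) (n : nat) : Prop :=
  (0 < n)%nat /\ exists k : Z, c < IZR k / INR n < d.

(** The reduced fraction k/n is unique when it exists, and it does not exist
    when [rho] is irrational, in which case the set is empty. *)
Definition Lambda (rho : R) (A : nat -> Prop) (m : nat) : Prop :=
  exists (k : Z) (n : nat),
    (0 < n)%nat /\ rel_prime k (Z.of_nat n) /\ rho = IZR k / INR n /\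
    exists q : nat, A q /\ m = (n * q)%nat.

(* Main.v *)
Require Import Defs.
From Stdlib Require Import Reals Lra Lia Classical IndefiniteDescription.
From Coquelicot Require Import Coquelicot.
Open Scope R_scope.

(** The projection of S to the real axis is a retraction. Composed with it, a lift [f] of a
    circle map of degree one becomes a map of S with the same periods and rotation numbers
    ([over_axis]), so it suffices to realize the data on the circle ([circle_realization]).

    Periods at the ends of the rotation interval come from interval maps, one for each
    initial segment of the Sharkovsky order ([sharkovsky_realization]). They are built by
    folding: on [-1, 1] let x >= 0 go to - x and let - y <= 0 go to g y. The orbits alternate
    between the two sides and the second iterate on the right is g, so the periods are 1
    and the doubles of the periods of g ([fold_doubles_periods]). Repeated folds of the
    identity give the segments below powers of two, and their limit gives the segment below
    2^oo. If g is replaced by a function that is slightly negative at the end ([hook]), an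
    orbit can stay on the left for two steps, but has to climb a given number of cells
    before it can do so again. This gives a prescribed least odd period and, by coverings of
    intervals, all other periods allowed then ([hook_periods]). Further folds give the
    segments below 2^e p.

    Let c < d. The points X(theta) = (1 - 1/B) * sum_n B^-n ceil(theta + n d) satisfy
    B X(theta) = X(theta + d) for theta in (-1, 0] and X(theta + 1) = X(theta) + 1. So if f
    is the multiplication by B on [a, b], where b = X(0) for d and - a = X(0) for - c, then
    b has rotation number d and a has rotation number c. Between b and a + 1 the map has to
    come down from B b to B a + 1. The points X(theta) form a monotone family that no orbit
    overtakes, so all rotation numbers are in [c, d]. Because b always gets beyond a + 1 + p
    by time q when p / q < d, and symmetrically for a, the gap between b and a + 1 covers its
    translates under iterates, for all rotation numbers inside (c, d). This gives all periods
    in M(c, d) and all rotation numbers in between ([interior_periods], [interior_drift]).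

    If d = p / q, the orbit of b is periodic and repelling. A copy of the interval map
    for s_d is inserted right of b at such a scale that the q - 1 following multiplications
    by B restore its size. The return map then is this interval map, and no other periodic
    orbit of rotation number d exists, because orbits of that rotation number stay in step
    with the orbit of b ([periods_at_rotation]). The lower end is the upper end of the map
    - f (- x). For c = d the map is an irrational rotation, or a rational rotation with an
    interval map inserted in one of the permuted cells. *)

(** * Iteration, coverings and itineraries *)

Lemma iter_S : forall (A : Type) (f : A -> A) n x,
  Nat.iter (S n) f x = f (Nat.iter n f x).
Proof. reflexivity. Qed.

Lemma iter_add : forall (A : Type) (f : A -> A) n m x,
  Nat.iter (n + m) f x = Nat.iter n f (Nat.iter m f x).
Proof. intros; induction n; simpl; congruence. Qed.

Lemma iter_mul : forall (A : Type) (f : A -> A) n m x,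
  Nat.iter (n * m) f x = Nat.iter n (Nat.iter m f) x.
Proof. intros; induction n; simpl; [easy | rewrite iter_add; congruence]. Qed.

Lemma iter_returns : forall (A : Type) (f : A -> A) n x i,
  Nat.iter n f x = x -> Nat.iter (i * n) f x = x.
Proof.
  intros A f n x i H; induction i; simpl; [easy |].
  rewrite iter_add, IHi; exact H.
Qed.

Lemma iter_comm_return : forall (A : Type) (f : A -> A) n x i,
  Nat.iter n f x = x -> Nat.iter n f (Nat.iter i f x) = Nat.iter i f x.
Proof. intros A f n x i H. rewrite <- iter_add, Nat.add_comm, iter_add, H; easy. Qed.

Lemma continuity_iter : forall f n, continuity f -> continuity (Nat.iter n f).
Proof.
  intros f n Hf; induction n; simpl.
  - apply derivable_continuous, derivable_id.
  - exact (continuity_comp _ _ IHn Hf).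
Qed.

Lemma continuity_near : forall f x eps, continuity f -> 0 < eps ->
  exists del, 0 < del /\ forall y, Rabs (y - x) < del -> Rabs (f y - f x) < eps.
Proof.
  intros f x eps Hf He.
  destruct (Hf x eps He) as [d [Hd H]].
  exists d; split; [exact Hd |]; intros y Hy.
  destruct (Req_dec x y) as [->|E].
  - rewrite Rminus_diag; rewrite Rabs_R0; exact He.
  - apply (H y); split; [split; [exact I | exact E] | exact Hy].
Qed.

Lemma continuity_reflect : forall f, continuity f -> continuity (fun x => - f (- x)).
Proof.
  intros f Hf. apply (continuity_opp (fun x => f (- x))).
  apply (continuity_comp (fun x => - x) f); [|exact Hf].
  apply (continuity_opp id), derivable_continuous, derivable_id.
Qed.

Lemma first_hit : forall h x y r, continuity h -> x <= y -> h x <= r <= h y ->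
  exists y', x <= y' <= y /\ h y' = r /\ forall z, x <= z <= y' -> h z <= r.
Proof.
  intros h x y r Hc Hxy [Hx Hy].
  set (E := fun w => x <= w <= y /\ forall z, x <= z <= w -> h z <= r).
  assert (Ex : E x).
  { split; [lra|]. intros z Hz; replace z with x by lra; exact Hx. }
  destruct (completeness E) as [s [Hs1 Hs2]].
  { exists y; intros w [Hw _]; lra. }
  { exists x; exact Ex. }
  assert (Hxs : x <= s) by (apply Hs1, Ex).
  assert (Hsy : s <= y) by (apply Hs2; intros w [Hw _]; lra).
  assert (Hlt : forall z, x <= z < s -> h z <= r).
  { intros z Hz. destruct (classic (exists w, E w /\ z < w)) as [[w [[_ Ew] Hw]]|N].
    - apply Ew; lra.
    - exfalso. apply (Rlt_not_le s z); [lra|]. apply Hs2; intros w Ew.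
      destruct (Rle_lt_dec w z); [easy|]. exfalso; apply N; exists w; easy. }
  assert (Hle : h s <= r).
  { destruct (Rle_lt_dec (h s) r) as [|Hgt]; [easy|exfalso].
    destruct (continuity_near h s (h s - r) Hc) as [del [Hd Hn]]; [lra|].
    destruct (Rle_lt_dec s x) as [Hsx|Hsx].
    - replace s with x in Hgt by lra; lra.
    - set (z := Rmax x (s - del / 2)).
      assert (Hz : x <= z < s) by (split; [apply Rmax_l | apply Rmax_lub_lt; lra]).
      assert (s - del / 2 <= z) by apply Rmax_r.
      specialize (Hlt z Hz).
      assert (Hz' : Rabs (z - s) < del) by (apply Rabs_def1; lra).
      apply Hn, Rabs_def2 in Hz'; lra. }
  assert (Hall : forall z, x <= z <= s -> h z <= r).
  { intros z Hz. destruct (Req_dec z s) as [->|]; [easy|]. apply Hlt; lra. }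
  exists s; split; [lra|split; [|exact Hall]].
  destruct (Rle_lt_dec r (h s)) as [|Hlt']; [lra|exfalso].
  destruct (continuity_near h s (r - h s) Hc) as [del [Hd Hn]]; [lra|].
  assert (Hsy' : s < y).
  { destruct (Req_dec s y) as [E'|]; [rewrite E' in Hlt'; lra | lra]. }
  set (w := Rmin y (s + del / 2)).
  assert (Hw : s < w <= y) by (split; [apply Rmin_glb_lt; lra | apply Rmin_l]).
  assert (w <= s + del / 2) by apply Rmin_r.
  apply (Rlt_not_le w s); [lra|]. apply Hs1. split; [lra|].
  intros z Hz. destruct (Rle_lt_dec z s); [apply Hall; lra|].
  assert (Hz' : Rabs (z - s) < del) by (apply Rabs_def1; lra).
  apply Hn, Rabs_def2 in Hz'; lra.
Qed.

Lemma sub_interval_incr : forall h x y l r, continuity h -> x <= y -> l <= r ->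
  h x <= l -> r <= h y ->
  exists x' y', x <= x' /\ x' <= y' /\ y' <= y /\ h x' = l /\ h y' = r /\
    forall z, x' <= z <= y' -> l <= h z <= r.
Proof.
  intros h x y l r Hc Hxy Hlr Hx Hy.
  destruct (first_hit h x y r Hc Hxy) as [y' [Hy' [Ey' By']]]; [lra|].
  destruct (first_hit (fun z => - h (- z)) (- y') (- x) (- l)) as [x' [Hx' [Ex' Bx']]].
  - apply continuity_reflect, Hc.
  - lra.
  - rewrite !Ropp_involutive; lra.
  - exists (- x'), y'. repeat split; try lra.
    + specialize (Bx' (- z)). rewrite Ropp_involutive in Bx'. lra.
    + apply By'; lra.
Qed.

Lemma sub_interval : forall h a b s t l r, continuity h -> l <= r ->
  a <= s <= b -> a <= t <= b -> h s <= l -> r <= h t ->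
  exists a' b', a <= a' /\ a' <= b' /\ b' <= b /\
    (h a' = l /\ h b' = r \/ h a' = r /\ h b' = l) /\
    forall z, a' <= z <= b' -> l <= h z <= r.
Proof.
  intros h a b s t l r Hc Hlr Hs Ht Hhs Hht.
  destruct (Rle_lt_dec s t) as [Hst|Hst].
  - destruct (sub_interval_incr h s t l r) as [a' [b' H]]; try easy.
    destruct H as (H1 & H2 & H3 & H4 & H5 & H6).
    exists a', b'. split; [lra|]. split; [lra|]. split; [lra|]. split; [left; easy | exact H6].
  - destruct (sub_interval_incr (fun z => h (- z)) (- s) (- t) l r) as [a' [b' H]]; try easy.
    + apply (continuity_comp (fun x => - x) h); [|exact Hc].
      apply (continuity_opp id), derivable_continuous, derivable_id.
    + lra.
    + rewrite Ropp_involutive; easy.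
    + rewrite Ropp_involutive; easy.
    + destruct H as (H1 & H2 & H3 & H4 & H5 & H6).
      exists (- b'), (- a').
      split; [lra|]. split; [lra|]. split; [lra|]. split; [right; easy|].
      intros z Hz. rewrite <- (Ropp_involutive z). apply H6. lra.
Qed.

Definition covers (f : R -> R) (l r l' r' : R) : Prop :=
  exists s t, l <= s <= r /\ l <= t <= r /\ f s <= l' /\ r' <= f t.

Lemma ivt : forall h s t y, continuity h -> h s <= y <= h t ->
  exists z, Rmin s t <= z <= Rmax s t /\ h z = y.
Proof.
  intros h s t y Hc Hy. destruct (IVT_gen h s t y Hc) as [z Hz].
  - rewrite Rmin_left, Rmax_right; lra.
  - exists z; exact Hz.
Qed.

Lemma ivt_between : forall h a b y, continuity h -> a <= b ->
  (h a <= y <= h b \/ h b <= y <= h a) -> exists z, a <= z <= b /\ h z = y.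
Proof.
  intros h a b y Hc Hab H.
  assert (exists z, Rmin a b <= z <= Rmax a b /\ h z = y) as [z Hz].
  { destruct H as [H|H].
    - exact (ivt h a b y Hc H).
    - rewrite Rmin_comm, Rmax_comm. exact (ivt h b a y Hc H). }
  rewrite Rmin_left, Rmax_right in Hz by lra. exists z; exact Hz.
Qed.

(** The preimages are kept as intervals whose ends go to the ends of the next
    interval: this is what makes a fixed point in [loop] possible. *)
Lemma chain : forall f (l r : nat -> R) n, continuity f ->
  (forall i, (i <= n)%nat -> l i <= r i) ->
  (forall i, (i < n)%nat -> covers f (l i) (r i) (l (S i)) (r (S i))) ->
  exists a b, a <= b /\
    (Nat.iter n f a = l n /\ Nat.iter n f b = r n \/
     Nat.iter n f a = r n /\ Nat.iter n f b = l n) /\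
    forall z i, a <= z <= b -> (i <= n)%nat -> l i <= Nat.iter i f z <= r i.
Proof.
  intros f l r n Hc. induction n as [|n IH]; intros Hlr Hcov.
  - exists (l 0%nat), (r 0%nat). split; [apply Hlr; lia|]. split; [left; easy|].
    intros z i Hz Hi. replace i with 0%nat by lia. exact Hz.
  - destruct IH as (a & b & Hab & Hends & Hin).
    { intros i Hi; apply Hlr; lia. }
    { intros i Hi; apply Hcov; lia. }
    destruct (Hcov n) as (s & t & Hs & Ht & Hfs & Hft); [lia|].
    assert (Hcn : continuity (Nat.iter n f)) by (apply continuity_iter, Hc).
    assert (Hpre : forall y, l n <= y <= r n ->
              exists z, a <= z <= b /\ Nat.iter n f z = y).
    { intros y Hy. apply ivt_between; [exact Hcn | exact Hab |].
      destruct Hends as [[-> ->]|[-> ->]]; [left|right]; exact Hy. }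
    destruct (Hpre s Hs) as (s' & Hs' & Es).
    destruct (Hpre t Ht) as (t' & Ht' & Et).
    destruct (sub_interval (Nat.iter (S n) f) a b s' t' (l (S n)) (r (S n)))
      as (a' & b' & H1 & H2 & H3 & H4 & H5); try easy.
    { apply continuity_iter, Hc. }
    { apply Hlr; lia. }
    { rewrite iter_S, Es; exact Hfs. }
    { rewrite iter_S, Et; exact Hft. }
    exists a', b'. split; [exact H2|]. split; [exact H4|].
    intros z i Hz Hi. destruct (Nat.eq_dec i (S n)) as [->|].
    + apply H5, Hz.
    + apply Hin; [lra | lia].
Qed.

Lemma loop : forall f (l r : nat -> R) n, continuity f ->
  (forall i, (i <= n)%nat -> l i <= r i) ->
  (forall i, (i < n)%nat -> covers f (l i) (r i) (l (S i)) (r (S i))) ->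
  l n = l 0%nat -> r n = r 0%nat ->
  exists x, Nat.iter n f x = x /\
    forall i, (i <= n)%nat -> l i <= Nat.iter i f x <= r i.
Proof.
  intros f l r n Hc Hlr Hcov El Er.
  destruct (chain f l r n Hc Hlr Hcov) as (a & b & Hab & Hends & Hin).
  assert (Ha := Hin a 0%nat ltac:(lra) ltac:(lia)).
  assert (Hb := Hin b 0%nat ltac:(lra) ltac:(lia)).
  simpl in Ha, Hb. rewrite El, Er in Hends.
  destruct (ivt_between (fun x => Nat.iter n f x - x) a b 0) as (z & Hz & Ez).
  - apply (continuity_minus (Nat.iter n f) id); [apply continuity_iter, Hc|].
    apply derivable_continuous, derivable_id.
  - exact Hab.
  - destruct Hends as [[-> ->]|[-> ->]]; [left|right]; lra.
  - exists z. split; [lra|]. intros i Hi. apply Hin; easy.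
Qed.

Lemma itinerary : forall f (l r : nat -> R) n, continuity f ->
  (forall i, (i <= n)%nat -> l i <= r i) ->
  (forall i, (i < n)%nat -> covers f (l i) (r i) (l (S i)) (r (S i))) ->
  exists x, forall i, (i <= n)%nat -> l i <= Nat.iter i f x <= r i.
Proof.
  intros f l r n Hc Hlr Hcov.
  destruct (chain f l r n Hc Hlr Hcov) as (a & b & Hab & _ & Hin).
  exists a. intros i Hi. apply Hin; [lra | exact Hi].
Qed.

(** Starting points of longer and longer finite itineraries accumulate, and each
    constraint is closed. *)
Lemma infinite_itinerary : forall f (l r : nat -> R), continuity f ->
  (forall i, l i <= r i) ->
  (forall i, covers f (l i) (r i) (l (S i)) (r (S i))) ->
  exists x, forall i, l i <= Nat.iter i f x <= r i.
Proof.
  intros f l r Hc Hlr Hcov.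
  assert (Hfin : forall n, exists x, forall i, (i <= n)%nat -> l i <= Nat.iter i f x <= r i).
  { intros n. apply itinerary; intros; [exact Hc | apply Hlr | apply Hcov]. }
  set (u := fun n => proj1_sig (constructive_indefinite_description _ (Hfin n))).
  assert (Hu := fun n => proj2_sig (constructive_indefinite_description _ (Hfin n))).
  change (forall n i, (i <= n)%nat -> l i <= Nat.iter i f (u n) <= r i) in Hu.
  destruct (Bolzano_Weierstrass u (fun x => l 0%nat <= x <= r 0%nat)) as [x Hx].
  { apply compact_P3. }
  { intros n. apply (Hu n 0%nat). lia. }
  exists x. intros i.
  assert (Hci : continuity (Nat.iter i f)) by (apply continuity_iter, Hc).
  (* If the limit violated the i-th constraint, so would all nearby points. *)
  assert (Hsep : forall eps, 0 < eps -> exists y, l i <= Nat.iter i f y <= r i /\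
            Rabs (Nat.iter i f y - Nat.iter i f x) < eps).
  { intros eps He.
    destruct (continuity_near _ x eps Hci He) as (del & Hd & Hn).
    destruct (Hx (fun y => Rabs (y - x) < del) i) as (n & Hin & Hnear).
    - exists (mkposreal del Hd). intros y Hy; exact Hy.
    - exists (u n). split; [apply Hu, Hin | apply Hn, Hnear]. }
  split; apply Rnot_lt_le; intros Hlt.
  - destruct (Hsep (l i - Nat.iter i f x)) as (y & Hy & Hd); [lra|].
    apply Rabs_def2 in Hd. lra.
  - destruct (Hsep (Nat.iter i f x - r i)) as (y & Hy & Hd); [lra|].
    apply Rabs_def2 in Hd. lra.
Qed.

(** * Folding interval maps *)

Lemma Rmax_formula : forall x y, Rmax x y = (x + y + Rabs (x - y)) * / 2.
Proof. intros; unfold Rmax, Rabs; destruct Rle_dec; destruct Rcase_abs; lra. Qed.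

Lemma continuity_Rmax : forall f g, continuity f -> continuity g ->
  continuity (fun x => Rmax (f x) (g x)).
Proof.
  intros f g Hf Hg x. apply continuity_pt_ext with
    (fun x => (f x + g x + Rabs (f x - g x)) * / 2).
  { intros y; symmetry; apply Rmax_formula. }
  revert x.
  apply (continuity_mult (fun x => f x + g x + Rabs (f x - g x)) (fun _ => / 2)).
  - apply (continuity_plus (fun x => f x + g x) (fun x => Rabs (f x - g x))).
    + apply (continuity_plus f g); easy.
    + apply (continuity_comp (fun x => f x - g x) Rabs).
      * apply (continuity_minus f g); easy.
      * exact Rcontinuity_abs.
  - apply continuity_const; intros a b; easy.
Qed.

Lemma continuity_Rmin : forall f g, continuity f -> continuity g ->
  continuity (fun x => Rmin (f x) (g x)).
Proof.
  intros f g Hf Hg x. apply continuity_pt_ext with (fun x => - Rmax (- f x) (- g x)).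
  { intros y. unfold Rmax, Rmin. destruct Rle_dec, Rle_dec; lra. }
  revert x. apply (continuity_opp (fun x => Rmax (- f x) (- g x))).
  apply continuity_Rmax; apply continuity_opp; easy.
Qed.

Ltac prove_continuity :=
  first [ assumption | apply continuity_const; intros ? ?; reflexivity |
  lazymatch goal with
  | |- continuity (fun x => x) => apply derivable_continuous, derivable_id
  | |- continuity (fun x => Rmax (@?a x) (@?b x)) =>
      apply (continuity_Rmax a b); prove_continuity
  | |- continuity (fun x => Rmin (@?a x) (@?b x)) =>
      apply (continuity_Rmin a b); prove_continuity
  | |- continuity (fun x => @?a x + @?b x) => apply (continuity_plus a b); prove_continuity
  | |- continuity (fun x => @?a x - @?b x) => apply (continuity_minus a b); prove_continuity
  | |- continuity (fun x => @?a x * @?b x) => apply (continuity_mult a b); prove_continuity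
  | |- continuity (fun x => @?a x / ?c) =>
      apply (continuity_mult a (fun _ => / c)); prove_continuity
  | |- continuity (fun x => - @?a x) => apply (continuity_opp a); prove_continuity
  | |- continuity (fun x => ?f (@?a x)) =>
      apply (continuity_comp a f); [prove_continuity | assumption]
  end ].

Definition clamp (y : R) : R := Rmax 0 (Rmin 1 y).

Lemma clamp_id : forall y, 0 <= y <= 1 -> clamp y = y.
Proof. intros y Hy. unfold clamp. rewrite Rmin_right, Rmax_right; lra. Qed.

Lemma clamp_low : forall y, y <= 0 -> clamp y = 0.
Proof. intros y Hy. unfold clamp. rewrite Rmin_right, Rmax_left; lra. Qed.

Lemma clamp_high : forall y, 1 <= y -> clamp y = 1.
Proof. intros y Hy. unfold clamp. rewrite Rmin_left, Rmax_right; lra. Qed.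

Lemma clamp_range : forall y, 0 <= clamp y <= 1.
Proof.
  intros y; split; [apply Rmax_l|]. apply Rmax_lub; [lra | apply Rmin_l].
Qed.

Lemma continuity_clamp : continuity clamp.
Proof. unfold clamp. prove_continuity. Qed.

Definition least_return {A : Type} (f : A -> A) (x : A) (n : nat) : Prop :=
  (0 < n)%nat /\ Nat.iter n f x = x /\
  forall m, (0 < m < n)%nat -> Nat.iter m f x <> x.

Definition interval_map (g : R -> R) : Prop :=
  continuity g /\ g 0 = 0 /\ forall t, 0 <= t <= 1 -> 0 <= g t <= 1.

Definition interval_periods (g : R -> R) (n : nat) : Prop :=
  exists t, 0 < t <= 1 /\ least_return g t n.

Lemma interval_map_iter : forall g i t, interval_map g ->
  0 <= t <= 1 -> 0 <= Nat.iter i g t <= 1.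
Proof. intros g i t (_ & _ & H) Ht; induction i; simpl; auto. Qed.

Lemma least_return_fixed : forall (A : Type) (f : A -> A) x n,
  f x = x -> least_return f x n -> n = 1%nat.
Proof.
  intros A f x n Hx (Hn & _ & Hmin).
  destruct (Nat.eq_dec n 1); [easy|]. exfalso; apply (Hmin 1%nat); [lia | exact Hx].
Qed.

Lemma least_return_iter : forall (A : Type) (f : A -> A) x n i,
  least_return f x n -> least_return f (Nat.iter i f x) n.
Proof.
  intros A f x n i (Hn & Hret & Hmin). split; [exact Hn|]. split.
  - apply iter_comm_return, Hret.
  - intros m Hm E. apply (Hmin m Hm).
    (* Run the orbit on to time i * n, where it is back at x. *)
    assert (Ei : Nat.iter (i * n - i) f (Nat.iter i f x) = x).
    { rewrite <- iter_add. replace (i * n - i + i)%nat with (i * n)%nat by nia.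
      apply iter_returns, Hret. }
    rewrite <- Ei at 1. rewrite <- iter_add, Nat.add_comm, iter_add, E. exact Ei.
Qed.

Lemma least_return_through_fixed : forall (A : Type) (f : A -> A) x n i,
  least_return f x n -> f (Nat.iter i f x) = Nat.iter i f x -> n = 1%nat.
Proof.
  intros A f x n i H E. apply (least_return_fixed A f (Nat.iter i f x)); [exact E|].
  apply least_return_iter, H.
Qed.

Lemma interval_periods_ext : forall g h, interval_map g ->
  (forall t, 0 <= t <= 1 -> h t = g t) ->
  forall n, interval_periods h n <-> interval_periods g n.
Proof.
  intros g h Hg E.
  assert (Ei : forall i t, 0 <= t <= 1 -> Nat.iter i h t = Nat.iter i g t).
  { intros i t Ht; induction i; simpl; [easy|].
    rewrite IHi; apply E, interval_map_iter; easy. }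
  intros n; split; intros (t & Ht & Hn & Hret & Hmin); exists t;
    (split; [exact Ht|]); (split; [exact Hn|]); split.
  - rewrite <- Ei by lra; exact Hret.
  - intros m Hm; rewrite <- Ei by lra; apply Hmin, Hm.
  - rewrite Ei by lra; exact Hret.
  - intros m Hm; rewrite Ei by lra; apply Hmin, Hm.
Qed.

Definition signed_map (psi : R -> R) : Prop :=
  continuity psi /\ psi 0 = 0 /\ forall y, 0 <= y <= 1 -> -1 <= psi y <= 1.

(** In the coordinate [embed] the core [1/3, 1] is [-1, 1], where x >= 0 goes to - x
    and - y <= 0 goes to [psi y]. The tail [0, 1/3] leads to the core and provides the
    fixed end point 0, at which a copy of the map can be attached to other maps. The
    three branches are added up so that continuity is immediate. *)
Definition fold (psi : R -> R) (t : R) : R :=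
  (2 + psi (clamp (2 - 3 * t))) / 3 + (Rmin t (1 / 3) - 1 / 3) * (2 + psi 1)
    - Rmax 0 (t - 2 / 3).

Definition embed (x : R) : R := (2 + x) / 3.

Lemma interval_map_signed : forall g, interval_map g -> signed_map g.
Proof.
  intros g (Hc & H0 & Hr). split; [exact Hc|]. split; [exact H0|].
  intros y Hy. specialize (Hr y Hy). lra.
Qed.

Lemma fold_continuity : forall psi, continuity psi -> continuity (fold psi).
Proof.
  intros psi Hc. unfold fold. assert (H := continuity_clamp). prove_continuity.
Qed.

Lemma fold_right : forall psi x, psi 0 = 0 -> 0 <= x <= 1 ->
  fold psi (embed x) = embed (- x).
Proof.
  intros psi x H0 Hx. unfold fold, embed.
  rewrite clamp_low, H0, Rmin_right, Rmax_right by lra. lra.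
Qed.

Lemma fold_left : forall psi y, 0 <= y <= 1 -> fold psi (embed (- y)) = embed (psi y).
Proof.
  intros psi y Hy. unfold fold, embed.
  rewrite Rmin_right, Rmax_left by lra.
  replace (2 - 3 * ((2 + - y) / 3)) with y by lra.
  rewrite clamp_id by lra. lra.
Qed.

Lemma fold_tail : forall psi t, 0 <= t <= 1 / 3 -> fold psi t = t * (2 + psi 1).
Proof.
  intros psi t Ht. unfold fold.
  rewrite clamp_high, Rmin_left, Rmax_left by lra. lra.
Qed.

Lemma embed_onto : forall t, 1 / 3 <= t <= 1 ->
  exists x, t = embed x /\ -1 <= x <= 1.
Proof. intros t Ht. exists (3 * t - 2). unfold embed. lra. Qed.

Lemma embed_inj : forall x y, embed x = embed y -> x = y.
Proof. unfold embed; intros; lra. Qed.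

Lemma fold_core : forall psi t, signed_map psi -> 1 / 3 <= t <= 1 ->
  1 / 3 <= fold psi t <= 1.
Proof.
  intros psi t (_ & H0 & Hr) Ht.
  destruct (embed_onto t Ht) as (x & -> & Hx).
  destruct (Rle_lt_dec 0 x).
  - rewrite fold_right by lra. unfold embed; lra.
  - replace x with (- - x) by lra. rewrite fold_left by lra.
    specialize (Hr (- x) ltac:(lra)). unfold embed; lra.
Qed.

Lemma fold_interval_map : forall psi, signed_map psi -> interval_map (fold psi).
Proof.
  intros psi Hpsi. assert (H := Hpsi). destruct H as (Hc & H0 & Hr).
  split; [apply fold_continuity, Hc|].
  split; [rewrite fold_tail; lra|].
  intros t Ht. destruct (Rle_lt_dec (1 / 3) t).
  - assert (H := fold_core psi t Hpsi ltac:(lra)). lra.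
  - rewrite fold_tail by lra. specialize (Hr 1 ltac:(lra)). nra.
Qed.

Lemma fold_core_iter : forall psi i t, signed_map psi -> 1 / 3 <= t <= 1 ->
  1 / 3 <= Nat.iter i (fold psi) t <= 1.
Proof. intros psi i t H Ht; induction i; simpl; [exact Ht | apply fold_core; easy]. Qed.

(** In the tail points only move to the right, and nothing comes back to it. *)
Lemma fold_periodic_core : forall psi t n, signed_map psi -> 0 <= t <= 1 ->
  least_return (fold psi) t n -> n <> 1%nat -> 1 / 3 <= t.
Proof.
  intros psi t n Hpsi Ht Hper Hn1.
  apply Rnot_lt_le; intros Hlt. apply Hn1.
  assert (Hpsi' := Hpsi). destruct Hpsi' as (_ & _ & Hr).
  assert (Hr1 := Hr 1 ltac:(lra)).
  destruct Hper as (Hn & Hret & Hmin).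
  assert (Hmono : forall i, fold psi t <= Nat.iter (S i) (fold psi) t \/
                            1 / 3 <= Nat.iter (S i) (fold psi) t).
  { intros i; induction i as [|i IH]; [left; simpl; lra|].
    rewrite iter_S. set (s := Nat.iter (S i) (fold psi) t) in *.
    assert (Hs : 0 <= s <= 1).
    { apply interval_map_iter; [apply fold_interval_map, Hpsi | exact Ht]. }
    destruct (Rle_lt_dec (1 / 3) s) as [Hge|Hs'].
    - right. apply fold_core; [exact Hpsi | lra].
    - left. rewrite (fold_tail psi s) by lra. destruct IH as [IH|IH]; nra. }
  apply (least_return_fixed R (fold psi) t); [|split; [exact Hn | split; [exact Hret | exact Hmin]]].
  specialize (Hmono (n - 1)%nat). replace (S (n - 1)) with n in Hmono by lia.
  rewrite Hret in Hmono. assert (E := fold_tail psi t ltac:(lra)).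
  destruct Hmono as [H|H]; [|lra]. nra.
Qed.

Lemma fold_has_fixed : forall psi, signed_map psi -> interval_periods (fold psi) 1.
Proof.
  intros psi (_ & H0 & _). exists (embed 0). split; [unfold embed; lra|].
  split; [lia|]. split; [|intros; lia]. simpl. rewrite fold_right by lra.
  f_equal; lra.
Qed.

Lemma fold_double_step : forall g i y, interval_map g -> 0 <= y <= 1 ->
  Nat.iter (2 * i) (fold g) (embed y) = embed (Nat.iter i g y).
Proof.
  intros g i y Hg Hy. rewrite Nat.mul_comm, iter_mul.
  induction i as [|i IH]; [easy|]. rewrite !iter_S, IH. simpl.
  assert (Hi := interval_map_iter g i y Hg Hy). destruct Hg as (_ & H0 & _).
  rewrite fold_right, fold_left by easy. easy.
Qed.

(** In the core the orbits alternate between the two sides of the centre, and on the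
    right side the second iterate is [g]. The point 0 of [g] becomes the fixed centre and
    not a point of period 2, which is why [interval_periods] looks at (0, 1] only. *)
Theorem fold_doubles_periods : forall g, interval_map g -> forall n,
  interval_periods (fold g) n <->
  n = 1%nat \/ exists k, n = (2 * k)%nat /\ interval_periods g k.
Proof.
  intros g Hg. assert (Hsg := interval_map_signed g Hg).
  assert (Hg' := Hg). destruct Hg' as (_ & H0 & Hr).
  assert (Hodd : forall y i, 0 <= y <= 1 ->
            Nat.iter (S (2 * i)) (fold g) (embed y) = embed y -> y = 0).
  { intros y i Hy E. rewrite iter_S, fold_double_step in E by easy.
    assert (Hi := interval_map_iter g i y Hg Hy).
    rewrite fold_right in E by easy. apply embed_inj in E. lra. }
  intros n; split.
  - intros (t & Ht & Hper).
    destruct (Nat.eq_dec n 1) as [|Hn1]; [left; easy | right].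
    assert (Hcore := fold_periodic_core g t n Hsg ltac:(lra) Hper Hn1).
    assert (Hex : exists y, 0 <= y <= 1 /\ least_return (fold g) (embed y) n).
    { destruct (embed_onto t ltac:(lra)) as (x & -> & Hx).
      destruct (Rle_lt_dec 0 x).
      - exists x; split; [lra | exact Hper].
      - exists (g (- x)). split; [apply Hr; lra|].
        replace (embed (g (- x))) with (Nat.iter 1 (fold g) (embed x)).
        + apply least_return_iter, Hper.
        + simpl. replace x with (- - x) at 1 by lra. apply fold_left; lra. }
    clear t Ht Hper Hcore. destruct Hex as (y & Hy & Hper).
    assert (Hy0 : y <> 0).
    { intros ->. apply Hn1. apply (least_return_fixed R (fold g) (embed 0)); [|exact Hper].
      rewrite fold_right by lra. f_equal; lra. }
    destruct Hper as (Hn & Hret & Hmin).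
    destruct (Nat.Even_or_Odd n) as [[k Hk]|[k Hk]].
    + exists k. split; [exact Hk|]. exists y. split; [lra|]. split; [lia|]. split.
      * rewrite Hk, fold_double_step in Hret by easy. apply embed_inj, Hret.
      * intros m Hm E. apply (Hmin (2 * m)%nat); [lia|].
        rewrite fold_double_step, E by easy. easy.
    + exfalso. apply Hy0, (Hodd y k Hy). rewrite <- Hret at 2. f_equal; lia.
  - intros [->|(k & -> & y & Hy & Hk & Hret & Hmin)]; [apply fold_has_fixed, Hsg|].
    exists (embed y). split; [unfold embed; lra|]. split; [lia|]. split.
    + rewrite fold_double_step, Hret by (easy || lra). easy.
    + intros m Hm E. destruct (Nat.Even_or_Odd m) as [[j Hj]|[j Hj]].
      * apply (Hmin j); [lia|]. subst m. rewrite fold_double_step in E by (easy || lra).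
        apply embed_inj, E.
      * replace m with (S (2 * j)) in E by lia. apply Hodd in E; lra.
Qed.

(** * Interval maps whose periods are powers of two *)

Lemma interval_map_id : interval_map (fun t => t).
Proof. split; [prove_continuity|]. split; [easy | intros; easy]. Qed.

Lemma interval_periods_id : forall n, interval_periods (fun t => t) n <-> n = 1%nat.
Proof.
  intros n; split.
  - intros (t & _ & H). exact (least_return_fixed R (fun t => t) t n eq_refl H).
  - intros ->. exists 1. split; [lra|]. split; [lia|]. split; [easy | intros; lia].
Qed.

Lemma fold_contracts : forall f g d, (forall t, 0 <= t <= 1 -> Rabs (f t - g t) <= d) ->
  forall t, 0 <= t <= 1 -> Rabs (fold f t - fold g t) <= d / 3.
Proof.
  intros f g d H t Ht. unfold fold.
  assert (Hc := H (clamp (2 - 3 * t)) (clamp_range _)).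
  assert (H1 := H 1 ltac:(lra)).
  apply Rabs_le_between in Hc, H1. apply Rabs_le_between.
  destruct (Rle_lt_dec (1 / 3) t) as [Hl|Hl].
  - rewrite Rmin_right by lra. lra.
  - rewrite Rmin_left by lra. rewrite clamp_high in * by lra. nra.
Qed.

Lemma iter_fold_interval_map : forall k g, interval_map g ->
  interval_map (Nat.iter k fold g).
Proof.
  intros k g Hg; induction k; simpl; [exact Hg|].
  apply fold_interval_map, interval_map_signed, IHk.
Qed.

Lemma iter_fold_contracts : forall n f g, interval_map f -> interval_map g ->
  forall t, 0 <= t <= 1 -> Rabs (Nat.iter n fold f t - Nat.iter n fold g t) <= (1 / 3) ^ n.
Proof.
  intros n f g (_ & _ & Hf) (_ & _ & Hg); induction n; intros t Ht; simpl.
  - specialize (Hf t Ht); specialize (Hg t Ht). apply Rabs_le_between; lra.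
  - replace (1 / 3 * (1 / 3) ^ n) with ((1 / 3) ^ n / 3) by lra.
    apply fold_contracts; easy.
Qed.

Lemma third_pow_small : forall eps, 0 < eps -> exists n, (1 / 3) ^ n < eps.
Proof.
  intros eps He. destruct (pow_lt_1_zero (1 / 3)) with (y := eps) as [n Hn].
  - rewrite Rabs_pos_eq; lra.
  - exact He.
  - exists n. specialize (Hn n (le_n n)). apply Rabs_def2 in Hn. lra.
Qed.

(** The limit of the repeated folds of the identity. They converge uniformly because
    folding divides distances by 3. *)
Definition fold_limit (t : R) : R :=
  real (Lim_seq (fun n => Nat.iter n fold (fun t => t) (clamp t))).

Lemma fold_limit_spec : forall n t,
  Rabs (fold_limit t - Nat.iter n fold (fun t => t) (clamp t)) <= (1 / 3) ^ n.
Proof.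
  intros n t. set (u := fun n => Nat.iter n fold (fun t => t) (clamp t)).
  assert (Hdist : forall n k, Rabs (u (n + k)%nat - u n) <= (1 / 3) ^ n).
  { intros i k. unfold u. rewrite iter_add. apply iter_fold_contracts.
    - apply iter_fold_interval_map, interval_map_id.
    - apply interval_map_id.
    - apply clamp_range. }
  assert (Hlim : is_lim_seq u (fold_limit t)).
  { apply Lim_seq_correct', ex_lim_seq_cauchy_corr. intros eps.
    destruct (third_pow_small (eps / 2)) as [N HN]; [destruct eps; simpl; lra|].
    exists N. intros i j Hi Hj.
    assert (H1 := Hdist N (i - N)%nat). assert (H2 := Hdist N (j - N)%nat).
    replace (N + (i - N))%nat with i in H1 by lia.
    replace (N + (j - N))%nat with j in H2 by lia.
    apply Rabs_le_between in H1, H2. apply Rabs_def1; lra. }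
  apply (is_lim_seq_incr_n u n) in Hlim.
  assert (Hb : forall k, u n - (1 / 3) ^ n <= u (k + n)%nat <= u n + (1 / 3) ^ n).
  { intros k. assert (H := Hdist n k). rewrite Nat.add_comm in H.
    apply Rabs_le_between in H. lra. }
  assert (Hlo := is_lim_seq_le _ _ _ _ (fun k => proj1 (Hb k)) (is_lim_seq_const _) Hlim).
  assert (Hhi := is_lim_seq_le _ _ _ _ (fun k => proj2 (Hb k)) Hlim (is_lim_seq_const _)).
  simpl in Hlo, Hhi. apply Rabs_le_between. fold (u n). lra.
Qed.

Lemma le_of_third_pow : forall x c, (forall n, x <= c * (1 / 3) ^ n) -> 0 < c -> x <= 0.
Proof.
  intros x c H Hc. apply Rnot_lt_le; intros Hx.
  destruct (third_pow_small (x / c)) as [n Hn]; [apply Rdiv_lt_0_compat; lra|].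
  specialize (H n). apply (Rmult_lt_compat_l c) in Hn; [|lra].
  replace (c * (x / c)) with x in Hn by (field; lra). lra.
Qed.

Lemma fold_limit_interval_map : interval_map fold_limit.
Proof.
  split; [|split].
  - intros x eps He. destruct (third_pow_small (eps / 3)) as [n Hn]; [lra|].
    assert (Hc : continuity (fun t => Nat.iter n fold (fun t => t) (clamp t))).
    { assert (H := proj1 (iter_fold_interval_map n _ interval_map_id)).
      assert (H' := continuity_clamp). prove_continuity. }
    destruct (continuity_near _ x (eps / 3) Hc) as (del & Hd & Hnear); [lra|].
    exists del. split; [exact Hd|]. intros y [_ Hy].
    change (Rabs (y - x) < del) in Hy.
    change (Rabs (fold_limit y - fold_limit x) < eps).
    assert (H1 := fold_limit_spec n y). assert (H2 := fold_limit_spec n x).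
    specialize (Hnear y Hy). apply Rabs_def2 in Hnear.
    apply Rabs_le_between in H1, H2. apply Rabs_def1; lra.
  - apply cond_eq. intros eps He. destruct (third_pow_small eps He) as [n Hn].
    assert (H := fold_limit_spec n 0). rewrite clamp_low in H by lra.
    assert (E := proj1 (proj2 (iter_fold_interval_map n _ interval_map_id))).
    rewrite E in H. lra.
  - intros t Ht.
    assert (H : forall n, - (1 / 3) ^ n <= fold_limit t <= 1 + (1 / 3) ^ n).
    { intros n. assert (H := fold_limit_spec n t). apply Rabs_le_between in H.
      assert (H' := proj2 (proj2 (iter_fold_interval_map n _ interval_map_id))
                      (clamp t) (clamp_range t)). lra. }
    split.
    + enough (- fold_limit t <= 0) by lra. apply (le_of_third_pow _ 1); [|lra].
      intros n; specialize (H n); lra.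
    + enough (fold_limit t - 1 <= 0) by lra. apply (le_of_third_pow _ 1); [|lra].
      intros n; specialize (H n); lra.
Qed.

Lemma fold_limit_fixed : forall t, 0 <= t <= 1 -> fold_limit t = fold fold_limit t.
Proof.
  intros t Ht. apply Rminus_diag_uniq.
  enough (Rabs (fold_limit t - fold fold_limit t) <= 0).
  { assert (H' := Rabs_pos (fold_limit t - fold fold_limit t)).
    apply Rabs_eq_0. lra. }
  apply (le_of_third_pow _ 2); [|lra]. intros n.
  assert (H1 := fold_limit_spec (S n) t). rewrite clamp_id in H1 by lra.
  assert (H2 : Rabs (fold fold_limit t - fold (Nat.iter n fold (fun t => t)) t)
                <= (1 / 3) ^ n / 3).
  { apply fold_contracts; [|exact Ht]. intros s Hs.
    assert (H := fold_limit_spec n s). rewrite clamp_id in H by lra. exact H. }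
  assert (Hp : 0 < (1 / 3) ^ n) by (apply pow_lt; lra).
  rewrite iter_S in H1. simpl in H1.
  apply Rabs_le_between in H1, H2. apply Rabs_le_between. lra.
Qed.

(** The limit is its own fold, so its set of periods P satisfies P = {1} + 2 P. *)
Lemma fold_limit_periods : forall n,
  interval_periods fold_limit n <-> exists f, n = (2 ^ f)%nat.
Proof.
  assert (Hrec : forall n, interval_periods fold_limit n <->
     n = 1%nat \/ exists k, n = (2 * k)%nat /\ interval_periods fold_limit k).
  { intros n. rewrite <- (fold_doubles_periods _ fold_limit_interval_map).
    apply interval_periods_ext.
    - apply fold_interval_map, interval_map_signed, fold_limit_interval_map.
    - apply fold_limit_fixed. }
  intros n; split.
  - induction n as [n IH] using lt_wf_ind. intros H. assert (Hn := H).
    destruct Hn as (_ & _ & Hn & _).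
    apply Hrec in H. destruct H as [->|(k & -> & Hk)]; [exists 0%nat; easy|].
    destruct (IH k) as [f ->]; [lia | exact Hk|]. exists (S f); simpl; lia.
  - intros [f ->]. induction f as [|f IH]; apply Hrec; [left; easy|].
    right. exists (2 ^ f)%nat. split; [simpl; lia | exact IH].
Qed.

(** * Interval maps with a given least odd period *)

Section Odd.
Context (m : nat) (Hm : (1 <= m)%nat).

Definition mesh : R := / (INR m + 1).

(** The slope is 2 on the first of [m] cells of length [mesh], the next cells are
    shifted by one cell, and from 1 a steep branch descends to [- mesh]. Under [fold] a
    point on the left beyond the zero [cut] of that branch has its image on the left too,
    in the first cell. From there it takes at least [m] rounds of two
    steps to get beyond [cut] again, which makes [2 * m + 1] the least odd period. *)
Definition hook (y : R) : R :=
  Rmin (2 * y) (Rmin (y + mesh) (1 - (INR m + 2) * (y - INR m * mesh))).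

Lemma mesh_eq : mesh * INR m = 1 - mesh.
Proof. unfold mesh. field. assert (H := pos_INR m). lra. Qed.

Lemma INRm : 1 <= INR m.
Proof. apply (le_INR 1); exact Hm. Qed.

Lemma mesh_pos : 0 < mesh.
Proof. unfold mesh. apply Rinv_0_lt_compat. assert (H := INRm). lra. Qed.

Lemma hook_bounds : forall y,
  hook y <= 2 * y /\ hook y <= y + mesh /\ hook y <= 1 - (INR m + 2) * (y - INR m * mesh).
Proof.
  intros y. unfold hook.
  assert (H1 := Rmin_l (2 * y) (Rmin (y + mesh) (1 - (INR m + 2) * (y - INR m * mesh)))).
  assert (H2 := Rmin_r (2 * y) (Rmin (y + mesh) (1 - (INR m + 2) * (y - INR m * mesh)))).
  assert (H3 := Rmin_l (y + mesh) (1 - (INR m + 2) * (y - INR m * mesh))).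
  assert (H4 := Rmin_r (y + mesh) (1 - (INR m + 2) * (y - INR m * mesh))).
  lra.
Qed.

Lemma hook_doubling : forall y, 0 <= y <= mesh -> hook y = 2 * y.
Proof.
  intros y Hy. unfold hook. rewrite Rmin_left; [easy|].
  assert (H := INRm). assert (H' := mesh_eq). assert (H'' := mesh_pos).
  apply Rmin_glb; [lra|]. nra.
Qed.

Lemma hook_shift : forall y, mesh <= y <= INR m * mesh -> hook y = y + mesh.
Proof.
  intros y Hy. unfold hook.
  assert (H := INRm). assert (H' := mesh_eq). assert (H'' := mesh_pos).
  rewrite (Rmin_left (y + mesh)) by nra. apply Rmin_right. lra.
Qed.

Lemma hook_last : forall y, INR m * mesh <= y ->
  hook y = 1 - (INR m + 2) * (y - INR m * mesh).
Proof.
  intros y Hy. unfold hook.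
  assert (H := INRm). assert (H' := mesh_eq). assert (H'' := mesh_pos).
  rewrite (Rmin_right (y + mesh)) by nra. apply Rmin_right. nra.
Qed.

Lemma hook_pos : forall y, 0 < y <= INR m * mesh -> 0 < hook y.
Proof.
  intros y Hy. destruct (Rle_lt_dec y mesh).
  - rewrite hook_doubling; lra.
  - rewrite hook_shift by lra. assert (H := mesh_pos). lra.
Qed.

Lemma hook_range : forall y, 0 <= y <= 1 -> - mesh <= hook y <= 1.
Proof.
  intros y Hy. assert (H := INRm). assert (H' := mesh_eq). assert (H'' := mesh_pos).
  destruct (Rle_lt_dec y (INR m * mesh)).
  - assert (Hb := hook_bounds y). split; [|lra].
    destruct (Req_dec y 0) as [->|].
    + rewrite hook_doubling; lra.
    + assert (Hp := hook_pos y). lra.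
  - rewrite hook_last by lra. nra.
Qed.

Lemma hook_signed : signed_map hook.
Proof.
  split; [unfold hook; prove_continuity|]. assert (H'' := mesh_pos).
  split; [rewrite hook_doubling; lra|].
  intros y Hy. assert (H := hook_range y Hy). assert (H' := mesh_eq).
  assert (Hi := INRm). nra.
Qed.

Lemma mesh_mult : forall j, (j <= m)%nat -> INR j * mesh <= INR m * mesh.
Proof. intros j Hj. apply le_INR in Hj. assert (H := mesh_pos). nra. Qed.

(** [hook] raises a point by at most one cell per round, and it is positive on the
    first [m] cells. *)
Lemma after_left_left : forall y, 0 < y <= 1 -> hook y < 0 ->
  forall j, (j < m)%nat ->
  exists w, 0 < w <= INR (S j) * mesh /\
    Nat.iter (S (2 * j)) (fold hook) (embed (- y)) = embed (- w).
Proof.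
  intros y Hy Hneg j. assert (Hi := INRm). assert (He := mesh_pos).
  induction j as [|j IH]; intros Hj.
  - exists (- hook y). assert (H := hook_range y). simpl. split; [lra|].
    rewrite fold_left by lra. f_equal; lra.
  - destruct IH as (w & Hw & Ew); [lia|]. 
    assert (Hwm := mesh_mult (S j) ltac:(lia)).
    assert (Hw1 : w <= 1) by (assert (H := mesh_eq); lra).
    assert (Hp := hook_pos w). assert (Hr := hook_range w).
    exists (hook w). split.
    + assert (Hb := hook_bounds w). rewrite (S_INR (S j)). lra.
    + replace (S (2 * S j)) with (2 + S (2 * j))%nat by lia.
      rewrite iter_add, Ew. simpl.
      rewrite fold_left, fold_right by (apply hook_signed || lra). easy.
Qed.

(** If the sides of the centre always alternated along the orbit, the period would be
    even. So two consecutive points lie on the left. From the second of them on the sides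
    alternate for [2 * m] points, so that such a pair recurs after [2 * m + 1] steps at the
    earliest. *)
Lemma odd_period_lower_bound : forall n,
  interval_periods (fold hook) n -> Nat.Odd n -> n = 1%nat \/ (2 * m + 1 <= n)%nat.
Proof.
  intros n (t & Ht & Hper) Hodd. assert (He := mesh_pos).
  destruct (Nat.eq_dec n 1) as [|Hn1]; [left; easy | right].
  assert (Hsig := hook_signed). assert (Hsig' := Hsig). destruct Hsig' as (_ & H0 & Hr).
  assert (Hcore := fold_periodic_core _ t n Hsig ltac:(lra) Hper Hn1).
  set (x := fun i => 3 * Nat.iter i (fold hook) t - 2).
  assert (Hx : forall i, Nat.iter i (fold hook) t = embed (x i) /\ -1 <= x i <= 1 /\ x i <> 0).
  { intros i. assert (Ex : Nat.iter i (fold hook) t = embed (x i)) by (unfold embed, x; field).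
    assert (Hi := fold_core_iter hook i t Hsig ltac:(lra)).
    split; [exact Ex|]. split; [unfold x; lra|]. intros Ei.
    apply Hn1. apply (least_return_through_fixed R (fold hook) t n i Hper).
    rewrite Ex, Ei, fold_right by lra. f_equal; lra. }
  assert (Hpos : forall i, 0 < x i -> x (S i) < 0).
  { intros i Hi. destruct (Hx i) as (E & Hb & _). destruct (Hx (S i)) as (E' & _).
    rewrite iter_S, E, fold_right in E' by lra. apply embed_inj in E'. lra. }
  assert (Hper_x : forall i, x (i + n)%nat = x i).
  { intros i. apply embed_inj. rewrite <- (proj1 (Hx i)), <- (proj1 (Hx (i + n)%nat)).
    rewrite iter_add. destruct Hper as (_ & -> & _). easy. }
  assert (Hdouble : exists i, x i < 0 /\ x (S i) < 0).
  { apply NNPP; intros Hno.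
    assert (Hneg : forall i, x i < 0 -> 0 < x (S i)).
    { intros i Hi. destruct (Rtotal_order (x (S i)) 0) as [H|[H|H]]; [|apply Hx in H; easy | easy].
      exfalso; apply Hno; exists i; easy. }
    assert (Halt : forall k i, x i < 0 -> x (2 * k + i)%nat < 0).
    { intros k i Hi; induction k as [|k IHk]; [exact Hi|].
      replace (2 * S k + i)%nat with (S (S (2 * k + i))) by lia. auto. }
    destruct Hodd as [k Hk].
    assert (Hi : exists i, x i < 0).
    { destruct (Rtotal_order (x 0%nat) 0) as [H|[H|H]].
      - exists 0%nat; easy.
      - apply Hx in H; easy.
      - exists 1%nat; auto. }
    destruct Hi as [i Hi].
    assert (H := Hneg _ (Halt k i Hi)).
    replace (S (2 * k + i)) with (i + n)%nat in H by lia.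
    rewrite Hper_x in H. lra. }
  destruct Hdouble as (i & Hi & HSi).
  assert (Ey : hook (- x i) = x (S i)).
  { apply embed_inj. rewrite <- (proj1 (Hx (S i))), iter_S, (proj1 (Hx i)).
    destruct (Hx i) as (_ & Hb & _).
    rewrite <- fold_left by lra. f_equal; f_equal; lra. }
  assert (Hafter := after_left_left (- x i) ltac:(destruct (Hx i); lra) ltac:(lra)).
  rewrite Ropp_involutive in Hafter.
  assert (Hodd_neg : forall j, (j < m)%nat -> 0 < x (2 * j + 2 + i)%nat).
  { intros j Hj. destruct (Hafter j Hj) as (w & Hw & Ew).
    rewrite <- (proj1 (Hx i)), <- iter_add in Ew.
    assert (Hwm := mesh_mult (S j) ltac:(lia)).
    assert (Hw1 : w <= 1) by (assert (H := mesh_eq); lra).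
    assert (E : embed (x (2 * j + 2 + i)%nat) = embed (hook w)).
    { rewrite <- (proj1 (Hx (2 * j + 2 + i)%nat)).
      replace (2 * j + 2 + i)%nat with (S (S (2 * j) + i)) by lia.
      rewrite iter_S, Ew, fold_left by lra. easy. }
    apply embed_inj in E. rewrite E. apply hook_pos. lra. }
  apply Nat.nlt_ge. intros Hlt.
  destruct Hper as (Hn & _).
  destruct (Nat.Even_or_Odd n) as [[k Hk]|[k Hk]].
  - specialize (Hodd_neg (k - 1)%nat ltac:(lia)).
    replace (2 * (k - 1) + 2 + i)%nat with (i + n)%nat in Hodd_neg by lia.
    rewrite Hper_x in Hodd_neg. lra.
  - specialize (Hodd_neg k ltac:(lia)).
    replace (2 * k + 2 + i)%nat with (S i + n)%nat in Hodd_neg by lia.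
    rewrite Hper_x in Hodd_neg. lra.
Qed.

Definition cut : R := INR m * mesh + / (INR m + 2).

Lemma cut_bounds : INR m * mesh < cut < 1.
Proof.
  unfold cut. assert (Hi := INRm). assert (E := mesh_eq).
  assert (H1 : 0 < / (INR m + 2)) by (apply Rinv_0_lt_compat; lra).
  assert (H2 : / (INR m + 2) < mesh) by (apply Rinv_lt_contravar; nra).
  lra.
Qed.

Lemma hook_cut : hook cut = 0.
Proof.
  assert (H := cut_bounds). rewrite hook_last by lra. unfold cut.
  assert (Hi := INRm). field. lra.
Qed.

Lemma hook_top : hook (INR m * mesh) = 1.
Proof. rewrite hook_last by lra. lra. Qed.

Lemma hook_one : hook 1 = - mesh.
Proof.
  assert (E := mesh_eq). assert (He := mesh_pos). rewrite hook_last by lra.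
  replace (1 - INR m * mesh) with mesh by lra. lra.
Qed.

Lemma hook_cell_covers : forall i l r, (i < m)%nat ->
  INR i * mesh + mesh <= l -> r <= INR i * mesh + 2 * mesh ->
  covers hook (INR i * mesh) (INR (S i) * mesh) l r.
Proof.
  intros i l r Hi Hl Hr. assert (He := mesh_pos). assert (Hi0 := pos_INR i).
  exists (INR i * mesh), (INR (S i) * mesh). rewrite S_INR.
  split; [nra|]. split; [nra|]. split.
  - assert (Hb := hook_bounds (INR i * mesh)). lra.
  - assert (Hm' := mesh_mult (S i) Hi). rewrite S_INR in Hm'.
    destruct i as [|i].
    + simpl in *. rewrite hook_doubling; lra.
    + rewrite S_INR in *. rewrite hook_shift; [lra|].
      assert (Hj0 := pos_INR i). split; nra.
Qed.

(** The orbits that wait in the first cell realize all larger odd periods. *)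
Lemma hook_first_cell_covers :
  covers hook (INR 0 * mesh) (INR 1 * mesh) (INR 0 * mesh) (INR 1 * mesh).
Proof.
  assert (He := mesh_pos). exists 0, mesh. simpl. rewrite !hook_doubling by lra. lra.
Qed.

Lemma covers_left : forall l r l' r', 0 <= l -> l <= r -> r <= 1 -> covers hook l r l' r' ->
  covers (fold hook) (embed (- r)) (embed (- l)) (embed l') (embed r').
Proof.
  intros l r l' r' H0 Hlr H1 (s & t & Hs & Ht & Es & Et).
  exists (embed (- s)), (embed (- t)). rewrite !fold_left by lra. unfold embed; lra.
Qed.

Lemma covers_right : forall l r, 0 <= l -> l <= r -> r <= 1 ->
  covers (fold hook) (embed l) (embed r) (embed (- r)) (embed (- l)).
Proof.
  intros l r H0 Hlr H1. exists (embed r), (embed l).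
  rewrite !fold_right by (apply hook_signed || lra). unfold embed; lra.
Qed.

(** A path of intervals for [hook] gives a path of double length for [fold hook], which
    takes place on the left at even times and on the right at odd times. *)
Definition zig_low (lo hi : nat -> R) (i : nat) : R :=
  if Nat.even i then embed (- hi (Nat.div2 i)) else embed (lo (S (Nat.div2 i))).

Definition zig_high (lo hi : nat -> R) (i : nat) : R :=
  if Nat.even i then embed (- lo (Nat.div2 i)) else embed (hi (S (Nat.div2 i))).

Lemma zig_even : forall lo hi j,
  zig_low lo hi (2 * j) = embed (- hi j) /\ zig_high lo hi (2 * j) = embed (- lo j).
Proof.
  intros. unfold zig_low, zig_high. rewrite Nat.even_even, Nat.div2_double. easy.
Qed.

Lemma zig_odd : forall lo hi j,
  zig_low lo hi (S (2 * j)) = embed (lo (S j)) /\ zig_high lo hi (S (2 * j)) = embed (hi (S j)).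
Proof.
  intros. unfold zig_low, zig_high.
  replace (Nat.even (S (2 * j))) with false.
  - rewrite Nat.div2_succ_double. easy.
  - rewrite Nat.even_succ, <- Nat.negb_even, Nat.even_even. easy.
Qed.

Lemma zig_0 : forall lo hi,
  zig_low lo hi 0 = embed (- hi 0%nat) /\ zig_high lo hi 0 = embed (- lo 0%nat).
Proof. easy. Qed.

Lemma zig_1 : forall lo hi,
  zig_low lo hi 1 = embed (lo 1%nat) /\ zig_high lo hi 1 = embed (hi 1%nat).
Proof. easy. Qed.

Lemma zig_path : forall lo hi K,
  (forall j, (j <= K)%nat -> 0 <= lo j /\ lo j <= hi j /\ hi j <= 1) ->
  (forall j, (j < K)%nat -> covers hook (lo j) (hi j) (lo (S j)) (hi (S j))) ->
  forall i,
  ((i <= 2 * K)%nat -> zig_low lo hi i <= zig_high lo hi i) /\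
  ((i < 2 * K)%nat -> covers (fold hook) (zig_low lo hi i) (zig_high lo hi i)
                             (zig_low lo hi (S i)) (zig_high lo hi (S i))).
Proof.
  intros lo hi K Hb Hc i.
  destruct (Nat.Even_or_Odd i) as [[j ->]|[j ->]].
  - rewrite !(proj1 (zig_even _ _ _)), !(proj2 (zig_even _ _ _)),
      !(proj1 (zig_odd _ _ _)), !(proj2 (zig_odd _ _ _)).
    split; intros Hi.
    + specialize (Hb j ltac:(lia)). unfold embed; lra.
    + apply covers_left; [apply Hb; lia.. | apply Hc; lia].
  - replace (2 * j + 1)%nat with (S (2 * j)) by lia.
    replace (S (S (2 * j))) with (2 * S j)%nat by lia.
    rewrite !(proj1 (zig_even _ _ _)), !(proj2 (zig_even _ _ _)),
      !(proj1 (zig_odd _ _ _)), !(proj2 (zig_odd _ _ _)).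
    split; intros Hi.
    + specialize (Hb (S j) ltac:(lia)). unfold embed; lra.
    + apply covers_right; apply Hb; lia.
Qed.

(** The loop visits the part beyond [cut] once, stays [k + 1] rounds in the first cell and
    one round in each of the other cells. *)
Lemma odd_periods_exist : forall k, interval_periods (fold hook) (S (2 * (k + m))).
Proof.
  intros k. set (K := (k + m)%nat).
  assert (He := mesh_pos). assert (Eq := mesh_eq). assert (Hcut := cut_bounds).
  assert (Hi := INRm). assert (Hme : 0 <= INR m * mesh) by nra.
  set (lo := fun j => if (j <? K)%nat then INR (j - k) * mesh else cut).
  set (hi := fun j => if (j <? K)%nat then INR (S (j - k)) * mesh else 1).
  assert (Elo : forall j, (j < K)%nat -> lo j = INR (j - k) * mesh).
  { intros j Hj; unfold lo. apply Nat.ltb_lt in Hj; rewrite Hj; easy. }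
  assert (Ehi : forall j, (j < K)%nat -> hi j = INR (S (j - k)) * mesh).
  { intros j Hj; unfold hi. apply Nat.ltb_lt in Hj; rewrite Hj; easy. }
  assert (EloK : lo K = cut) by (unfold lo; rewrite Nat.ltb_irrefl; easy).
  assert (EhiK : hi K = 1) by (unfold hi; rewrite Nat.ltb_irrefl; easy).
  assert (Hb : forall j, (j <= K)%nat -> 0 <= lo j /\ lo j <= hi j /\ hi j <= 1).
  { intros j Hj. destruct (Nat.eq_dec j K) as [->|]; [lra|].
    rewrite Elo, Ehi by lia. assert (H := mesh_mult (S (j - k)) ltac:(lia)).
    assert (H' := pos_INR (j - k)). rewrite S_INR in *. split; [nra|]. split; nra. }
  assert (Hc : forall j, (j < K)%nat -> covers hook (lo j) (hi j) (lo (S j)) (hi (S j))).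
  { intros j Hj. rewrite Elo, Ehi by easy.
    destruct (Nat.eq_dec (S j) K) as [E|].
    - rewrite E, EloK, EhiK. replace (j - k)%nat with (m - 1)%nat by lia.
      assert (H : INR m = INR (m - 1) + 1) by (rewrite <- S_INR; f_equal; lia).
      rewrite H in *. apply hook_cell_covers; [lia | lra | lra].
    - rewrite Elo, Ehi by lia. destruct (le_lt_dec k j).
      + replace (S j - k)%nat with (S (j - k)) by lia.
        apply hook_cell_covers; [lia|rewrite ?S_INR; lra..].
      + replace (S j - k)%nat with 0%nat by lia. replace (j - k)%nat with 0%nat by lia.
        apply hook_first_cell_covers. }
  assert (Hzig := zig_path lo hi K Hb Hc).
  set (l := fun i => match i with O => embed (Ropp 1) | S i' => zig_low lo hi i' end).
  set (r := fun i => match i with O => embed (- cut) | S i' => zig_high lo hi i' end).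
  destruct (loop (fold hook) l r (S (2 * K))) as (t & Ht & Hin).
  - apply fold_continuity, hook_signed.
  - intros [|i] Hle; simpl; [unfold embed; lra | apply Hzig; lia].
  - intros [|i] Hlt; [|apply Hzig; lia].
    simpl. rewrite (proj1 (zig_0 lo hi)), (proj2 (zig_0 lo hi)).
    rewrite Elo, Ehi by lia. replace (0 - k)%nat with 0%nat by lia. simpl.
    exists (embed (Ropp 1)), (embed (- cut)). rewrite !fold_left by lra.
    rewrite hook_one, hook_cut. unfold embed; lra.
  - change (zig_low lo hi (2 * K) = embed (Ropp 1)). rewrite (proj1 (zig_even lo hi K)), EhiK. easy.
  - change (zig_high lo hi (2 * K) = embed (- cut)). rewrite (proj2 (zig_even lo hi K)), EloK. easy.
  - assert (H0 := Hin 0%nat ltac:(lia)). simpl in H0. unfold embed in H0.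
    exists t. split; [lra|]. split; [lia|]. split; [exact Ht|].
    (* The orbit visits the leftmost interval only once. *)
    intros q Hq E. specialize (Hin q ltac:(lia)). rewrite E in Hin.
    destruct q as [|q]; [lia|]. simpl in Hin.
    destruct (Nat.Even_or_Odd q) as [[j Ej]|[j Ej]].
    + rewrite Ej, (proj1 (zig_even _ _ _)), (proj2 (zig_even _ _ _)), Ehi in Hin by lia.
      assert (H := mesh_mult (S (j - k)) ltac:(lia)). unfold embed in Hin. lra.
    + replace q with (S (2 * j)) in Hin by lia.
      rewrite (proj1 (zig_odd _ _ _)) in Hin. specialize (Hb (S j) ltac:(lia)).
      unfold embed in Hin. lra.
Qed.

Lemma period_two_exists : interval_periods (fold hook) 2.
Proof.
  assert (Hcut := cut_bounds). assert (Hi := INRm). assert (He := mesh_pos).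
  assert (Hme : 0 < INR m * mesh) by nra.
  destruct (ivt_between (fun y => hook y - y) (INR m * mesh) cut 0) as (y & Hy & Ey).
  - assert (H := proj1 hook_signed). prove_continuity.
  - lra.
  - right. rewrite hook_top, hook_cut. lra.
  - exists (embed y). split; [unfold embed; lra|]. split; [lia|].
    assert (E1 : fold hook (embed y) = embed (- y)) by (apply fold_right; [apply hook_signed | lra]).
    split.
    + simpl. rewrite E1, fold_left by lra. f_equal; lra.
    + intros q Hq. replace q with 1%nat by lia. simpl. rewrite E1. intros E.
      apply embed_inj in E. lra.
Qed.

(** The descending interval from [INR m * mesh] to [cut] covers itself and the last cell,
    which covers it in return. The loop visits the last cell once. *)
Lemma even_periods_exist : forall k, (2 <= k)%nat -> interval_periods (fold hook) (2 * k).
Proof.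
  intros k Hk.
  assert (He := mesh_pos). assert (Eq := mesh_eq). assert (Hcut := cut_bounds).
  assert (Hi := INRm). assert (Hm1 : INR m = INR (m - 1) + 1) by (rewrite <- S_INR; f_equal; lia).
  assert (H0 := pos_INR (m - 1)).
  set (base := fun j => ((j =? 0) || (j =? k))%nat%bool).
  set (lo := fun j => if base j then INR (m - 1) * mesh else INR m * mesh).
  set (hi := fun j => if base j then INR m * mesh else cut).
  assert (Hcases : forall j, (j = 0%nat \/ j = k) /\ lo j = INR (m - 1) * mesh /\ hi j = INR m * mesh
                    \/ j <> 0%nat /\ j <> k /\ lo j = INR m * mesh /\ hi j = cut).
  { intros j. unfold lo, hi, base.
    destruct (Nat.eqb_spec j 0); [left; simpl; tauto|].
    destruct (Nat.eqb_spec j k); [left | right]; simpl; tauto. }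
  assert (Hb : forall j, 0 <= lo j /\ lo j <= hi j /\ hi j <= 1).
  { intros j. destruct (Hcases j) as [(_ & -> & ->)|(_ & _ & -> & ->)];
      (split; [nra|]); split; nra. }
  assert (Htop : hook (INR m * mesh) = 1) by apply hook_top.
  assert (Hc : forall j, (j < k)%nat -> covers hook (lo j) (hi j) (lo (S j)) (hi (S j))).
  { intros j Hj. assert (Hb' := Hb (S j)).
    destruct (Hcases j) as [(Hj0 & -> & ->)|(_ & _ & -> & ->)].
    - destruct (Hcases (S j)) as [(Hj' & _)|(_ & _ & -> & ->)]; [lia|].
      exists (INR (m - 1) * mesh), (INR m * mesh).
      assert (H := hook_bounds (INR (m - 1) * mesh)). rewrite Htop.
      assert (INR m * mesh = INR (m - 1) * mesh + mesh) by (rewrite Hm1 at 1; ring). lra.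
    - exists cut, (INR m * mesh). rewrite hook_cut. split; [lra|]. split; [lra|]. lra. }
  assert (Hzig := zig_path lo hi k (fun j _ => Hb j) Hc).
  assert (Hends : lo k = lo 0%nat /\ hi k = hi 0%nat).
  { destruct (Hcases k) as [(_ & -> & ->)|]; [|lia].
    destruct (Hcases 0%nat) as [(_ & -> & ->)|]; [easy|lia]. }
  destruct (loop (fold hook) (zig_low lo hi) (zig_high lo hi) (2 * k)) as (t & Ht & Hin).
  - apply fold_continuity, hook_signed.
  - intros i Hle. apply Hzig; lia.
  - intros i Hlt. apply Hzig; lia.
  - rewrite (proj1 (zig_even _ _ k)), (proj1 (zig_0 _ _)). destruct Hends as [_ ->]; easy.
  - rewrite (proj2 (zig_even _ _ k)), (proj2 (zig_0 _ _)). destruct Hends as [-> _]; easy.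
  - assert (Ht0 := Hin 0%nat ltac:(lia)). change (Nat.iter 0 (fold hook) t) with t in Ht0.
    rewrite (proj1 (zig_0 _ _)), (proj2 (zig_0 _ _)) in Ht0.
    destruct (Hcases 0%nat) as [(_ & E1 & E2)|]; [rewrite E1, E2 in Ht0 | lia].
    destruct (embed_onto t) as (x & -> & Hx).
    { unfold embed in Ht0. assert (INR m * mesh <= 1) by lra. nra. }
    assert (Hx' : - (INR m * mesh) <= x <= - (INR (m - 1) * mesh)) by (unfold embed in Ht0; lra).
    assert (H1 := Hin 1%nat ltac:(lia)).
    rewrite (proj1 (zig_1 _ _)), (proj2 (zig_1 _ _)) in H1.
    destruct (Hcases 1%nat) as [(Hbad & _)|(_ & _ & E3 & E4)]; [lia|].
    rewrite E3, E4 in H1. simpl Nat.iter in H1.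
    replace x with (- - x) in H1 by lra.
    rewrite fold_left in H1 by nra.
    assert (Hhook : INR m * mesh <= hook (- x) <= cut) by (unfold embed in H1; lra).
    exists (embed x). split; [unfold embed; nra|]. split; [lia|]. split; [exact Ht|].
    (* A return before time 2 k would put the point on the boundary of its interval,
       and the first step excludes both boundary points. *)
    intros q Hq E. specialize (Hin q ltac:(lia)). rewrite E in Hin.
    destruct (Nat.Even_or_Odd q) as [[j Ej]|[j Ej]].
    + rewrite Ej, (proj1 (zig_even _ _ _)), (proj2 (zig_even _ _ _)) in Hin.
      destruct (Hcases j) as [(Hbad & _)|(_ & _ & E5 & E6)]; [lia|].
      rewrite E5, E6 in Hin. unfold embed in Hin.
      replace (- x) with (INR m * mesh) in Hhook by lra. lra.
    + replace q with (S (2 * j)) in Hin by lia.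
      rewrite (proj1 (zig_odd _ _ _)) in Hin. assert (Hb' := Hb (S j)).
      unfold embed in Hin. assert (Hx0 : - x = 0) by nra.
      rewrite Hx0, hook_doubling in Hhook by lra. nra.
Qed.

Theorem hook_periods : forall n, interval_periods (fold hook) n <->
  (0 < n)%nat /\ (Nat.Odd n -> n = 1%nat \/ (2 * m + 1 <= n)%nat).
Proof.
  intros n; split.
  - intros H. split; [destruct H as (_ & _ & Hn & _); exact Hn|].
    apply odd_period_lower_bound, H.
  - intros [Hn Hodd]. destruct (Nat.Even_or_Odd n) as [[k Hk]|Ho].
    + destruct (Nat.eq_dec k 1) as [->|]; rewrite Hk.
      * apply period_two_exists.
      * apply even_periods_exist; lia.
    + destruct (Hodd Ho) as [->|Hle].
      * apply fold_has_fixed, hook_signed.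
      * destruct Ho as [k ->]. replace (2 * k + 1)%nat with (S (2 * ((k - m) + m))) by lia.
        apply odd_periods_exist.
Qed.
End Odd.

(** * Initial segments of the Sharkovsky order *)

Lemma two_adic : forall n, (0 < n)%nat ->
  exists e p, n = (2 ^ e * p)%nat /\ Nat.Odd p.
Proof.
  induction n as [n IH] using lt_wf_ind; intros Hn.
  destruct (Nat.Even_or_Odd n) as [[k Hk]|Ho].
  - destruct (IH k ltac:(lia) ltac:(lia)) as (e & p & E & Hp).
    exists (S e), p. split; [simpl; lia | exact Hp].
  - exists 0%nat, n. split; [simpl; lia | exact Ho].
Qed.

Lemma two_adic_unique : forall e f p q, Nat.Odd p -> Nat.Odd q ->
  (2 ^ e * p = 2 ^ f * q)%nat -> e = f /\ p = q.
Proof.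
  induction e as [|e IH]; intros [|f] p q Hp Hq E.
  - simpl in E; lia.
  - exfalso. destruct Hp as [i Hi]. simpl in E. lia.
  - exfalso. destruct Hq as [i Hi]. simpl in E. lia.
  - destruct (IH f p q Hp Hq) as [-> ->]; [simpl in E; lia | easy].
Qed.

Lemma Odd_1 : Nat.Odd 1.
Proof. exists 0%nat; easy. Qed.

Lemma Sh_nat_iff : forall n n_pos k,
  Sh (NSh_nat n n_pos) k <-> (0 < k)%nat /\ (k = n \/ sh_gt_nat n k).
Proof.
  intros n n_pos k; split.
  - intros [k_pos [E|H]]; split; try exact k_pos.
    + left. injection E; easy.
    + right. exact H.
  - intros [k_pos [->|H]]; exists k_pos.
    + left. f_equal. apply le_unique.
    + right. exact H.
Qed.

(** The initial segment below [2 ^ e * p] for an odd [p > 1], in terms of the decomposition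
    [2 ^ f * q] into a power of two and an odd number. Unlike the given order, this form
    makes the effect of doubling evident. *)
Definition sh_tail (e p k : nat) : Prop :=
  exists f q, k = (2 ^ f * q)%nat /\ Nat.Odd q /\
    (q = 1 \/ e < f \/ e = f /\ p <= q)%nat.

Lemma Sh_odd : forall e p pos, odd_gt1 p ->
  forall k, Sh (NSh_nat (2 ^ e * p) pos) k <-> sh_tail e p k.
Proof.
  intros e p pos Hp k. rewrite Sh_nat_iff. split.
  - intros [_ [->|H]]; [exists e, p; split; [easy|]; split; [apply Hp | lia]|].
    remember (2 ^ e * p)%nat as N eqn:EN. destruct Hp as [Hodd Hp1].
    destruct H as [e' p' q [Hp' _] [Hq _] Hlt | e' f p' q [Hp' _] [Hq _] Hlt
                  | e' f p' [Hp' _] | e' f Hlt].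
    + destruct (two_adic_unique e' e p' p Hp' Hodd EN) as [-> ->].
      exists e, q. split; [easy|]. split; [exact Hq | lia].
    + destruct (two_adic_unique e' e p' p Hp' Hodd EN) as [-> ->].
      exists f, q. split; [easy|]. split; [exact Hq | lia].
    + exists f, 1%nat. split; [lia|]. split; [apply Odd_1 | lia].
    + destruct (two_adic_unique e' e 1 p Odd_1 Hodd ltac:(lia)) as [_ <-]. lia.
  - intros (f & q & -> & Hq & H).
    assert (Hpow : forall i, (0 < 2 ^ i)%nat) by (intros i; apply Nat.neq_0_lt_0, Nat.pow_nonzero; lia).
    assert (Hq0 : (0 < q)%nat) by (destruct Hq; lia).
    split; [specialize (Hpow f); nia|].
    destruct (Nat.eq_dec q 1) as [->|Hq1].
    + right. rewrite Nat.mul_1_r. apply sh_gt_odd_pow2, Hp.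
    + assert (Hqg : odd_gt1 q) by (split; [exact Hq | lia]).
      destruct H as [|[H|[<- H]]]; [lia | right; apply sh_gt_lower_level; easy |].
      destruct (Nat.eq_dec p q) as [->|]; [left; easy | right].
      apply sh_gt_same_level; try easy; lia.
Qed.

Lemma Sh_pow2 : forall e pos k,
  Sh (NSh_nat (2 ^ e) pos) k <-> exists f, (f <= e)%nat /\ k = (2 ^ f)%nat.
Proof.
  intros e pos k. rewrite Sh_nat_iff. split.
  - intros [_ [->|H]]; [exists e; easy|].
    remember (2 ^ e)%nat as N eqn:EN.
    assert (Hbad : forall e' p', odd_gt1 p' -> (2 ^ e' * p' = 2 ^ e)%nat -> False).
    { intros e' p' [Hp Hp1] E.
      destruct (two_adic_unique e' e p' 1 Hp Odd_1 ltac:(lia)) as [_ ->]. lia. }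
    destruct H as [e' p q Hp _ _ | e' f p q Hp _ _ | e' f p Hp | e' f Hf];
      try (exfalso; exact (Hbad _ _ Hp EN)).
    exists f. split; [|easy]. apply Nat.pow_inj_r in EN; lia.
  - intros (f & Hf & ->). split; [apply Nat.neq_0_lt_0, Nat.pow_nonzero; lia|].
    destruct (Nat.eq_dec f e) as [->|]; [left; easy | right; apply sh_gt_pow2; lia].
Qed.

Lemma Sh_two_inf : forall k, Sh NSh_two_inf k <-> exists f, k = (2 ^ f)%nat.
Proof.
  intros k; split.
  - intros [k_pos [E|H]]; [discriminate | exact H].
  - intros [f ->].
    assert (pos : (0 < 2 ^ f)%nat) by (apply Nat.neq_0_lt_0, Nat.pow_nonzero; lia).
    exists pos. right. exists f; easy.
Qed.

Lemma NSh_cases : forall s,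
  (exists e, forall k, Sh s k <-> exists f, (f <= e)%nat /\ k = (2 ^ f)%nat) \/
  (forall k, Sh s k <-> exists f, k = (2 ^ f)%nat) \/
  (exists e p, odd_gt1 p /\ forall k, Sh s k <-> sh_tail e p k).
Proof.
  intros [n pos|]; [|right; left; apply Sh_two_inf].
  destruct (two_adic n pos) as (e & p & E & Hp). subst n.
  destruct (Nat.eq_dec p 1) as [->|].
  - left. exists e. revert pos. rewrite Nat.mul_1_r. apply Sh_pow2.
  - assert (odd_gt1 p) by (split; [easy | destruct Hp; lia]).
    right; right. exists e, p. split; [easy | apply Sh_odd; easy].
Qed.

Lemma sh_tail_pow2 : forall e p f, sh_tail e p (2 ^ f).
Proof. intros. exists f, 1%nat. split; [lia|]. split; [apply Odd_1 | lia]. Qed.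

(** This is what reduces the case c = d, where both ends insert periods at the same
    rotation number, to a single initial segment. *)
Lemma Sh_total : forall s s',
  (forall k, Sh s k -> Sh s' k) \/ (forall k, Sh s' k -> Sh s k).
Proof.
  intros s s'.
  destruct (NSh_cases s) as [(e & H)|[H|(e & p & _ & H)]];
  destruct (NSh_cases s') as [(e' & H')|[H'|(e' & p' & _ & H')]].
  - destruct (le_lt_dec e e'); [left | right]; intros k; rewrite H, H';
      intros (f & Hf & ->); exists f; (split; [lia | easy]).
  - left; intros k; rewrite H, H'. intros (f & _ & ->); exists f; easy.
  - left; intros k; rewrite H, H'. intros (f & _ & ->); apply sh_tail_pow2.
  - right; intros k; rewrite H, H'. intros (f & _ & ->); exists f; easy.
  - left; intros k; rewrite H, H'; easy.
  - left; intros k; rewrite H, H'. intros (f & ->); apply sh_tail_pow2.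
  - right; intros k; rewrite H, H'. intros (f & _ & ->); apply sh_tail_pow2.
  - right; intros k; rewrite H, H'. intros (f & ->); apply sh_tail_pow2.
  - assert (C : (e' < e \/ e = e' /\ p' <= p \/ e < e' \/ e = e' /\ p <= p')%nat) by lia.
    destruct C as [C|[C|[C|C]]]; [left | left | right | right]; intros k; rewrite H, H';
      intros (f & q & -> & Hq & Hc); exists f, q; (split; [easy | split; [exact Hq | lia]]).
Qed.

Lemma Sh_one : forall s, Sh s 1.
Proof.
  intros s. destruct (NSh_cases s) as [(e & ->)|[->|(e & p & _ & ->)]].
  - exists 0%nat; split; [lia | easy].
  - exists 0%nat; easy.
  - apply (sh_tail_pow2 e p 0).
Qed.

Lemma fold_iter_id_periods : forall e n,
  interval_periods (Nat.iter e fold (fun t => t)) n <-> exists f, (f <= e)%nat /\ n = (2 ^ f)%nat.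
Proof.
  induction e as [|e IH]; intros n.
  - simpl. rewrite interval_periods_id. split.
    + intros ->. exists 0%nat; easy.
    + intros (f & Hf & ->). replace f with 0%nat by lia. easy.
  - rewrite iter_S, fold_doubles_periods
      by apply (iter_fold_interval_map e _ interval_map_id). split.
    + intros [->|(k & -> & Hk)]; [exists 0%nat; split; [lia | easy]|].
      apply IH in Hk. destruct Hk as (f & Hf & ->). exists (S f). split; [lia | easy].
    + intros ([|f] & Hf & ->); [left; easy | right].
      exists (2 ^ f)%nat. split; [easy|]. apply IH. exists f. split; [lia | easy].
Qed.

Lemma fold_iter_hook_periods : forall m, (1 <= m)%nat -> forall e n,
  interval_periods (Nat.iter e fold (fold (hook m))) n <-> sh_tail e (2 * m + 1) n.
Proof.
  intros m Hm. assert (Him := fold_interval_map _ (hook_signed m Hm)).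
  induction e as [|e IH]; intros n.
  - simpl Nat.iter. rewrite hook_periods by exact Hm. split.
    + intros [Hn Hodd]. destruct (two_adic n Hn) as (f & q & -> & Hq).
      exists f, q. split; [easy|]. split; [exact Hq|].
      destruct f as [|f]; [|lia]. rewrite Nat.pow_0_r, Nat.mul_1_l in Hodd. 
      specialize (Hodd Hq). lia.
    + intros (f & q & -> & Hq & H).
      assert (Hpow : (0 < 2 ^ f)%nat) by (apply Nat.neq_0_lt_0, Nat.pow_nonzero; lia).
      split; [destruct Hq; nia|]. intros [k Hk].
      destruct f as [|f]; [simpl; lia|]. simpl in Hk; lia.
  - rewrite iter_S, fold_doubles_periods by apply (iter_fold_interval_map e _ Him). split.
    + intros [->|(k & -> & Hk)]; [apply (sh_tail_pow2 (S e) _ 0)|].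
      apply IH in Hk. destruct Hk as (f & q & -> & Hq & H).
      exists (S f), q. split; [simpl; lia|]. split; [exact Hq | lia].
    + intros ([|f] & q & -> & Hq & H); [left; simpl; lia | right].
      exists (2 ^ f * q)%nat. split; [simpl; lia|]. apply IH.
      exists f, q. split; [easy|]. split; [exact Hq | lia].
Qed.

Theorem sharkovsky_realization : forall s,
  exists g, interval_map g /\ forall n, interval_periods g n <-> Sh s n.
Proof.
  intros s. destruct (NSh_cases s) as [(e & H)|[H|(e & p & [[m Hp] Hp1] & H)]].
  - exists (Nat.iter e fold (fun t => t)).
    split; [apply iter_fold_interval_map, interval_map_id|].
    intros n. rewrite H. apply fold_iter_id_periods.
  - exists fold_limit. split; [apply fold_limit_interval_map|].
    intros n. rewrite H. apply fold_limit_periods.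
  - assert (Hm : (1 <= m)%nat) by lia.
    exists (Nat.iter e fold (fold (hook m))).
    split; [apply iter_fold_interval_map, fold_interval_map, hook_signed, Hm|].
    intros n. rewrite H, Hp. apply fold_iter_hook_periods, Hm.
Qed.

(** * Lifts of circle maps of degree one *)

Definition lift (f : R -> R) : Prop :=
  continuity f /\ forall x, f (x + 1) = f x + 1.

Definition circle_period (f : R -> R) (x : R) (n : nat) : Prop :=
  (0 < n)%nat /\ (exists k, Nat.iter n f x = x + IZR k) /\
  forall m, (0 < m < n)%nat -> ~ exists k, Nat.iter m f x = x + IZR k.

Lemma IZR_pred : forall k, IZR (Z.pred k) = IZR k - 1.
Proof. intros. rewrite <- Z.sub_1_r. apply minus_IZR. Qed.

Lemma lift_shift : forall f, lift f -> forall x k, f (x + IZR k) = f x + IZR k.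
Proof.
  intros f [_ Hf] x k. revert x. induction k as [|k IH|k IH] using Z.peano_ind; intros x.
  - rewrite !Rplus_0_r; easy.
  - rewrite succ_IZR, <- Rplus_assoc, Hf, IH. lra.
  - assert (H := Hf (x + IZR (Z.pred k))). rewrite IZR_pred in *.
    replace (x + (IZR k - 1) + 1) with (x + IZR k) in H by lra. rewrite IH in H. lra.
Qed.

Lemma iter_lift_shift : forall f, lift f -> forall n x k,
  Nat.iter n f (x + IZR k) = Nat.iter n f x + IZR k.
Proof.
  intros f Hf n x k. induction n; simpl; [easy|]. rewrite IHn. apply lift_shift, Hf.
Qed.

Lemma return_orbit : forall f, lift f -> forall n x k i N,
  Nat.iter n f x = x + IZR k ->
  Nat.iter n f (Nat.iter i f x + IZR N) = Nat.iter i f x + IZR N + IZR k.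
Proof.
  intros f Hf n x k i N H.
  rewrite iter_lift_shift, <- iter_add, Nat.add_comm, iter_add, H, iter_lift_shift by easy.
  lra.
Qed.

Lemma return_multiple : forall f, lift f -> forall n x k i,
  Nat.iter n f x = x + IZR k -> Nat.iter (i * n) f x = x + INR i * IZR k.
Proof.
  intros f Hf n x k i H. induction i as [|i IH]; [simpl; lra|].
  rewrite S_INR. simpl Nat.mul. rewrite iter_add, IH.
  rewrite INR_IZR_INZ, <- mult_IZR, iter_lift_shift, H by easy. rewrite mult_IZR. lra.
Qed.

(** Both sides are the displacement after [n * m] steps. *)
Lemma return_ratio : forall f, lift f -> forall n m x k j,
  Nat.iter n f x = x + IZR k -> Nat.iter m f x = x + IZR j ->
  (k * Z.of_nat m = j * Z.of_nat n)%Z.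
Proof.
  intros f Hf n m x k j Hn Hm.
  apply (return_multiple f Hf _ _ _ m) in Hn. apply (return_multiple f Hf _ _ _ n) in Hm.
  rewrite Nat.mul_comm, Hm in Hn. apply eq_IZR. rewrite !mult_IZR, <- !INR_IZR_INZ. lra.
Qed.

Lemma archimedean_bound : forall y K, (forall i, INR i * y <= K) -> y <= 0.
Proof.
  intros y K Hy. apply Rnot_lt_le; intros Hpos.
  destruct (INR_unbounded (K / y)) as [i Hi]. specialize (Hy i).
  apply Rlt_div_l in Hi; lra.
Qed.

Lemma return_within : forall f, lift f -> forall c d K z n k,
  (forall i, z + INR i * c - K <= Nat.iter i f z <= z + INR i * d + K) ->
  Nat.iter n f z = z + IZR k -> INR n * c <= IZR k <= INR n * d.
Proof.
  intros f Hf c d K z n k Hbound Hk.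
  assert (Hlin : forall i, INR i * (IZR k - INR n * d) <= K /\ INR i * (INR n * c - IZR k) <= K).
  { intros i. assert (H := Hbound (i * n)%nat).
    rewrite (return_multiple f Hf n z k i Hk), mult_INR in H. nra. }
  assert (Hd := archimedean_bound _ _ (fun i => proj1 (Hlin i))).
  assert (Hc := archimedean_bound _ _ (fun i => proj2 (Hlin i))). lra.
Qed.

Lemma circle_period_orbit : forall f, lift f -> forall x n i N,
  circle_period f x n -> circle_period f (Nat.iter i f x + IZR N) n.
Proof.
  intros f Hf x n i N (Hn & [k Hk] & Hmin). split; [exact Hn|]. split.
  - exists k. apply return_orbit; easy.
  - intros m Hm [j Hj]. apply (Hmin m Hm). exists j.
    (* Run the orbit on to time (i + 1) * n, where it is a translate of [x]. *)
    rewrite iter_lift_shift in Hj by exact Hf.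
    assert (E : Nat.iter m f (Nat.iter i f x) = Nat.iter i f x + IZR j) by lra.
    set (r := ((i + 1) * n - i)%nat).
    assert (Er : Nat.iter r f (Nat.iter i f x) = x + IZR (Z.of_nat (i + 1) * k)).
    { rewrite <- iter_add. replace (r + i)%nat with ((i + 1) * n)%nat by (unfold r; nia).
      rewrite (return_multiple f Hf n x k) by easy.
      rewrite mult_IZR, <- INR_IZR_INZ. easy. }
    assert (E2 := f_equal (Nat.iter r f) E).
    rewrite <- iter_add, Nat.add_comm, iter_add, Er, !iter_lift_shift, Er in E2 by easy. lra.
Qed.

Lemma return_reduced : forall (n q : nat) (k p : Z), (0 < q)%nat ->
  rel_prime p (Z.of_nat q) -> (k * Z.of_nat q = p * Z.of_nat n)%Z ->
  exists m, n = (q * m)%nat /\ k = (Z.of_nat m * p)%Z.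
Proof.
  intros n q k p Hq Hrel E.
  destruct (Gauss (Z.of_nat q) p (Z.of_nat n)) as [m Hm].
  - exists k. lia.
  - apply rel_prime_sym, Hrel.
  - assert (Hm0 : (0 <= m)%Z) by (apply (Zmult_le_0_reg_r (Z.of_nat q)); lia).
    exists (Z.to_nat m). rewrite Z2Nat.id by exact Hm0. split.
    + apply Nat2Z.inj. rewrite Nat2Z.inj_mul, Z2Nat.id by exact Hm0. lia.
    + apply (Z.mul_reg_r _ _ (Z.of_nat q)); [lia|]. rewrite E, Hm. ring.
Qed.

Lemma reduce_fraction : forall (n : nat) (k : Z), (0 < n)%nat ->
  exists m q p, (0 < m)%nat /\ (0 < q)%nat /\ n = (q * m)%nat /\
    k = (Z.of_nat m * p)%Z /\ rel_prime p (Z.of_nat q).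
Proof.
  intros n k Hn. set (g := Z.gcd k (Z.of_nat n)).
  assert (Hg0 : (0 <= g)%Z) by apply Z.gcd_nonneg.
  assert (Hgn : g <> 0%Z) by (intros E; apply Z.gcd_eq_0_r in E; lia).
  destruct (Z.gcd_divide_l k (Z.of_nat n)) as [p Hp]. fold g in Hp.
  destruct (Z.gcd_divide_r k (Z.of_nat n)) as [q Hq]. fold g in Hq.
  assert (0 < q)%Z by nia.
  exists (Z.to_nat g), (Z.to_nat q), p.
  split; [lia|]. split; [lia|]. split; [nia|]. split; [lia|].
  assert (H' := Zis_gcd_rel_prime k (Z.of_nat n) g ltac:(lia) ltac:(lia) (Zgcd_is_gcd _ _)).
  rewrite Hp, Hq, !Z.div_mul in H' by exact Hgn.
  replace (Z.of_nat (Z.to_nat q)) with q by lia. exact H'.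
Qed.

(** Its periodic points are the points periodic modulo 1 for [f] of rotation number [p / q]. *)
Definition turn_back (f : R -> R) (q : nat) (p : Z) (x : R) : R := Nat.iter q f x - IZR p.

Lemma iter_turn_back : forall f, lift f -> forall q p l x,
  Nat.iter l (turn_back f q p) x = Nat.iter (q * l) f x - INR l * IZR p.
Proof.
  intros f Hf q p l x. induction l as [|l IH].
  - rewrite Nat.mul_0_r. simpl. lra.
  - rewrite iter_S, IH. unfold turn_back.
    replace (q * S l)%nat with (q + q * l)%nat by lia. rewrite iter_add, S_INR.
    replace (Nat.iter (q * l) f x - INR l * IZR p)
      with (Nat.iter (q * l) f x + IZR (- (Z.of_nat l * p))).
    + rewrite iter_lift_shift by exact Hf.
      rewrite opp_IZR, mult_IZR, <- INR_IZR_INZ. lra.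
    + rewrite opp_IZR, mult_IZR, <- INR_IZR_INZ. lra.
Qed.

(** * Periodic orbits at a rational end *)

Section Cells.
Context (f : R -> R) (Hf : lift f) (p : Z) (q : nat) (Hq : (0 < q)%nat)
  (Hpq : rel_prime p (Z.of_nat q)) (x0 h : R) (Hh : 0 < h) (g : R -> R)
  (Hg : forall t, 0 <= t <= 1 -> 0 <= g t <= 1)
  (Hturn : forall t, 0 <= t <= 1 -> turn_back f q p (x0 + h * t) = x0 + h * g t).

Lemma turn_back_insert : forall l t, 0 <= t <= 1 ->
  0 <= Nat.iter l g t <= 1 /\
  Nat.iter l (turn_back f q p) (x0 + h * t) = x0 + h * Nat.iter l g t.
Proof.
  intros l t Ht. induction l as [|l [IH1 IH2]]; [easy|].
  rewrite !iter_S, IH2, Hturn by easy. split; [apply Hg, IH1 | easy].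
Qed.

(** Returns of [f] have rotation number p / q in lowest terms, so their times are multiples
    of [q], and there only [g] matters. *)
Lemma inserted_period : forall t m, 0 <= t <= 1 -> least_return g t m ->
  circle_period f (x0 + h * t) (q * m).
Proof.
  intros t m Ht (Hm & Hret & Hmin). split; [nia|].
  assert (Hback : Nat.iter (q * m) f (x0 + h * t) = x0 + h * t + IZR (Z.of_nat m * p)).
  { assert (E := iter_turn_back f Hf q p m (x0 + h * t)).
    rewrite (proj2 (turn_back_insert m t Ht)), Hret in E.
    rewrite mult_IZR, <- INR_IZR_INZ. lra. }
  split; [eexists; exact Hback|].
  intros r Hr [k Hk].
  assert (E := return_ratio f Hf _ _ _ _ _ Hk Hback).
  destruct (return_reduced r q k p Hq Hpq) as (r' & Er & Ek); [nia|].
  apply (Hmin r'); [nia|].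
  assert (E' := iter_turn_back f Hf q p r' (x0 + h * t)).
  rewrite (proj2 (turn_back_insert r' t Ht)), <- Er, Hk, Ek, mult_IZR, <- INR_IZR_INZ in E'.
  apply (Rmult_eq_reg_l h); lra.
Qed.

Context (x : Z -> R) (Ex0 : x 0%Z = x0)
  (Hdeg : forall j, x (j + Z.of_nat q)%Z = x j + 1)
  (Hbelow : forall y j, y <= x j -> f y <= x (j + p)%Z)
  (Hright : forall z, x0 + h <= z <= x 1%Z -> turn_back f q p z <= z).

Lemma cell_shift : forall j N, x (j + N * Z.of_nat q)%Z = x j + IZR N.
Proof.
  intros j N. revert j. induction N as [|N IH|N IH] using Z.peano_ind; intros j.
  - rewrite Z.mul_0_l, Z.add_0_r. lra.
  - replace (j + Z.succ N * Z.of_nat q)%Z with (j + N * Z.of_nat q + Z.of_nat q)%Z by lia.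
    rewrite Hdeg, IH, succ_IZR. lra.
  - assert (H := Hdeg (j + Z.pred N * Z.of_nat q)).
    replace (j + Z.pred N * Z.of_nat q + Z.of_nat q)%Z with (j + N * Z.of_nat q)%Z in H by lia.
    rewrite IH in H. rewrite IZR_pred. lra.
Qed.

Lemma below_iter : forall i y j, y <= x j -> Nat.iter i f y <= x (j + Z.of_nat i * p)%Z.
Proof.
  intros i y j Hy. induction i as [|i IH].
  - simpl. replace (j + 0)%Z with j by lia. exact Hy.
  - rewrite iter_S. replace (j + Z.of_nat (S i) * p)%Z with (j + Z.of_nat i * p + p)%Z by lia.
    apply Hbelow, IH.
Qed.

Lemma find_cell : forall z, exists j, x (j - 1)%Z < z <= x j.
Proof.
  intros z.
  destruct (archimed (z - x 0%Z)) as [Hup1 Hup2].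
  set (N := up (z - x 0%Z)) in *.
  assert (HN := cell_shift 0 N). assert (HL := cell_shift 0 (N - 2)).
  rewrite Z.add_0_l in HN, HL. rewrite minus_IZR in HL.
  set (L := ((N - 2) * Z.of_nat q)%Z) in *.
  destruct (dec_inh_nat_subset_has_unique_least_element
              (fun i => z <= x (L + Z.of_nat i)%Z)) as (i & [Hi Hleast] & _).
  - intros i. destruct (Rle_lt_dec z (x (L + Z.of_nat i)%Z)); [left | right]; lra.
  - exists (2 * q)%nat. replace (L + Z.of_nat (2 * q))%Z with (N * Z.of_nat q)%Z by (unfold L; lia).
    lra.
  - exists (L + Z.of_nat i)%Z. split; [|exact Hi].
    apply Rnot_le_lt; intros Hle. destruct i as [|i].
    + simpl in Hi. replace (L + 0)%Z with L in Hi by lia. lra.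
    + replace (L + Z.of_nat (S i) - 1)%Z with (L + Z.of_nat i)%Z in Hle by lia.
      apply Hleast in Hle. lia.
Qed.

(** No orbit overtakes the points [x j], which rotate at the rate p / q. A periodic orbit of
    the same rotation number therefore stays in step with them. *)
Lemma periodic_keeps_cell : forall z n k j, (0 < n)%nat ->
  Nat.iter n f z = z + IZR k -> (k * Z.of_nat q = p * Z.of_nat n)%Z ->
  x (j - 1)%Z < z <= x j ->
  forall i, x (j - 1 + Z.of_nat i * p)%Z < Nat.iter i f z <= x (j + Z.of_nat i * p)%Z.
Proof.
  intros z n k j Hn Hk Hrat Hj i. split; [|apply below_iter; lra].
  apply Rnot_le_lt; intros Hle.
  (* A point that lags by one cell never makes up for it. *)
  assert (H := below_iter (n * (i + 1) - i) _ _ Hle).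
  rewrite <- iter_add in H. replace (n * (i + 1) - i + i)%nat with ((i + 1) * n)%nat in H by nia.
  rewrite (return_multiple f Hf n z k) in H by easy.
  replace (j - 1 + Z.of_nat i * p + Z.of_nat (n * (i + 1) - i) * p)%Z
    with (j - 1 + (Z.of_nat (i + 1) * k) * Z.of_nat q)%Z in H by nia.
  rewrite cell_shift, mult_IZR, <- INR_IZR_INZ in H. lra.
Qed.

(** An orbit in step with the points [x j] visits, up to translation, the cell right of
    [x0], as p and q are coprime. In this cell [turn_back f q p] is [g] on the inserted copy
    and moves no point right of the copy to the right, so that a periodic orbit either
    lies in the copy or is fixed. *)
Theorem periods_at_rotation : forall z n k,
  circle_period f z n -> Nat.iter n f z = z + IZR k -> (k * Z.of_nat q = p * Z.of_nat n)%Z ->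
  exists m, n = (q * m)%nat /\ (m = 1%nat \/ interval_periods g m).
Proof.
  intros z n k Hper Hk Hrat.
  destruct (return_reduced n q k p Hq Hpq Hrat) as (m & En & Ek).
  assert (Hn : (0 < n)%nat) by apply Hper.
  assert (Hmove : exists z', circle_period f z' n /\ Nat.iter n f z' = z' + IZR k /\
                    x 0%Z < z' <= x 1%Z).
  { destruct (find_cell z) as [j Hj].
    destruct (rel_prime_bezout _ _ Hpq) as [u v Huv].
    set (w := ((1 - j) * u)%Z).
    assert (Hmod := Z.mod_pos_bound w (Z.of_nat q) ltac:(lia)).
    assert (Hdiv := Z.div_mod w (Z.of_nat q) ltac:(lia)).
    set (i := Z.to_nat (w mod Z.of_nat q)).
    set (N := (- (v * (1 - j) + w / Z.of_nat q * p))%Z).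
    assert (Ei : (j + Z.of_nat i * p = 1 + N * Z.of_nat q)%Z).
    { unfold i, N. rewrite Z2Nat.id by lia.
      replace (w mod Z.of_nat q)%Z with (w - Z.of_nat q * (w / Z.of_nat q))%Z by lia.
      set (t := (w / Z.of_nat q)%Z). unfold w.
      replace (j + ((1 - j) * u - Z.of_nat q * t) * p)%Z
        with (j + (1 - j) * (u * p) - Z.of_nat q * t * p)%Z by ring.
      replace (u * p)%Z with (1 - v * Z.of_nat q)%Z by lia. ring. }
    exists (Nat.iter i f z + IZR (- N)). split; [apply circle_period_orbit; easy|].
    split; [apply return_orbit; easy|].
    assert (H := periodic_keeps_cell z n k j Hn Hk Hrat Hj i).
    replace (j - 1 + Z.of_nat i * p)%Z with (0 + N * Z.of_nat q)%Z in H by lia.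
    rewrite Ei, !cell_shift in H. rewrite opp_IZR. lra. }
  clear z Hper Hk. destruct Hmove as (z & Hper & Hk & Hz).
  exists m. split; [exact En|].
  assert (Hcell : forall l, x 0%Z < Nat.iter l (turn_back f q p) z <= x 1%Z).
  { intros l. rewrite iter_turn_back by exact Hf.
    assert (H := periodic_keeps_cell z n k 1 Hn Hk Hrat Hz (q * l)).
    replace (1 - 1 + Z.of_nat (q * l) * p)%Z with (0 + (Z.of_nat l * p) * Z.of_nat q)%Z in H by nia.
    replace (1 + Z.of_nat (q * l) * p)%Z with (1 + (Z.of_nat l * p) * Z.of_nat q)%Z in H by nia.
    rewrite !cell_shift, mult_IZR, <- INR_IZR_INZ in H. lra. }
  destruct (classic (exists l, Nat.iter l (turn_back f q p) z <= x0 + h)) as [[l Hl]|Hout].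
  - right. assert (Hlc := Hcell l). rewrite iter_turn_back in Hl, Hlc by exact Hf.
    set (z' := Nat.iter (q * l) f z + IZR (- (Z.of_nat l * p))).
    assert (Ez' : z' = Nat.iter (q * l) f z - INR l * IZR p).
    { unfold z'. rewrite opp_IZR, mult_IZR, <- INR_IZR_INZ. lra. }
    assert (Hper' : circle_period f z' n) by (apply circle_period_orbit; easy).
    assert (Hk' : Nat.iter n f z' = z' + IZR k) by (apply return_orbit; easy).
    set (t := (z' - x0) / h).
    assert (Et : z' = x0 + h * t) by (unfold t; field; lra).
    assert (Ht : 0 < t <= 1).
    { rewrite Ex0 in Hlc. split; apply (Rmult_lt_reg_l h) || apply (Rmult_le_reg_l h); lra. }
    exists t. split; [exact Ht|]. split; [nia|].
    destruct Hper' as (_ & _ & Hmin). split.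
    + assert (E := iter_turn_back f Hf q p m z').
      rewrite <- En, Hk', Ek, mult_IZR, <- INR_IZR_INZ in E.
      rewrite Et in E at 1. rewrite (proj2 (turn_back_insert m t ltac:(lra))) in E.
      apply (Rmult_eq_reg_l h); lra.
    + intros r Hr E. apply (Hmin (q * r)%nat); [nia|]. exists (Z.of_nat r * p)%Z.
      assert (E' := iter_turn_back f Hf q p r z').
      rewrite Et in E' at 1. rewrite (proj2 (turn_back_insert r t ltac:(lra))), E in E'.
      rewrite mult_IZR, <- INR_IZR_INZ. lra.
  - (* Then the orbit under [turn_back] only moves left, so it is constant. *)
    left.
    assert (Hdec : forall l, Nat.iter (S l) (turn_back f q p) z <= Nat.iter l (turn_back f q p) z).
    { intros l. rewrite iter_S. apply Hright. split; [|apply Hcell].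
      apply Rnot_lt_le; intros Hlt. apply Hout; exists l; lra. }
    assert (Hle : forall l, Nat.iter (S l) (turn_back f q p) z <= turn_back f q p z).
    { intros l. induction l as [|l IH]; [apply Rle_refl|].
      apply (Rle_trans _ _ _ (Hdec (S l)) IH). }
    assert (Em : Nat.iter m (turn_back f q p) z = z).
    { rewrite iter_turn_back, <- En, Hk, Ek, mult_IZR, <- INR_IZR_INZ by exact Hf. lra. }
    assert (Hfix : turn_back f q p z = z).
    { apply Rle_antisym; [apply (Hdec 0%nat)|]. rewrite <- Em at 1.
      replace m with (S (m - 1)) by nia. apply Hle. }
    destruct (Nat.eq_dec m 1) as [|Hm1]; [easy|exfalso].
    destruct Hper as (_ & _ & Hmin). apply (Hmin q); [nia|]. exists p.
    unfold turn_back in Hfix. lra.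
Qed.
End Cells.

(** * The interior of the rotation interval *)

(** Stronger than having the rotation number [rho], and free of limits. *)
Definition bounded_drift (f : R -> R) (x rho : R) : Prop :=
  exists K, forall n, Rabs (Nat.iter n f x - x - INR n * rho) <= K.

Section Horseshoe.
Context (f : R -> R) (Hf : lift f) (c d u v : R) (Huv : u < v)
  (Hu : forall (q : nat) (p : Z), (0 < q)%nat -> IZR p < INR q * d -> v + IZR p <= Nat.iter q f u)
  (Hv : forall (q : nat) (p : Z), (0 < q)%nat -> INR q * c < IZR p -> Nat.iter q f v <= u + IZR p).

(** Write k / n = p / q in lowest terms, n = q m, and G for the q-th iterate turned back
    by p. As G moves [u] beyond [v] and [v] below [u], the interval from [u] to [v] covers
    itself and the interval from [v] to [G u], and the latter covers the former, as
    G does not bring [G u] back below [v]. So there are loops of all lengths m that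
    visit the second interval once. *)
Theorem interior_periods : forall n, M c d n -> exists z, circle_period f z n.
Proof.
  intros n (Hn & k & Hk).
  destruct (reduce_fraction n k Hn) as (m & q & p & Hm & Hq & En & Ek & Hpq).
  assert (HmR : 0 < INR m) by (apply lt_0_INR, Hm).
  assert (HqR : 0 < INR q) by (apply lt_0_INR, Hq).
  assert (Hkn : IZR k / INR n = IZR p / INR q).
  { rewrite En, Ek, mult_INR, mult_IZR, <- INR_IZR_INZ. field. lra. }
  rewrite Hkn in Hk. destruct Hk as [Hc Hd].
  apply Rlt_div_r in Hc; [|lra]. apply Rlt_div_l in Hd; [|lra].
  set (G := turn_back f q p).
  assert (Hmult : forall i, INR i * IZR p = IZR (Z.of_nat i * p)).
  { intros; rewrite mult_IZR, <- INR_IZR_INZ; easy. }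
  assert (HGu : forall i, (0 < i)%nat -> v <= Nat.iter i G u).
  { intros i Hi. unfold G. rewrite iter_turn_back by exact Hf.
    assert (HiR : 0 < INR i) by (apply lt_0_INR, Hi).
    assert (H := Hu (q * i) (Z.of_nat i * p) ltac:(nia)).
    rewrite <- Hmult, mult_INR in H. specialize (H ltac:(nra)). lra. }
  assert (HGv : forall i, (0 < i)%nat -> Nat.iter i G v <= u).
  { intros i Hi. unfold G. rewrite iter_turn_back by exact Hf.
    assert (HiR : 0 < INR i) by (apply lt_0_INR, Hi).
    assert (H := Hv (q * i) (Z.of_nat i * p) ltac:(nia)).
    rewrite <- Hmult, mult_INR in H. specialize (H ltac:(nra)). lra. }
  assert (HcG : continuity G).
  { unfold G, turn_back. assert (H := continuity_iter f q (proj1 Hf)). prove_continuity. }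
  assert (H1u := HGu 1%nat ltac:(lia)). assert (H1v := HGv 1%nat ltac:(lia)).
  assert (H2u := HGu 2%nat ltac:(lia)). simpl in H1u, H1v, H2u.
  (* The loop runs once through [v, G u] and otherwise stays in [u, v]. *)
  assert (Hloop : exists z, Nat.iter m G z = z /\
    forall i, (0 < i < m)%nat -> Nat.iter i G z <> z).
  { destruct (Nat.eq_dec m 1) as [->|Hm1].
    - destruct (loop G (fun _ => u) (fun _ => v) 1 HcG) as (z & Hz & _); try easy.
      + intros; lra.
      + intros i Hi. exists v, u. lra.
      + exists z. split; [exact Hz | intros; lia].
    - set (out := fun i => ((i =? 0) || (i =? m))%nat%bool).
      set (l := fun i => if out i then v else u).
      set (r := fun i => if out i then G u else v).
      assert (Hcase : forall i, (i = 0%nat \/ i = m) /\ l i = v /\ r i = G u \/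
                        i <> 0%nat /\ i <> m /\ l i = u /\ r i = v).
      { intros i. unfold l, r, out. destruct (Nat.eqb_spec i 0); [left; simpl; tauto|].
        destruct (Nat.eqb_spec i m); [left | right]; simpl; tauto. }
      destruct (loop G l r m HcG) as (z & Hz & Hin).
      + intros i _. destruct (Hcase i) as [(_ & -> & ->)|(_ & _ & -> & ->)]; lra.
      + intros i Hi. destruct (Hcase i) as [(Hi0 & -> & ->)|(_ & _ & -> & ->)].
        * destruct (Hcase (S i)) as [(Hbad & _)|(_ & _ & -> & ->)]; [lia|].
          exists v, (G u). lra.
        * exists v, u. destruct (Hcase (S i)) as [(_ & -> & ->)|(_ & _ & -> & ->)]; lra.
      + destruct (Hcase m) as [(_ & -> & _)|]; [|lia].
        destruct (Hcase 0%nat) as [(_ & -> & _)|]; [easy | lia].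
      + destruct (Hcase m) as [(_ & _ & ->)|]; [|lia].
        destruct (Hcase 0%nat) as [(_ & _ & ->)|]; [easy | lia].
      + exists z. split; [exact Hz|]. intros i Hi E.
        assert (H0 := Hin 0%nat ltac:(lia)). simpl in H0.
        destruct (Hcase 0%nat) as [(_ & E1 & _)|]; [rewrite E1 in H0 | lia].
        specialize (Hin i ltac:(lia)). rewrite E in Hin.
        destruct (Hcase i) as [(Hbad & _)|(_ & _ & E2 & E3)]; [lia|]. rewrite E2, E3 in Hin.
        replace z with v in Hz by lra. specialize (HGv m Hm). lra. }
  destruct Hloop as (z & Hz & Hmin). exists z.
  unfold G in Hz. rewrite iter_turn_back, <- En, Hmult, <- Ek in Hz by exact Hf.
  assert (Hret : Nat.iter n f z = z + IZR k) by lra.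
  split; [exact Hn|]. split; [exists k; exact Hret|].
  intros r Hr [j Hj].
  assert (Hrat := return_ratio f Hf _ _ _ _ _ Hj Hret).
  destruct (return_reduced r q j p Hq Hpq) as (r' & Er & Ej); [nia|].
  apply (Hmin r'); [nia|]. unfold G. rewrite iter_turn_back, <- Er, Hj, Hmult, <- Ej by exact Hf.
  lra.
Qed.

(** For large N the integer parts of i N rho increase by amounts p with c < p / N < d. So
    each translate of the interval from [u] to [v] by such a part covers the next one in N
    steps. *)
Theorem interior_drift : forall K0 rho, c < rho < d ->
  (forall y n, y + INR n * c - K0 <= Nat.iter n f y <= y + INR n * d + K0) ->
  exists x, bounded_drift f x rho.
Proof.
  intros K0 rho Hrho Hbound.
  destruct (archimed_cor1 (Rmin (rho - c) (d - rho))) as (N & HN & HN0).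
  { apply Rmin_pos; lra. }
  assert (HNR : 0 < INR N) by (apply lt_0_INR, HN0).
  assert (HNc : 1 < INR N * (rho - c)).
  { assert (H := Rlt_le_trans _ _ _ HN (Rmin_l _ _)).
    apply (Rmult_lt_compat_l (INR N)) in H; [|lra]. rewrite Rinv_r in H; lra. }
  assert (HNd : 1 < INR N * (d - rho)).
  { assert (H := Rlt_le_trans _ _ _ HN (Rmin_r _ _)).
    apply (Rmult_lt_compat_l (INR N)) in H; [|lra]. rewrite Rinv_r in H; lra. }
  set (P := fun i => Int_part (INR i * (INR N * rho))).
  assert (HP : forall i, INR i * (INR N * rho) - 1 < IZR (P i) <= INR i * (INR N * rho)).
  { intros i. assert (H := base_Int_part (INR i * (INR N * rho))). unfold P. lra. }
  destruct (infinite_itinerary (Nat.iter N f) (fun i => u + IZR (P i)) (fun i => v + IZR (P i)))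
    as (x & Hx).
  - apply continuity_iter, Hf.
  - intros i; lra.
  - intros i. assert (H1 := HP i). assert (H2 := HP (S i)). rewrite S_INR in H2.
    exists (v + IZR (P i)), (u + IZR (P i)).
    rewrite !iter_lift_shift by exact Hf.
    assert (Hu' := Hu N (P (S i) - P i) HN0). assert (Hv' := Hv N (P (S i) - P i) HN0).
    rewrite minus_IZR in Hu', Hv'.
    specialize (Hu' ltac:(lra)). specialize (Hv' ltac:(lra)). lra.
  - exists x, (K0 + INR N * (d - c) + 2 * (v - u) + 2). intros n.
    set (i := (n / N)%nat). set (r := (n mod N)%nat).
    assert (En : n = (i * N + r)%nat).
    { unfold i, r. rewrite Nat.mul_comm. apply Nat.div_mod. lia. }
    assert (Hr : (r < N)%nat) by (apply Nat.mod_upper_bound; lia).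
    assert (HrR : 0 <= INR r <= INR N) by (split; [apply pos_INR | apply le_INR; lia]).
    assert (Ex : Nat.iter n f x = Nat.iter r f (Nat.iter i (Nat.iter N f) x)).
    { rewrite <- iter_mul, <- iter_add. f_equal. lia. }
    assert (EnR : INR n = INR i * INR N + INR r) by (rewrite <- mult_INR, <- plus_INR; f_equal; exact En).
    rewrite Ex, EnR. clear Ex EnR.
    assert (Hi := Hx i). assert (H0 := Hx 0%nat). simpl in H0.
    set (y := Nat.iter i (Nat.iter N f) x) in *.
    assert (Hy := Hbound y r). assert (HPi := HP i). assert (HP0 := HP 0%nat). simpl in HP0.
    apply Rabs_le_between. nra.
Qed.
End Horseshoe.

(** * Points that a multiplication moves like a rotation *)

Definition ceil (x : R) : Z := (- Int_part (- x))%Z.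

Lemma ceil_bounds : forall x, x <= IZR (ceil x) < x + 1.
Proof.
  intros x. unfold ceil. rewrite opp_IZR. assert (H := base_Int_part (- x)). lra.
Qed.

Lemma ceil_spec : forall x k, x <= IZR k < x + 1 -> ceil x = k.
Proof.
  intros x k H. unfold ceil.
  rewrite <- (Int_part_spec (- x) (- k)); [lia|]. rewrite opp_IZR. lra.
Qed.

Lemma ceil_le : forall x y, x <= y -> (ceil x <= ceil y)%Z.
Proof.
  intros x y H. assert (Hx := ceil_bounds x). assert (Hy := ceil_bounds y).
  enough (ceil x < ceil y + 1)%Z by lia. apply lt_IZR. rewrite plus_IZR. lra.
Qed.

Lemma ceil_IZR : forall k, ceil (IZR k) = k.
Proof. intros k. apply ceil_spec. lra. Qed.

Lemma ceil_shift : forall x k, ceil (x + IZR k) = (ceil x + k)%Z.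
Proof. intros x k. apply ceil_spec. rewrite plus_IZR. assert (H := ceil_bounds x). lra. Qed.

Lemma ceil_gt : forall x k, IZR k < x -> (k + 1 <= ceil x)%Z.
Proof.
  intros x k H. assert (Hx := ceil_bounds x).
  enough (k < ceil x)%Z by lia. apply lt_IZR. lra.
Qed.

Lemma series_le : forall a b, ex_series a -> ex_series b -> (forall n, a n <= b n) ->
  Series a <= Series b.
Proof.
  intros a b Ha Hb H.
  enough (0 <= Series b - Series a) by lra.
  rewrite <- Series_minus by easy.
  replace 0 with (Series (fun _ : nat => 0 * 0)) by (rewrite Series_scal_l; lra).
  apply Series_le.
  - intros n. specialize (H n). lra.
  - apply (ex_series_minus b a); easy.
Qed.

Section Orbit.
Context (B : R) (HB : 3 <= B).

Definition orbit_term (d theta : R) (n : nat) : R := IZR (ceil (theta + INR n * d)) * (/ B) ^ n.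

(** The point of phase [theta]. Multiplication by [B] shifts the expansion by one place, so
    up to integers it acts on these points as the rotation by [d] acts on the phases. *)
Definition orbit_point (d theta : R) : R := (1 - / B) * Series (orbit_term d theta).

Lemma invB_bounds : 0 < / B <= / 3.
Proof. split; [apply Rinv_0_lt_compat; lra | apply Rinv_le_contravar; lra]. Qed.

Lemma INR_le_pow2 : forall n, INR n <= 2 ^ n /\ 1 <= 2 ^ n.
Proof. induction n as [|n IH]; [simpl; lra|]. rewrite S_INR. simpl. lra. Qed.

Lemma ex_orbit_series : forall d theta, ex_series (orbit_term d theta).
Proof.
  intros d theta. assert (Hb := invB_bounds).
  apply (@ex_series_le R_AbsRing R_CompleteNormedModule _
           (fun n => (Rabs theta + Rabs d + 1) * (2 * / B) ^ n)).
  - intros n. change norm with Rabs. unfold orbit_term.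
    rewrite Rabs_mult, Rpow_mult_distr.
    assert (Hp : 0 < (/ B) ^ n) by (apply pow_lt; lra).
    rewrite (Rabs_pos_eq ((/ B) ^ n)) by lra.
    rewrite <- Rmult_assoc. apply Rmult_le_compat_r; [lra|].
    assert (Hc := ceil_bounds (theta + INR n * d)).
    destruct (INR_le_pow2 n) as [H1 H2]. assert (H0 := pos_INR n).
    assert (Ht := Rle_abs theta). assert (Ht' := Rle_abs (- theta)).
    assert (Hd := Rle_abs d). assert (Hd' := Rle_abs (- d)). rewrite Rabs_Ropp in Ht', Hd'.
    assert (Hn : INR n * Rabs d <= 2 ^ n * Rabs d) by (apply Rmult_le_compat_r; [apply Rabs_pos | lra]).
    assert (Hnd : - (INR n * Rabs d) <= INR n * d <= INR n * Rabs d) by nra.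
    assert (Htp : Rabs theta <= Rabs theta * 2 ^ n) by (assert (H := Rabs_pos theta); nra).
    apply Rabs_le_between. lra.
  - apply (@ex_series_scal_l R_AbsRing R_NormedModule). apply ex_series_geom.
    rewrite Rabs_pos_eq; lra.
Qed.

Lemma series_pow_invB : ex_series (fun n => (/ B) ^ n) /\
  (1 - / B) * Series (fun n => (/ B) ^ n) = 1.
Proof.
  assert (Hb := invB_bounds). assert (H : Rabs (/ B) < 1) by (rewrite Rabs_pos_eq; lra).
  split; [apply ex_series_geom, H|]. rewrite Series_geom by exact H. apply Rinv_r. lra.
Qed.

(** As - ceil (- x) is the integer part of x, the case of [d] and [- c] compares the upper
    end with the lower end. *)
Lemma orbit_point_compare : forall d theta d' theta' k,
  (forall n, (k <= ceil (theta + INR n * d) + ceil (theta' + INR n * d'))%Z) ->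
  IZR k <= orbit_point d theta + orbit_point d' theta'.
Proof.
  intros d theta d' theta' k H. assert (Hb := invB_bounds).
  destruct series_pow_invB as [He Es].
  unfold orbit_point. rewrite <- Rmult_plus_distr_l, <- Series_plus by apply ex_orbit_series.
  replace (IZR k) with ((1 - / B) * Series (fun n => IZR k * (/ B) ^ n)).
  - apply Rmult_le_compat_l; [lra|]. apply series_le.
    + apply (@ex_series_scal_l R_AbsRing R_NormedModule), He.
    + apply (ex_series_plus (orbit_term d theta) (orbit_term d' theta')); apply ex_orbit_series.
    + intros n. unfold orbit_term. rewrite <- Rmult_plus_distr_r, <- plus_IZR.
      apply Rmult_le_compat_r; [apply pow_le; lra | apply IZR_le, H].
  - rewrite (Series_scal_l (IZR k) (fun n => (/ B) ^ n)).
    replace ((1 - / B) * (IZR k * Series (fun n => (/ B) ^ n)))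
      with (IZR k * ((1 - / B) * Series (fun n => (/ B) ^ n))) by ring.
    rewrite Es. ring.
Qed.

Lemma orbit_point_le : forall d theta theta', theta <= theta' ->
  orbit_point d theta <= orbit_point d theta'.
Proof.
  intros d theta theta' H. assert (Hb := invB_bounds).
  apply Rmult_le_compat_l; [lra|]. apply series_le; try apply ex_orbit_series.
  intros n. apply Rmult_le_compat_r; [apply pow_le; lra|].
  apply IZR_le, ceil_le. lra.
Qed.

Lemma orbit_point_shift : forall d theta k,
  orbit_point d (theta + IZR k) = orbit_point d theta + IZR k.
Proof.
  intros d theta k. destruct series_pow_invB as [He Es]. unfold orbit_point.
  rewrite (Series_ext _ (fun n => orbit_term d theta n + IZR k * (/ B) ^ n)).
  - rewrite Series_plus, (Series_scal_l (IZR k) (fun n => (/ B) ^ n)).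
    + rewrite Rmult_plus_distr_l.
      replace ((1 - / B) * (IZR k * Series (fun n => (/ B) ^ n)))
        with (IZR k * ((1 - / B) * Series (fun n => (/ B) ^ n))) by ring.
      rewrite Es. ring.
    + apply ex_orbit_series.
    + apply (@ex_series_scal_l R_AbsRing R_NormedModule), He.
  - intros n. unfold orbit_term.
    replace (theta + IZR k + INR n * d) with (theta + INR n * d + IZR k) by ring.
    rewrite ceil_shift, plus_IZR. ring.
Qed.

Lemma orbit_point_step : forall d theta,
  B * orbit_point d theta = (B - 1) * IZR (ceil theta) + orbit_point d (theta + d).
Proof.
  intros d theta. unfold orbit_point.
  rewrite (Series_incr_1 (orbit_term d theta)) by apply ex_orbit_series.
  rewrite (Series_ext (fun k => orbit_term d theta (S k))
             (fun k => / B * orbit_term d (theta + d) k)).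
  - rewrite Series_scal_l. unfold orbit_term at 1. simpl INR.
    replace (theta + 0 * d) with theta by ring. rewrite pow_O. field. lra.
  - intros n. unfold orbit_term. rewrite S_INR.
    replace (theta + (INR n + 1) * d) with (theta + d + INR n * d) by ring. simpl. ring.
Qed.

(** Each step backwards in time divides a distance by [B]. *)
Lemma orbit_point_jump : forall d n theta theta', theta <= theta' ->
  (ceil (theta + INR n * d) < ceil (theta' + INR n * d))%Z ->
  orbit_point d theta + (1 - / B) * (/ B) ^ n <= orbit_point d theta'.
Proof.
  intros d n. assert (Hb := invB_bounds).
  induction n as [|n IH]; intros theta theta' Hle Hlt;
    assert (E := orbit_point_step d theta); assert (E' := orbit_point_step d theta').
  - simpl in Hlt. rewrite !Rmult_0_l, !Rplus_0_r in Hlt.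
    assert (H := orbit_point_le d (theta + d) (theta' + d) ltac:(lra)).
    assert (Hk : IZR (ceil theta) + 1 <= IZR (ceil theta')).
    { rewrite <- plus_IZR. apply IZR_le. lia. }
    apply (Rmult_le_reg_l B); [lra|].
    replace (B * (orbit_point d theta + (1 - / B) * (/ B) ^ 0))
      with (B * orbit_point d theta + (B - 1)) by (simpl; field; lra).
    rewrite E, E'. nra.
  - rewrite S_INR in Hlt.
    specialize (IH (theta + d) (theta' + d) ltac:(lra)).
    replace (theta + d + INR n * d) with (theta + (INR n + 1) * d) in IH by ring.
    replace (theta' + d + INR n * d) with (theta' + (INR n + 1) * d) in IH by ring.
    specialize (IH Hlt).
    assert (Hk := IZR_le _ _ (ceil_le theta theta' Hle)).
    apply (Rmult_le_reg_l B); [lra|].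
    replace (B * (orbit_point d theta + (1 - / B) * (/ B) ^ S n))
      with (B * orbit_point d theta + (1 - / B) * (/ B) ^ n) by (simpl; field; lra).
    rewrite E, E'. nra.
Qed.

Lemma orbit_point_near : forall d theta,
  orbit_point d 0 + theta - 1 <= orbit_point d theta <= orbit_point d 0 + theta + 1.
Proof.
  intros d theta. assert (H := ceil_bounds theta).
  assert (Hhi := orbit_point_le d theta (0 + IZR (ceil theta)) ltac:(lra)).
  assert (Hlo := orbit_point_le d (0 + IZR (ceil theta - 1)) theta).
  rewrite minus_IZR in Hlo. specialize (Hlo ltac:(lra)).
  rewrite <- minus_IZR in Hlo. rewrite orbit_point_shift in Hlo, Hhi. rewrite minus_IZR in Hlo.
  lra.
Qed.

Lemma orbit_point_zero_le : forall d, (B - 1) * orbit_point d 0 <= d + 1.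
Proof.
  intros d. assert (E := orbit_point_step d 0). rewrite (ceil_IZR 0), Rplus_0_l in E.
  assert (H := orbit_point_near d d). lra.
Qed.

(** * The upper end of the rotation interval *)

(** What the upper end of the rotation interval depends on. The map may exceed its value at
    [b = orbit_point d 0] on the way from [b] to [a + 1], but by [upper_gap] it must not get
    past the images of the phases right of 0. *)
Record upper_shape (d a kappa : R) (f : R -> R) : Prop := {
  upper_lift : lift f;
  upper_height : 0 <= kappa;
  upper_phases : forall theta, -1 < theta -> a <= orbit_point d theta;
  upper_affine : forall x, a <= x <= orbit_point d 0 -> f x = B * x;
  upper_bump : forall x, orbit_point d 0 <= x <= a + 1 ->
    f x <= B * orbit_point d 0 + kappa;
  upper_gap : forall theta, 0 < theta ->
    orbit_point d d + kappa <= orbit_point d (theta + d)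
}.

Arguments upper_lift {d a kappa f}.
Arguments upper_height {d a kappa f}.
Arguments upper_phases {d a kappa f}.
Arguments upper_affine {d a kappa f}.
Arguments upper_bump {d a kappa f}.
Arguments upper_gap {d a kappa f}.

Section Upper.
Context (f : R -> R) (d a kappa : R) (Hshape : upper_shape d a kappa f).

Notation b := (orbit_point d 0).

Lemma b_image : B * b = orbit_point d d.
Proof. rewrite orbit_point_step, (ceil_IZR 0), Rplus_0_l. ring. Qed.

(** The phases in (N - 1, N] belong to the translate by [N] of the interval [a, b]. *)
Lemma affine_near : forall theta N y, IZR N - 1 < theta <= IZR N ->
  a + IZR N <= y <= b + IZR N ->
  f y = orbit_point d (theta + d) + B * (y - orbit_point d theta).
Proof.
  intros theta N y Ht Hy.
  assert (Ef := lift_shift f (upper_lift Hshape) (y - IZR N) N). replace (y - IZR N + IZR N) with y in Ef by ring.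
  rewrite Ef, (upper_affine Hshape) by lra.
  assert (E := orbit_point_step d theta).
  rewrite (ceil_spec theta N) in E by lra. lra.
Qed.

Lemma phase_range : forall theta N, IZR N - 1 < theta <= IZR N ->
  a + IZR N <= orbit_point d theta <= b + IZR N.
Proof.
  intros theta N Ht.
  assert (H1 := upper_phases Hshape (theta + IZR (- N))). assert (H2 := orbit_point_le d theta (0 + IZR N)).
  rewrite orbit_point_shift in H1, H2. rewrite opp_IZR in H1.
  specialize (H1 ltac:(lra)). specialize (H2 ltac:(lra)). lra.
Qed.

Lemma phase_image : forall theta, f (orbit_point d theta) = orbit_point d (theta + d).
Proof.
  intros theta. assert (Hc := ceil_bounds theta).
  rewrite (affine_near theta (ceil theta)); [ring | lra | apply phase_range; lra].
Qed.

(** On the affine part the map is increasing. A point that is not in the affine part of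
    [theta] but left of it has at least one turn to make up for, and [upper_gap] prevents
    that. *)
Lemma phase_bound : forall x theta, x <= orbit_point d theta -> f x <= orbit_point d (theta + d).
Proof.
  intros x theta Hx. assert (Hk := upper_height Hshape).
  assert (Hc := ceil_bounds theta). set (N := ceil theta) in *.
  assert (Hr := phase_range theta N ltac:(lra)).
  destruct (Rle_lt_dec (a + IZR N) x) as [Hax|Hax].
  - rewrite (affine_near theta N) by lra. nra.
  - (* Bring [x] into [a, a + 1); this takes a turn at least. *)
    set (j := Int_part (x - a)). assert (Hj := base_Int_part (x - a)). fold j in Hj.
    assert (HjN : (j + 1 <= N)%Z).
    { enough (j < N)%Z by lia. apply lt_IZR. lra. }
    apply IZR_le in HjN. rewrite plus_IZR in HjN.
    assert (Ef := lift_shift f (upper_lift Hshape) (x - IZR j) j). replace (x - IZR j + IZR j) with x in Ef by ring.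
    assert (Hfx : f (x - IZR j) <= B * b + kappa).
    { destruct (Rle_lt_dec (x - IZR j) b).
      - rewrite (upper_affine Hshape) by lra. nra.
      - apply (upper_bump Hshape). lra. }
    assert (Hg := upper_gap Hshape (theta + IZR (1 - N))). rewrite minus_IZR in Hg.
    specialize (Hg ltac:(lra)). rewrite <- minus_IZR in Hg.
    replace (theta + IZR (1 - N) + d) with (theta + d + IZR (1 - N)) in Hg by ring.
    rewrite orbit_point_shift, minus_IZR in Hg. rewrite b_image in Hfx. lra.
Qed.

Lemma phase_image_iter : forall n theta,
  Nat.iter n f (orbit_point d theta) = orbit_point d (theta + INR n * d).
Proof.
  intros n theta. induction n as [|n IH].
  - simpl. f_equal; ring.
  - rewrite iter_S, IH, phase_image, S_INR. f_equal; ring.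
Qed.

Lemma phase_bound_iter : forall n x theta, x <= orbit_point d theta ->
  Nat.iter n f x <= orbit_point d (theta + INR n * d).
Proof.
  intros n x theta Hx. induction n as [|n IH].
  - simpl. replace (theta + 0 * d) with theta by ring. exact Hx.
  - rewrite iter_S, S_INR. replace (theta + (INR n + 1) * d) with (theta + INR n * d + d) by ring.
    apply phase_bound, IH.
Qed.

Lemma upper_displacement : forall x n, Nat.iter n f x <= x + INR n * d + 2.
Proof.
  intros x n. assert (H := orbit_point_near d (x - b + 1)).
  assert (H' := phase_bound_iter n x (x - b + 1) ltac:(lra)).
  assert (H'' := orbit_point_near d (x - b + 1 + INR n * d)). lra.
Qed.

Lemma upper_drift : bounded_drift f b d.
Proof.
  exists 1. intros n. rewrite phase_image_iter, Rplus_0_l.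
  assert (H := orbit_point_near d (INR n * d)). apply Rabs_le_between. lra.
Qed.

(** The point reached has phase [q * d], which exceeds [p], hence it is not left of [a + p + 1]. *)
Lemma upper_advance : forall (q : nat) (p : Z), IZR p < INR q * d ->
  a + 1 + IZR p <= Nat.iter q f b.
Proof.
  intros q p Hp. rewrite phase_image_iter, Rplus_0_l.
  assert (H := upper_phases Hshape (INR q * d + IZR (- (p + 1)))).
  rewrite orbit_point_shift in H. rewrite opp_IZR, plus_IZR in H. specialize (H ltac:(lra)). lra.
Qed.

Section Rational.
Context (p : Z) (q : nat) (Hq : (0 < q)%nat) (Hpq : rel_prime p (Z.of_nat q))
  (Hd : d = IZR p / INR q) (h : R) (Hh : 0 < h <= 1 - / B)
  (Ekappa : kappa = h * (/ B) ^ (q - 1)) (g : R -> R)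
  (Hg : forall t, 0 <= t <= 1 -> 0 <= g t <= 1)
  (Hinsert : forall t, 0 <= t <= 1 -> f (b + h * t) = B * b + kappa * g t).

Lemma INRq : 0 < INR q.
Proof. apply lt_0_INR, Hq. Qed.

Lemma not_multiple : forall i N, (0 < i < q)%nat -> (Z.of_nat i * p <> N * Z.of_nat q)%Z.
Proof.
  intros i N Hi E.
  destruct (return_reduced i q N p Hq Hpq) as (m & Em & _); [lia|].
  destruct m; nia.
Qed.

Lemma d_multiple : forall i : nat, INR i * d = IZR (Z.of_nat i * p) / INR q.
Proof. intros i. rewrite Hd, mult_IZR, <- INR_IZR_INZ. field. assert (H := INRq). lra. Qed.

Lemma d_full_turn : INR q * d = IZR p.
Proof. rewrite Hd. field. assert (H := INRq). lra. Qed.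

(** Before the orbit of [b] returns to [b] its phase is not an integer, so the right end of
    the affine part has a larger phase. The ceilings of the two phases differ at the time of
    the return, and the resulting jump keeps the points apart. *)
Lemma orbit_room : forall i, (0 < i < q)%nat ->
  orbit_point d (INR i * d) + h * (/ B) ^ (q - i) <= b + IZR (ceil (INR i * d)).
Proof.
  intros i Hi. set (N := ceil (INR i * d)).
  assert (Hc := ceil_bounds (INR i * d)). fold N in Hc.
  assert (Hqr := INRq). assert (Hb := invB_bounds).
  assert (Hlt : INR i * d < IZR N).
  { destruct (Req_dec (INR i * d) (IZR N)) as [E|]; [exfalso | lra].
    apply (not_multiple i N Hi). apply eq_IZR. rewrite d_multiple in E.
    rewrite (mult_IZR N), <- INR_IZR_INZ, <- E. field. lra. }
  assert (Eq : INR i * d + INR (q - i) * d = IZR p).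
  { rewrite minus_INR, <- d_full_turn by lia. ring. }
  assert (H := orbit_point_jump d (q - i) (INR i * d) (0 + IZR N) ltac:(lra)).
  rewrite Eq, ceil_IZR, orbit_point_shift in H.
  assert (Hg' := ceil_gt (0 + IZR N + INR (q - i) * d) p ltac:(lra)).
  specialize (H ltac:(lia)).
  assert (Hp : 0 < (/ B) ^ (q - i)) by (apply pow_lt; lra). nra.
Qed.

Lemma affine_right : forall i e, (0 < i < q)%nat -> 0 <= e <= h * (/ B) ^ (q - i) ->
  f (orbit_point d (INR i * d) + e) = orbit_point d (INR (S i) * d) + B * e.
Proof.
  intros i e Hi He. assert (Hroom' := orbit_room i Hi).
  assert (Hc := ceil_bounds (INR i * d)).
  assert (Hr := phase_range (INR i * d) (ceil (INR i * d)) ltac:(lra)).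
  rewrite (affine_near (INR i * d) (ceil (INR i * d))) by lra.
  rewrite S_INR. replace ((INR i + 1) * d) with (INR i * d + d) by ring. ring.
Qed.

Lemma scale_up : forall i, (0 < i < q)%nat -> B * (h * (/ B) ^ (q - i)) = h * (/ B) ^ (q - S i).
Proof.
  intros i Hi. replace (q - i)%nat with (S (q - S i)) by lia. simpl. field. lra.
Qed.

(** Each of the [q - 1] affine steps after the bump enlarges the copy of [g] by the factor [B]. *)
Lemma insert_iter : forall t i, 0 <= t <= 1 -> (0 < i <= q)%nat ->
  Nat.iter i f (b + h * t) = orbit_point d (INR i * d) + h * (/ B) ^ (q - i) * g t.
Proof.
  intros t i Ht [Hi0 Hiq]. specialize (Hg t Ht). assert (Hb := invB_bounds).
  induction i as [|i IH]; [lia|].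
  destruct (Nat.eq_dec i 0) as [->|Hi].
  - simpl Nat.iter. rewrite Hinsert by exact Ht. rewrite b_image, Ekappa, Rmult_1_l. easy.
  - rewrite iter_S, IH by lia.
    assert (Hp : 0 < (/ B) ^ (q - i)) by (apply pow_lt; lra).
    assert (Hhp : 0 < h * (/ B) ^ (q - i)) by nra.
    rewrite affine_right, <- scale_up; [ring | lia | lia |]. nra.
Qed.

Lemma insert_turn : forall t, 0 <= t <= 1 -> turn_back f q p (b + h * t) = b + h * g t.
Proof.
  intros t Ht. unfold turn_back. rewrite insert_iter by (easy || lia).
  rewrite Nat.sub_diag, d_full_turn, <- (Rplus_0_l (IZR p)), orbit_point_shift. simpl. ring.
Qed.

(** The points between the copy of [g] and [a + 1] are mapped below the top of the bump, whose
    later image is the right end of the copy. *)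
Lemma middle_turn : forall z, b + h <= z <= a + 1 -> turn_back f q p z <= z.
Proof.
  intros z Hz. assert (Hb := invB_bounds).
  assert (H : forall i, (0 < i <= q)%nat ->
            Nat.iter i f z <= orbit_point d (INR i * d) + h * (/ B) ^ (q - i)).
  { intros i [Hi0 Hiq]. induction i as [|i IH]; [lia|].
    destruct (Nat.eq_dec i 0) as [->|Hi].
    - simpl Nat.iter. rewrite Rmult_1_l, <- b_image, <- Ekappa. apply (upper_bump Hshape). lra.
    - rewrite iter_S. specialize (IH ltac:(lia) ltac:(lia)).
      assert (Hp : 0 < (/ B) ^ (q - i)) by (apply pow_lt; lra).
      assert (Hhp : 0 < h * (/ B) ^ (q - i)) by nra.
      rewrite <- scale_up by lia. set (y := Nat.iter i f z) in *.
      destruct (Rle_lt_dec y (orbit_point d (INR i * d))) as [Hy|Hy].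
      + apply phase_bound in Hy. rewrite S_INR.
        replace ((INR i + 1) * d) with (INR i * d + d) by ring. nra.
      + replace y with (orbit_point d (INR i * d) + (y - orbit_point d (INR i * d))) by ring.
        rewrite affine_right by (lia || lra). nra. }
  specialize (H q ltac:(lia)). unfold turn_back.
  rewrite Nat.sub_diag, d_full_turn, <- (Rplus_0_l (IZR p)), orbit_point_shift in H.
  simpl in H. lra.
Qed.

(** The distance to the orbit of the phase 1 / q does not decrease, unless the point falls
    behind the orbit of the phase 0. *)
Lemma repelled_turn : forall z, a + 1 <= z <= orbit_point d (/ INR q) -> b <= z ->
  turn_back f q p z <= z.
Proof.
  intros z Hz Hbz. assert (Hqr := INRq).
  assert (Hq1 : 1 <= INR q) by (apply (le_INR 1); lia).
  assert (Hinv : 0 < / INR q <= 1).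
  { split; [apply Rinv_0_lt_compat; lra|]. rewrite <- Rinv_1. apply Rinv_le_contravar; lra. }
  set (e := orbit_point d (/ INR q) - z).
  assert (H : forall i, (0 < i <= q)%nat -> Nat.iter i f z <=
            Rmax (orbit_point d (INR i * d)) (orbit_point d (/ INR q + INR i * d) - e)).
  { intros i [Hi0 Hiq]. induction i as [|i IH]; [lia|].
    destruct (Nat.eq_dec i 0) as [->|Hi].
    - simpl Nat.iter. rewrite Rmult_1_l.
      assert (Hr := phase_range (/ INR q) 1 ltac:(lra)).
      rewrite (affine_near (/ INR q) 1) by lra.
      eapply Rle_trans; [|apply Rmax_r]. unfold e. nra.
    - rewrite iter_S. specialize (IH ltac:(lia) ltac:(lia)).
      set (y := Nat.iter i f z) in *.
      replace (INR (S i) * d) with (INR i * d + d) by (rewrite S_INR; ring).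
      destruct (Rle_lt_dec y (orbit_point d (INR i * d))) as [Hy|Hy].
      + eapply Rle_trans; [apply phase_bound, Hy | apply Rmax_l].
      + assert (Hye : y <= orbit_point d (/ INR q + INR i * d) - e).
        { apply Rnot_lt_le; intros Hlt. apply (Rlt_not_le _ _ (Rmax_lub_lt _ _ _ Hy Hlt) IH). }
        (* The phases i d and 1/q + i d lie in the same (N - 1, N]. *)
        set (N := ceil (/ INR q + INR i * d)).
        assert (Hc := ceil_bounds (/ INR q + INR i * d)). fold N in Hc.
        assert (Hgt : IZR N - 1 < INR i * d).
        { rewrite d_multiple in *. rewrite <- (minus_IZR N 1).
          apply Rlt_div_r; [lra|]. rewrite INR_IZR_INZ, <- mult_IZR. apply IZR_lt.
          assert (Hlt : ((N - 1) * Z.of_nat q < 1 + Z.of_nat i * p)%Z).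
          { apply lt_IZR. rewrite plus_IZR, mult_IZR, minus_IZR, <- INR_IZR_INZ.
            destruct Hc as [_ Hc]. apply (Rmult_lt_compat_r (INR q)) in Hc; [|lra].
            replace ((/ INR q + IZR (Z.of_nat i * p) / INR q + 1) * INR q)
              with (1 + IZR (Z.of_nat i * p) + INR q) in Hc by (field; lra). lra. }
          assert (Hne := not_multiple i (N - 1) ltac:(lia)). lia. }
        assert (Hr1 := phase_range (INR i * d) N ltac:(lra)).
        assert (Hr2 := phase_range (/ INR q + INR i * d) N ltac:(lra)).
        assert (He : 0 <= e) by (unfold e; lra).
        rewrite (affine_near (/ INR q + INR i * d) N) by lra.
        replace (/ INR q + (INR i * d + d)) with (/ INR q + INR i * d + d) by ring.
        eapply Rle_trans; [|apply Rmax_r]. nra. }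
  specialize (H q ltac:(lia)). rewrite d_full_turn in H. unfold turn_back.
  rewrite orbit_point_shift in H. rewrite <- (Rplus_0_l (IZR p)), orbit_point_shift in H at 1.
  assert (Hmax : Rmax (b + IZR p) (orbit_point d (/ INR q) + IZR p - e) <= z + IZR p).
  { apply Rmax_lub; unfold e; lra. }
  lra.
Qed.

Theorem upper_periods : forall z n k,
  circle_period f z n -> Nat.iter n f z = z + IZR k -> IZR k = INR n * d ->
  exists m, n = (q * m)%nat /\ (m = 1%nat \/ interval_periods g m).
Proof.
  intros z n k Hper Hk Hrat. assert (Hqr := INRq).
  apply (periods_at_rotation f (upper_lift Hshape) p q Hq Hpq b h (proj1 Hh) g Hg insert_turn
           (fun j => orbit_point d (IZR j / INR q))) with (z := z) (k := k).
  - f_equal. unfold Rdiv. ring.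
  - intros j. rewrite <- (orbit_point_shift d _ 1). f_equal.
    rewrite plus_IZR, <- INR_IZR_INZ. field. lra.
  - intros y j Hy. apply phase_bound in Hy. rewrite plus_IZR.
    replace ((IZR j + IZR p) / INR q) with (IZR j / INR q + d) by (rewrite Hd; field; lra).
    exact Hy.
  - intros y Hy. replace (IZR 1 / INR q) with (/ INR q) in Hy by (field; lra).
    destruct (Rle_lt_dec y (a + 1)).
    + apply middle_turn. lra.
    + apply repelled_turn; lra.
  - exact Hper.
  - exact Hk.
  - apply eq_IZR. rewrite !mult_IZR, Hrat, <- !INR_IZR_INZ, Hd. field. lra.
Qed.

Theorem upper_periods_exist : forall m, interval_periods g m ->
  exists z, circle_period f z (q * m).
Proof.
  intros m (t & Ht & Hm). exists (b + h * t).
  apply (inserted_period f (upper_lift Hshape) p q Hq Hpq b h (proj1 Hh) g Hg insert_turn); [lra | exact Hm].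
Qed.
End Rational.
End Upper.
End Orbit.

(** * Rotation intervals with more than one point *)

Lemma lift_extension : forall phi b, continuity phi -> phi (b + 1) = phi b + 1 ->
  exists f, lift f /\ forall x, b <= x <= b + 1 -> f x = phi x.
Proof.
  intros phi b Hc Hglue.
  set (f := fun x => phi (x - IZR (Int_part (x - b))) + IZR (Int_part (x - b))).
  assert (Hloc : forall k x, b + IZR k <= x <= b + IZR k + 1 -> f x = phi (x - IZR k) + IZR k).
  { intros k x Hx. unfold f. destruct (Req_dec x (b + IZR k + 1)) as [E|].
    - rewrite <- (Int_part_spec (x - b) (k + 1)) by (rewrite plus_IZR; lra).
      rewrite plus_IZR. replace (x - (IZR k + 1)) with b by lra.
      replace (x - IZR k) with (b + 1) by lra. lra.
    - rewrite <- (Int_part_spec (x - b) k) by lra. easy. }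
  assert (Hfl : forall x, exists k, b + IZR k <= x < b + IZR k + 1).
  { intros x. exists (Int_part (x - b)). assert (H := base_Int_part (x - b)). lra. }
  exists f. split; [split|].
  - intros x eps He. destruct (Hfl x) as [k Hk].
    assert (Hck : forall j, continuity (fun y => phi (y - IZR j) + IZR j)).
    { intros j. prove_continuity. }
    destruct (continuity_near _ x eps (Hck k) He) as (d1 & Hd1 & H1).
    destruct (continuity_near _ x eps (Hck (k - 1)%Z) He) as (d2 & Hd2 & H2).
    (* Right of [x] the branch of [x] applies; left of [x] possibly the previous
       one, when [x] is a break point. *)
    set (d3 := if Req_EM_T x (b + IZR k) then 1 else x - (b + IZR k)).
    assert (Hd3 : 0 < d3) by (unfold d3; destruct Req_EM_T; lra).
    exists (Rmin (Rmin d1 d2) (Rmin d3 (b + IZR k + 1 - x))).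
    split; [repeat apply Rmin_pos; lra|]. intros y [_ Hy].
    change (Rabs (y - x) < Rmin (Rmin d1 d2) (Rmin d3 (b + IZR k + 1 - x))) in Hy.
    change (Rabs (f y - f x) < eps).
    apply Rmin_Rgt_l in Hy. destruct Hy as [Hy12 Hy34].
    apply Rmin_Rgt_l in Hy12, Hy34. destruct Hy12 as [Hy1 Hy2]. destruct Hy34 as [Hy3 Hy4].
    apply Rgt_lt, Rabs_def2 in Hy3, Hy4.
    destruct (Rle_lt_dec (b + IZR k) y) as [Hle|Hlt].
    + rewrite (Hloc k y), (Hloc k x) by lra. apply H1. lra.
    + unfold d3 in Hy3. destruct Req_EM_T as [Ex|]; [|lra].
      rewrite (Hloc (k - 1)%Z y), (Hloc (k - 1)%Z x) by (rewrite minus_IZR; lra).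
      apply H2. lra.
  - intros x. destruct (Hfl x) as [k Hk].
    rewrite (Hloc k x), (Hloc (k + 1)%Z (x + 1)) by (rewrite ?plus_IZR; lra).
    rewrite plus_IZR. replace (x + 1 - (IZR k + 1)) with (x - IZR k) by ring. ring.
  - intros x Hx. rewrite (Hloc 0%Z x) by (simpl; lra). rewrite Rminus_0_r, Rplus_0_r. easy.
Qed.

(** The cut-off function [m] descends from 1 to 0 on the middle third of the gap between [b]
    and [a + 1], the outer thirds of which carry the two bumps. *)
Lemma bumped_map : forall B a b h kl ku gl gu,
  0 <= B -> a <= b -> 0 < h -> b + 3 * h = a + 1 -> B * a + 1 <= B * b ->
  0 <= kl -> 0 <= ku -> interval_map gl -> interval_map gu ->
  exists f, lift f /\
    (forall x, a <= x <= b -> f x = B * x) /\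
    (forall x, b <= x <= a + 1 -> B * a + 1 - kl <= f x <= B * b + ku) /\
    (forall t, 0 <= t <= 1 -> f (b + h * t) = B * b + ku * gu t) /\
    (forall t, 0 <= t <= 1 -> f (a + 1 - h * t) = B * a + 1 - kl * gl t).
Proof.
  intros B a b h kl ku gl gu HB Hab Hh Ehab Hdrop Hkl Hku (Hcl & Hl0 & Hgl) (Hcu & Hu0 & Hgu).
  set (m := fun x => clamp ((a + 1 - h - x) / h)).
  set (phi := fun x => B * (Rmax x (a + 1) - 1) + 1
     + m x * (B * b - B * a - 1 + ku * gu (clamp ((x - b) / h)))
     - (1 - m x) * (kl * gl (clamp ((a + 1 - x) / h)))).
  assert (Hcphi : continuity phi).
  { unfold phi, m. assert (H := continuity_clamp). prove_continuity. }
  assert (Hm1 : forall x, x <= b + h -> m x = 1).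
  { intros x Hx. apply clamp_high. apply Rle_div_r; lra. }
  assert (Hm0 : forall x, a + 1 - h <= x -> m x = 0).
  { intros x Hx. apply clamp_low. apply Rle_div_l; lra. }
  assert (Hright : forall x, a + 1 <= x -> phi x = B * (x - 1) + 1).
  { intros x Hx. unfold phi. rewrite Hm0 by lra. rewrite Rmax_left by lra.
    rewrite (clamp_low ((a + 1 - x) / h)) by (apply Rle_div_l; lra). rewrite Hl0. ring. }
  assert (Hup : forall t, 0 <= t <= 1 -> phi (b + h * t) = B * b + ku * gu t).
  { intros t Ht. unfold phi. rewrite Hm1 by nra. rewrite Rmax_right by nra.
    replace ((b + h * t - b) / h) with t by (field; lra). rewrite (clamp_id t) by lra. ring. }
  assert (Hlo : forall t, 0 <= t <= 1 -> phi (a + 1 - h * t) = B * a + 1 - kl * gl t).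
  { intros t Ht. unfold phi. rewrite Hm0 by nra. rewrite Rmax_right by nra.
    replace ((a + 1 - (a + 1 - h * t)) / h) with t by (field; lra).
    rewrite (clamp_id t) by lra. ring. }
  destruct (lift_extension phi b Hcphi) as (f & Hf & Ef).
  { rewrite Hright by lra. replace b with (b + h * 0) at 2 by ring.
    rewrite Hup by lra. rewrite Hu0. ring. }
  exists f. split; [exact Hf|]. split; [|split; [|split]].
  - intros x Hx. assert (E := proj2 Hf x). rewrite Ef in E by lra.
    rewrite Hright in E by lra. lra.
  - intros x Hx. rewrite Ef by lra. unfold phi. rewrite Rmax_right by lra.
    assert (H1 := Hgu _ (clamp_range ((x - b) / h))).
    assert (H2 := Hgl _ (clamp_range ((a + 1 - x) / h))).
    assert (H3 := clamp_range ((a + 1 - h - x) / h)). fold (m x) in H3.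
    set (U := ku * gu (clamp ((x - b) / h))). set (L := kl * gl (clamp ((a + 1 - x) / h))).
    assert (0 <= U <= ku) by (unfold U; nra). assert (0 <= L <= kl) by (unfold L; nra).
    assert (0 <= m x * (B * b - B * a - 1 + U) <= B * b - B * a - 1 + U).
    { split; [apply Rmult_le_pos; lra|].
      rewrite <- (Rmult_1_l (B * b - B * a - 1 + U)) at 2. apply Rmult_le_compat_r; lra. }
    assert (0 <= (1 - m x) * L <= L) by nra. lra.
  - intros t Ht. rewrite Ef by nra. apply Hup, Ht.
  - intros t Ht. rewrite Ef by nra. apply Hlo, Ht.
Qed.

Lemma coprime_quotient_unique : forall p q p' q', (0 < q)%nat -> (0 < q')%nat ->
  rel_prime p (Z.of_nat q) -> rel_prime p' (Z.of_nat q') ->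
  IZR p / INR q = IZR p' / INR q' -> q = q'.
Proof.
  intros p q p' q' Hq Hq' Hp Hp' E.
  assert (HqR : 0 < INR q) by (apply lt_0_INR, Hq).
  assert (HqR' : 0 < INR q') by (apply lt_0_INR, Hq').
  assert (Ez : (p * Z.of_nat q' = p' * Z.of_nat q)%Z).
  { apply eq_IZR. rewrite !mult_IZR, <- !INR_IZR_INZ.
    apply (Rmult_eq_reg_r (/ INR q * / INR q')).
    - field_simplify in E; try lra. field_simplify; lra.
    - apply Rmult_integral_contrapositive; split; apply Rinv_neq_0_compat; lra. }
  destruct (return_reduced q q' p p' Hq' Hp' Ez) as (i & Ei & _).
  destruct (return_reduced q' q p' p Hq Hp ltac:(lia)) as (j & Ej & _).
  apply Nat.divide_antisym; [exists j | exists i]; lia.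
Qed.

(** For an irrational [d] there is nothing to insert, and the phases leave no room for a bump:
    the height is 0. *)
Lemma bump_height : forall B d h, 3 <= B -> 0 < h <= 1 - / B ->
  exists kappa, 0 <= kappa /\
    (forall theta, 0 < theta -> orbit_point B d d + kappa <= orbit_point B d (theta + d)) /\
    (forall p q, (0 < q)%nat -> rel_prime p (Z.of_nat q) -> d = IZR p / INR q ->
       kappa = h * (/ B) ^ (q - 1)).
Proof.
  intros B d h HB Hh. assert (HiB := invB_bounds B HB).
  destruct (classic (exists p q, (0 < q)%nat /\ rel_prime p (Z.of_nat q) /\ d = IZR p / INR q))
    as [(p & q & Hq & Hpq & Ed)|Hirr].
  - exists (h * (/ B) ^ (q - 1)).
    assert (Hp : 0 < (/ B) ^ (q - 1)) by (apply pow_lt; lra).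
    split; [nra|]. split.
    + intros theta Ht.
      assert (HqR : 0 < INR q) by (apply lt_0_INR, Hq).
      assert (Eq : d + INR (q - 1) * d = IZR p).
      { rewrite minus_INR, Ed by lia. simpl. field. lra. }
      assert (H := orbit_point_jump B HB d (q - 1) d (theta + d) ltac:(lra)).
      rewrite Eq, ceil_IZR in H.
      assert (Hgt := ceil_gt (theta + d + INR (q - 1) * d) p ltac:(lra)).
      specialize (H ltac:(lia)). nra.
    + intros p' q' Hq' Hpq' Ed'.
      replace q' with q; [easy|]. apply (coprime_quotient_unique p q p' q'); congruence.
  - exists 0. split; [lra|]. split.
    + intros theta Ht. rewrite Rplus_0_r. apply orbit_point_le; lra.
    + intros p q Hq Hpq Ed. exfalso. apply Hirr. exists p, q. easy.
Qed.

Lemma Lambda_of_ratio : forall f s g d,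
  (forall n, interval_periods g n <-> Sh s n) ->
  (forall p q, (0 < q)%nat -> rel_prime p (Z.of_nat q) -> d = IZR p / INR q ->
    forall z n k, circle_period f z n -> Nat.iter n f z = z + IZR k -> IZR k = INR n * d ->
    exists m, n = (q * m)%nat /\ (m = 1%nat \/ interval_periods g m)) ->
  forall z n k, circle_period f z n -> Nat.iter n f z = z + IZR k -> IZR k = INR n * d ->
  Lambda d (Sh s) n.
Proof.
  intros f s g d Hg H z n k Hper Hk Hrat. assert (Hn : (0 < n)%nat) by apply Hper.
  destruct (reduce_fraction n k Hn) as (m & q & p & Hm & Hq & En & Ek & Hpq).
  assert (HmR : 0 < INR m) by (apply lt_0_INR, Hm).
  assert (HqR : 0 < INR q) by (apply lt_0_INR, Hq).
  assert (Ed : d = IZR p / INR q).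
  { rewrite Ek, En, mult_INR, mult_IZR, <- INR_IZR_INZ in Hrat.
    apply (Rmult_eq_reg_l (INR q * INR m)); [|nra]. rewrite <- Hrat. field. lra. }
  destruct (H p q Hq Hpq Ed z n k Hper Hk Hrat) as (j & Ej & Hj).
  exists p, q. split; [exact Hq|]. split; [exact Hpq|]. split; [exact Ed|].
  exists j. split; [|exact Ej]. destruct Hj as [->|Hj]; [apply Sh_one | apply Hg, Hj].
Qed.

(** The copy of [g] has size [h] in the domain, and in the image the size that the [q - 1]
    affine steps until the return to [b] enlarge to [h]. *)
Record insertion (B d kappa h : R) (g f : R -> R) : Prop := {
  insertion_size : 0 < h <= 1 - / B;
  insertion_height : forall p q, (0 < q)%nat -> rel_prime p (Z.of_nat q) ->
    d = IZR p / INR q -> kappa = h * (/ B) ^ (q - 1);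
  insertion_map : interval_map g;
  insertion_values : forall t, 0 <= t <= 1 ->
    f (orbit_point B d 0 + h * t) = B * orbit_point B d 0 + kappa * g t
}.

Theorem upper_end : forall B f d a kappa h g s,
  3 <= B -> upper_shape B d a kappa f -> insertion B d kappa h g f ->
  (forall n, interval_periods g n <-> Sh s n) ->
  (forall x n, Nat.iter n f x <= x + INR n * d + 2) /\
  bounded_drift f (orbit_point B d 0) d /\
  (forall (q : nat) (p : Z), IZR p < INR q * d ->
     a + 1 + IZR p <= Nat.iter q f (orbit_point B d 0)) /\
  (forall z n k, circle_period f z n -> Nat.iter n f z = z + IZR k -> IZR k = INR n * d ->
     Lambda d (Sh s) n) /\
  (forall n, Lambda d (Sh s) n -> exists z, circle_period f z n).
Proof.
  intros B f d a kappa h g s HB Hshape [Hh Hkap (_ & _ & Hgr) Hins] Hg.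
  split; [|split; [|split; [|split]]].
  - apply (upper_displacement B HB f d a kappa Hshape).
  - apply (upper_drift B HB f d a kappa Hshape).
  - apply (upper_advance B HB f d a kappa Hshape).
  - apply (Lambda_of_ratio f s g d Hg). intros p q Hq Hpq Ed.
    exact (upper_periods B HB f d a kappa Hshape p q Hq Hpq Ed h Hh
             (Hkap p q Hq Hpq Ed) g Hgr Hins).
  - intros n (p & q & Hq & Hpq & Ed & m & Hm & En). rewrite En. apply Hg in Hm.
    exact (upper_periods_exist B HB f d a kappa Hshape p q Hq Hpq Ed h Hh
             (Hkap p q Hq Hpq Ed) g Hgr Hins m Hm).
Qed.

(** The symmetry that exchanges the two ends of the rotation interval. *)
Definition mirror (f : R -> R) (x : R) : R := - f (- x).

Lemma iter_mirror : forall f n x, Nat.iter n (mirror f) x = - Nat.iter n f (- x).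
Proof.
  intros f n x. induction n as [|n IH]; simpl; [ring|].
  rewrite IH. unfold mirror. rewrite Ropp_involutive. easy.
Qed.

Lemma lift_mirror : forall f, lift f -> lift (mirror f).
Proof.
  intros f Hf. split; [apply continuity_reflect, Hf|].
  intros x. unfold mirror. assert (H := proj2 Hf (- (x + 1))).
  replace (- (x + 1) + 1) with (- x) in H by ring. lra.
Qed.

Lemma return_mirror : forall f n x k,
  Nat.iter n f x = x + IZR k <-> Nat.iter n (mirror f) (- x) = - x + IZR (- k).
Proof.
  intros f n x k. rewrite iter_mirror, Ropp_involutive, opp_IZR. split; lra.
Qed.

Lemma circle_period_mirror : forall f x n,
  circle_period f x n -> circle_period (mirror f) (- x) n.
Proof.
  intros f x n (Hn & [k Hk] & Hmin). split; [exact Hn|]. split.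
  - exists (- k)%Z. apply (proj1 (return_mirror f n x k)), Hk.
  - intros m Hm [j Hj]. apply (Hmin m Hm). exists (- j)%Z.
    apply (proj2 (return_mirror f m x (- j))).
    replace (- - j)%Z with j by lia. exact Hj.
Qed.

Lemma circle_period_unreflect : forall f x n,
  circle_period (mirror f) x n -> circle_period f (- x) n.
Proof.
  intros f x n (Hn & [k Hk] & Hmin). rewrite <- (Ropp_involutive x) in Hk.
  split; [exact Hn|]. split.
  - exists (- k)%Z. apply (proj2 (return_mirror f n (- x) (- k))). replace (- - k)%Z with k by lia. exact Hk.
  - intros m Hm [j Hj]. apply (Hmin m Hm). exists (- j)%Z.
    apply (proj1 (return_mirror f m (- x) j)) in Hj. rewrite Ropp_involutive in Hj. exact Hj.
Qed.

Lemma Lambda_opp : forall c A n, Lambda (- c) A n -> Lambda c A n.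
Proof.
  intros c A n (k & q & Hq & Hrel & E & H). exists (- k)%Z, q.
  split; [exact Hq|]. split; [|split; [|exact H]].
  - apply Zis_gcd_minus. rewrite Z.opp_involutive. apply Zis_gcd_sym, Hrel.
  - rewrite opp_IZR. unfold Rdiv in *. lra.
Qed.

Definition realizes (c d : R) (s_c s_d : NSh) (f : R -> R) : Prop :=
  lift f /\
  (exists K, forall x n, x + INR n * c - K <= Nat.iter n f x <= x + INR n * d + K) /\
  (forall rho, c <= rho <= d -> exists x, bounded_drift f x rho) /\
  (forall n, (exists z, circle_period f z n) <->
     Lambda c (Sh s_c) n \/ M c d n \/ Lambda d (Sh s_d) n).

(** The factor [B] is so large that the affine part [a, b] is shorter than a turn. As c < d,
    its image is at least a turn long, so the map has to come down between [b] and [a + 1], and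
    the interior of the rotation interval is realized there. The ends are realized by the
    orbits of [b] and [a] and by the copies inserted next to them. *)
Theorem nondegenerate_realization : forall c d s_c s_d, c < d ->
  exists f, realizes c d s_c s_d f.
Proof.
  intros c d s_c s_d Hcd.
  set (B := d - c + 4). assert (HB : 3 <= B) by (unfold B; lra).
  assert (HiB := invB_bounds B HB).
  set (b := orbit_point B d 0). set (a' := orbit_point B (- c) 0). set (a := - a').
  assert (Hwidth : b - a < 1).
  { assert (H1 := orbit_point_zero_le B HB d). assert (H2 := orbit_point_zero_le B HB (- c)).
    fold b in H1. fold a' in H2. unfold a. unfold B in H1, H2. nra. }
  assert (Hdrop : B * a + 1 <= B * b).
  { assert (H1 := b_image B HB d). assert (H2 := b_image B HB (- c)).
    fold b in H1. fold a' in H2. unfold a.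
    assert (H : IZR 1 <= orbit_point B d d + orbit_point B (- c) (- c)).
    { apply orbit_point_compare; [exact HB|]. intros n.
      assert (Hn := pos_INR n).
      assert (H3 := ceil_bounds (d + INR n * d)). assert (H4 := ceil_bounds (- c + INR n * - c)).
      enough (0 < ceil (d + INR n * d) + ceil (- c + INR n * - c))%Z by lia.
      apply lt_IZR. rewrite plus_IZR. nra. }
    simpl in H. lra. }
  assert (Hab : a <= b) by nra.
  assert (Hlow : forall e e' theta, -1 < theta -> 0 <= e + e' ->
            - orbit_point B e' 0 <= orbit_point B e theta).
  { intros e e' theta Ht He.
    enough (IZR 0 <= orbit_point B e theta + orbit_point B e' 0) by (simpl in *; lra).
    apply orbit_point_compare; [exact HB|]. intros n. assert (Hn := pos_INR n).
    assert (H3 := ceil_bounds (theta + INR n * e)). assert (H4 := ceil_bounds (0 + INR n * e')).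
    enough (-1 < ceil (theta + INR n * e) + ceil (0 + INR n * e'))%Z by lia.
    apply lt_IZR. rewrite plus_IZR. nra. }
  set (h := (a + 1 - b) / 3).
  assert (Hh : 0 < h <= 1 - / B) by (unfold h; lra).
  destruct (bump_height B d h HB Hh) as (ku & Hku & Hgapu & Hkapu).
  destruct (bump_height B (- c) h HB Hh) as (kl & Hkl & Hgapl & Hkapl).
  destruct (sharkovsky_realization s_d) as (gu & Hgu & Hpu).
  destruct (sharkovsky_realization s_c) as (gl & Hgl & Hpl).
  destruct (bumped_map B a b h kl ku gl gu) as (f & Hf & Haff & Hmid & Hinsu & Hinsl);
    try assumption; try (unfold h; lra).
  exists f.
  destruct (upper_end B f d a ku h gu s_d) as (U1 & U2 & U3 & U4 & U5); try assumption.
  { split; try assumption.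
    - intros theta Ht. apply Hlow; lra.
    - intros x Hx. apply Hmid, Hx. }
  { split; assumption. }
  destruct (upper_end B (mirror f) (- c) (- b) kl h gl s_c) as (L1 & L2 & L3 & L4 & L5);
    try assumption.
  { split; try assumption; fold a'.
    - apply lift_mirror, Hf.
    - intros theta Ht. apply Hlow; lra.
    - intros x Hx. unfold mirror. rewrite Haff by (unfold a; lra). ring.
    - intros x Hx. unfold mirror.
      assert (H := proj2 Hf (- x)). assert (Hm := Hmid (- x + 1) ltac:(unfold a; lra)).
      unfold a in Hm. lra. }
  { split; try assumption; fold a'.
    intros t Ht. unfold mirror.
    assert (H := proj2 Hf (- (a' + h * t))). assert (Hm := Hinsl t Ht). unfold a in Hm.
    replace (- (a' + h * t) + 1) with (- a' + 1 - h * t) in H by ring. lra. }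
  assert (Hbound : forall x n, x + INR n * c - 2 <= Nat.iter n f x <= x + INR n * d + 2).
  { intros x n. split; [|apply U1]. assert (H := L1 (- x) n).
    rewrite iter_mirror, Ropp_involutive in H. lra. }
  assert (Hback : forall (q : nat) (p : Z), INR q * c < IZR p ->
            Nat.iter q f (a + 1) <= b + IZR p).
  { intros q p Hp. assert (H := L3 q (- p)%Z). rewrite opp_IZR in H.
    specialize (H ltac:(lra)). rewrite iter_mirror in H. fold a' a in H.
    rewrite (iter_lift_shift f Hf q a 1). unfold a in *. lra. }
  split; [exact Hf|]. split; [exists 2; exact Hbound|]. split.
  - intros rho Hrho.
    destruct (Req_dec rho d) as [->|]; [exists b; exact U2|].
    destruct (Req_dec rho c) as [->|].
    { exists a. destruct L2 as [K HK]. exists K. intros n. specialize (HK n).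
      rewrite iter_mirror in HK. fold a' in HK. fold a in HK.
      replace (- Nat.iter n f a - a' - INR n * - c) with
        (- (Nat.iter n f a - a - INR n * c)) in HK by (unfold a; ring).
      rewrite Rabs_Ropp in HK. exact HK. }
    apply (interior_drift f Hf c d b (a + 1)) with (K0 := 2).
    + lra.
    + intros q p _. apply U3.
    + intros q p _. apply Hback.
    + lra.
    + exact Hbound.
  - intros n; split.
    + intros [z Hz]. assert (Hz' := Hz). destruct Hz' as (Hn & [k Hk] & _).
      assert (HnR : 0 < INR n) by (apply lt_0_INR, Hn).
      assert (Hcd' := return_within f Hf c d 2 z n k (Hbound z) Hk).
      destruct (Req_dec (IZR k) (INR n * d)) as [Ed|].
      { right; right. exact (U4 z n k Hz Hk Ed). }
      destruct (Req_dec (IZR k) (INR n * c)) as [Ec|].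
      { left. apply Lambda_opp, (L4 (- z) n (- k)%Z).
        - apply circle_period_mirror, Hz.
        - apply (proj1 (return_mirror f n z k)), Hk.
        - rewrite opp_IZR, Ec. ring. }
      right; left. split; [exact Hn|]. exists k. split.
      * apply Rlt_div_r; lra.
      * apply Rlt_div_l; lra.
    + intros [H|[H|H]].
      * destruct (L5 n) as [z Hz].
        { apply Lambda_opp. rewrite Ropp_involutive. exact H. }
        exists (- z). apply circle_period_unreflect, Hz.
      * apply (interior_periods f Hf c d b (a + 1)); try exact H.
        -- lra.
        -- intros q p _. apply U3.
        -- intros q p _. apply Hback.
      * apply U5, H.
Qed.

(** * Rotation intervals with one point *)

Lemma M_degenerate : forall c n, ~ M c c n.
Proof. intros c n (_ & k & Hk). lra. Qed.

Section RationalRotation.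
Context (p : Z) (q : nat) (Hq : (0 < q)%nat) (Hpq : rel_prime p (Z.of_nat q))
  (g : R -> R) (Hg : interval_map g).

Definition half_cell : R := / (2 * INR q).

(** The copy of [g] on the left half need not end at a fixed point, so the right half is used
    to reach the end of the cell. *)
Definition cell_map (x : R) : R :=
  half_cell * g (clamp (x / half_cell))
    + (2 - g 1) * half_cell * clamp ((x - half_cell) / half_cell).

Lemma half_cell_pos : 0 < half_cell.
Proof. apply Rinv_0_lt_compat. assert (H := INRq q Hq). lra. Qed.

Lemma half_cell_q : INR q * (2 * half_cell) = 1.
Proof. unfold half_cell. field. assert (H := INRq q Hq). lra. Qed.

Lemma cell_map_left : forall t, 0 <= t <= 1 -> cell_map (half_cell * t) = half_cell * g t.
Proof.
  intros t Ht. assert (Hh := half_cell_pos). unfold cell_map.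
  replace (half_cell * t / half_cell) with t by (field; lra).
  rewrite (clamp_id t), (clamp_low ((half_cell * t - half_cell) / half_cell)); [ring | | exact Ht].
  apply Rle_div_l; nra.
Qed.

Lemma cell_map_zero : cell_map 0 = 0.
Proof.
  replace 0 with (half_cell * 0) at 1 by ring. destruct Hg as (_ & H0 & _).
  rewrite cell_map_left, H0 by lra. ring.
Qed.

Lemma cell_map_right : forall x, half_cell <= x <= 2 * half_cell ->
  cell_map x = half_cell * g 1 + (2 - g 1) * (x - half_cell).
Proof.
  intros x Hx. assert (Hh := half_cell_pos). unfold cell_map.
  rewrite (clamp_high (x / half_cell)) by (apply Rle_div_r; lra).
  rewrite clamp_id; [field; lra|].
  split; [apply Rle_div_r | apply Rle_div_l]; lra.
Qed.

Lemma cell_map_range : forall x, 0 <= x <= 2 * half_cell -> 0 <= cell_map x <= 2 * half_cell.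
Proof.
  intros x Hx. assert (Hh := half_cell_pos). destruct Hg as (_ & _ & Hr).
  destruct (Rle_lt_dec x half_cell).
  - replace x with (half_cell * (x / half_cell)) by (field; lra).
    assert (Ht : 0 <= x / half_cell <= 1) by (split; [apply Rle_div_r | apply Rle_div_l]; lra).
    rewrite cell_map_left by exact Ht. specialize (Hr _ Ht). nra.
  - rewrite cell_map_right by lra. specialize (Hr 1 ltac:(lra)). nra.
Qed.

(** The rotation by p / q permutes the cells between consecutive multiples of 1 / q. If it is
    preceded on one cell by a map that fixes the ends, this map becomes the return map of
    the cell. *)
Theorem rational_rotation_realization : forall c s,
  c = IZR p / INR q -> (forall n, interval_periods g n <-> Sh s n) ->
  exists f, lift f /\
    (forall x n, x + INR n * c - 1 <= Nat.iter n f x <= x + INR n * c + 1) /\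
    (forall n, (exists z, circle_period f z n) <-> Lambda c (Sh s) n).
Proof.
  intros c s Ec Hs. assert (Hh := half_cell_pos). assert (Hhq := half_cell_q).
  assert (HqR := INRq q Hq). assert (Hq1 : 1 <= INR q) by (apply (le_INR 1); lia).
  assert (Hh1 : 2 * half_cell <= 1) by nra.
  assert (Hg' := Hg). destruct Hg' as (Hcg & Hg0 & Hgr).
  destruct (lift_extension
    (fun x => Rmax x (2 * half_cell) - 2 * half_cell + cell_map x + c) 0) as (f & Hf & Ef).
  { unfold cell_map. assert (H := continuity_clamp). prove_continuity. }
  { rewrite cell_map_zero, Rmax_left, Rmax_right by lra. unfold cell_map.
    rewrite (clamp_high ((0 + 1) / half_cell)) by (apply Rle_div_r; lra).
    rewrite (clamp_high ((0 + 1 - half_cell) / half_cell)) by (apply Rle_div_r; lra). ring. }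
  assert (Ecell : forall x, 0 <= x <= 2 * half_cell -> f x = cell_map x + c).
  { intros x Hx. rewrite Ef, Rmax_right by lra. ring. }
  assert (Erot : forall x, 2 * half_cell <= x <= 1 -> f x = x + c).
  { intros x Hx. rewrite Ef, Rmax_left by lra. unfold cell_map.
    rewrite (clamp_high (x / half_cell)) by (apply Rle_div_r; lra).
    rewrite (clamp_high ((x - half_cell) / half_cell)) by (apply Rle_div_r; lra). ring. }
  assert (Hjq : forall j, IZR j / INR q = IZR j * (2 * half_cell)).
  { intros j. unfold half_cell. field. lra. }
  (* Off the cells N + [0, 1/q] the map is the rotation; those it maps to their images. *)
  assert (Hsplit : forall y, exists N, IZR N <= y < IZR N + 1 /\
            (y <= IZR N + 2 * half_cell /\ IZR N <= f y - c <= IZR N + 2 * half_cell \/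
             IZR N + 2 * half_cell <= y /\ f y = y + c)).
  { intros y. exists (Int_part y). assert (HN := base_Int_part y). set (N := Int_part y) in *.
    split; [lra|]. assert (E := lift_shift f Hf (y - IZR N) N).
    replace (y - IZR N + IZR N) with y in E by ring.
    destruct (Rle_lt_dec (y - IZR N) (2 * half_cell)) as [Hy|Hy].
    - left. split; [lra|]. assert (Hr := cell_map_range (y - IZR N) ltac:(lra)).
      rewrite E, Ecell by lra. lra.
    - right. split; [lra|]. rewrite E, Erot by lra. ring. }
  assert (Hgrid : forall j N, IZR j / INR q < IZR N + 2 * half_cell -> IZR j / INR q <= IZR N).
  { intros j N H. rewrite Hjq in H |- *.
    assert (Hj : (j < N * Z.of_nat q + 1)%Z).
    { apply lt_IZR. rewrite plus_IZR, mult_IZR, <- INR_IZR_INZ.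
      apply (Rmult_lt_reg_r (2 * half_cell)); [lra|].
      replace ((IZR N * INR q + 1) * (2 * half_cell))
        with (IZR N * (INR q * (2 * half_cell)) + 2 * half_cell) by ring.
      rewrite Hhq. lra. }
    assert (Hj' : (j <= N * Z.of_nat q)%Z) by lia.
    apply IZR_le in Hj'. rewrite mult_IZR, <- INR_IZR_INZ in Hj'.
    replace (IZR N) with (IZR N * INR q * (2 * half_cell)) by (rewrite Rmult_assoc, Hhq; ring).
    apply Rmult_le_compat_r; lra. }
  assert (Hbelow : forall y j, y <= IZR j / INR q -> f y <= IZR j / INR q + c).
  { intros y j Hy. destruct (Hsplit y) as (N & HN & [[H1 H2]|[H1 H2]]); [|lra].
    destruct (Rle_lt_dec (IZR N + 2 * half_cell) (IZR j / INR q)) as [H|H]; [lra|].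
    apply Hgrid in H. replace y with (0 + IZR N) in * by lra.
    rewrite (lift_shift f Hf 0 N), (Ecell 0), cell_map_zero by lra. lra. }
  assert (Habove : forall y j, IZR j / INR q <= y -> IZR j / INR q + c <= f y).
  { intros y j Hy. destruct (Hsplit y) as (N & HN & [[H1 H2]|[H1 H2]]); [|lra].
    destruct (Rle_lt_dec (IZR N + 2 * half_cell) (IZR j / INR q)) as [H|H].
    - replace y with (2 * half_cell + IZR N) in * by lra.
      rewrite (lift_shift f Hf (2 * half_cell) N), (Erot (2 * half_cell)) by lra. lra.
    - apply Hgrid in H. lra. }
  assert (Hgrid_step : forall j, IZR j / INR q + c = IZR (j + p) / INR q).
  { intros j. rewrite plus_IZR, Ec. field. lra. }
  assert (Hbound : forall x n, x + INR n * c - 1 <= Nat.iter n f x <= x + INR n * c + 1).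
  { intros x n.
    set (j := Int_part (x * INR q)). assert (Hj := base_Int_part (x * INR q)). fold j in Hj.
    assert (H1 : IZR j / INR q <= x) by (apply Rle_div_l; lra).
    assert (H2 : x <= IZR (j + 1) / INR q) by (apply Rle_div_r; rewrite ?plus_IZR; lra).
    assert (H3 : IZR (j + 1) / INR q = IZR j / INR q + 2 * half_cell).
    { rewrite !Hjq, plus_IZR. ring. }
    assert (Hi : IZR (j + Z.of_nat n * p) / INR q <= Nat.iter n f x
                  <= IZR (j + 1 + Z.of_nat n * p) / INR q).
    { induction n as [|n IH].
      - simpl Nat.iter. replace (j + Z.of_nat 0 * p)%Z with j by lia.
        replace (j + 1 + Z.of_nat 0 * p)%Z with (j + 1)%Z by lia. lra.
      - rewrite iter_S.
        replace (j + Z.of_nat (S n) * p)%Z with (j + Z.of_nat n * p + p)%Z by lia.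
        replace (j + 1 + Z.of_nat (S n) * p)%Z with (j + 1 + Z.of_nat n * p + p)%Z by lia.
        rewrite <- !Hgrid_step. split; [apply Habove | apply Hbelow]; apply IH. }
    assert (E : forall i, IZR (i + Z.of_nat n * p) / INR q = IZR i / INR q + INR n * c).
    { intros i. rewrite plus_IZR, mult_IZR, <- INR_IZR_INZ, Ec. field. lra. }
    rewrite !E in Hi. lra. }
  assert (Hturn : forall x, 0 <= x <= 2 * half_cell -> turn_back f q p x = cell_map x).
  { intros x Hx. assert (Hr := cell_map_range x Hx).
    assert (H : forall i, (0 < i <= q)%nat -> Nat.iter i f x = cell_map x + INR i * c).
    { intros i [Hi0 Hiq]. induction i as [|i IH]; [lia|].
      destruct (Nat.eq_dec i 0) as [->|Hi]; [simpl; rewrite Ecell by lra; ring|].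
      rewrite iter_S, IH, S_INR by lia.
      assert (Eic : INR i * c = IZR (Z.of_nat i * p) / INR q).
      { rewrite mult_IZR, <- INR_IZR_INZ, Ec. field. lra. }
      (* The cell of i p / q is not one of the cells N + [0, 1/q]. *)
      set (r := ((Z.of_nat i * p) mod Z.of_nat q)%Z).
      set (N := ((Z.of_nat i * p) / Z.of_nat q)%Z).
      assert (Hdiv := Z.div_mod (Z.of_nat i * p) (Z.of_nat q) ltac:(lia)).
      assert (Hmod := Z.mod_pos_bound (Z.of_nat i * p) (Z.of_nat q) ltac:(lia)).
      fold r N in Hdiv, Hmod.
      assert (Hr0 : r <> 0%Z).
      { intros E. apply (not_multiple p q Hq Hpq i N ltac:(lia)). lia. }
      assert (Er : INR i * c = IZR N + IZR r * (2 * half_cell)).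
      { rewrite Eic, Hdiv, plus_IZR, mult_IZR, <- INR_IZR_INZ.
        unfold half_cell. field. lra. }
      assert (Hr1 : 1 <= IZR r <= INR q - 1).
      { split; [apply (IZR_le 1); lia|]. rewrite INR_IZR_INZ, <- (minus_IZR _ 1).
        apply IZR_le. lia. }
      assert (E := lift_shift f Hf (cell_map x + IZR r * (2 * half_cell)) N).
      rewrite (Erot (cell_map x + IZR r * (2 * half_cell))) in E by nra.
      rewrite Er. replace (cell_map x + (IZR N + IZR r * (2 * half_cell)))
        with (cell_map x + IZR r * (2 * half_cell) + IZR N) by ring.
      rewrite E. lra. }
    unfold turn_back. rewrite H by lia.
    replace (INR q * c) with (IZR p) by (rewrite Ec; field; lra). ring. }
  assert (Hins : forall t, 0 <= t <= 1 -> turn_back f q p (0 + half_cell * t) = 0 + half_cell * g t).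
  { intros t Ht. rewrite !Rplus_0_l, Hturn by nra. apply cell_map_left, Ht. }
  exists f. split; [exact Hf|]. split; [exact Hbound|]. intros n; split.
  - intros [z Hz]. assert (Hz' := Hz). destruct Hz' as (Hn & [k Hk] & _).
    assert (Hrat : IZR k = INR n * c).
    { assert (H := return_within f Hf c c 1 z n k (Hbound z) Hk). lra. }
    apply (Lambda_of_ratio f s g c Hs) with (z := z) (k := k); try assumption.
    clear z n k Hz Hn Hk Hrat. intros p' q' Hq' Hpq' Ed z n k Hz Hk Hrat.
    replace q' with q by (apply (coprime_quotient_unique p q p' q'); congruence).
    apply (periods_at_rotation f Hf p q Hq Hpq 0 half_cell Hh g Hgr Hins
             (fun j => IZR j / INR q)) with (z := z) (k := k).
    + field. lra.
    + intros j. rewrite plus_IZR, <- INR_IZR_INZ. field. lra.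
    + intros y j Hy. rewrite <- Hgrid_step. apply Hbelow, Hy.
    + intros y Hy. rewrite Hjq in Hy. rewrite Hturn, cell_map_right by lra.
      specialize (Hgr 1 ltac:(lra)). nra.
    + exact Hz.
    + exact Hk.
    + apply eq_IZR. rewrite !mult_IZR, Hrat, <- !INR_IZR_INZ, Ec. field. lra.
  - intros (p' & q' & Hq' & Hpq' & Ed & m & Hm & En). rewrite En.
    replace q' with q by (apply (coprime_quotient_unique p q p' q'); congruence).
    apply Hs in Hm. destruct Hm as (t & Ht & Hm). exists (0 + half_cell * t).
    apply (inserted_period f Hf p q Hq Hpq 0 half_cell Hh g Hgr Hins); [lra | exact Hm].
Qed.
End RationalRotation.

Lemma bounded_drift_of_bound : forall f c K,
  (forall x n, x + INR n * c - K <= Nat.iter n f x <= x + INR n * c + K) ->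
  forall rho, c <= rho <= c -> exists x, bounded_drift f x rho.
Proof.
  intros f c K H rho Hrho. exists 0, K. intros n. specialize (H 0 n).
  replace rho with c by lra. apply Rabs_le_between. lra.
Qed.

Theorem degenerate_realization : forall c s_c s_d, exists f, realizes c c s_c s_d f.
Proof.
  intros c s_c s_d.
  destruct (classic (exists p q, (0 < q)%nat /\ rel_prime p (Z.of_nat q) /\ c = IZR p / INR q))
    as [(p & q & Hq & Hpq & Ec)|Hirr].
  - assert (Hmax : exists s, forall n, Sh s n <-> Sh s_c n \/ Sh s_d n).
    { destruct (Sh_total s_c s_d) as [H|H]; [exists s_d | exists s_c]; intros n;
        specialize (H n); tauto. }
    destruct Hmax as [s Hs]. destruct (sharkovsky_realization s) as (g & Hg & Hgs).
    destruct (rational_rotation_realization p q Hq Hpq g Hg c s Ec Hgs) as (f & Hf & Hb & Hper).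
    exists f. split; [exact Hf|]. split; [exists 1; exact Hb|].
    split; [apply (bounded_drift_of_bound f c 1 Hb)|].
    intros n. rewrite Hper. split.
    + intros (p' & q' & Hq' & Hpq' & E & m & Hm & En). apply Hs in Hm.
      destruct Hm as [Hm|Hm]; [left | right; right]; exists p', q';
        (split; [exact Hq'|]); (split; [exact Hpq'|]); (split; [exact E|]); exists m; easy.
    + intros [H|[H|H]]; [|exfalso; exact (M_degenerate _ _ H)|];
        destruct H as (p' & q' & Hq' & Hpq' & E & m & Hm & En); exists p', q';
        (split; [exact Hq'|]); (split; [exact Hpq'|]); (split; [exact E|]); exists m;
        (split; [apply Hs; tauto | exact En]).
  - set (f := fun x => x + c).
    assert (Hiter : forall x n, Nat.iter n f x = x + INR n * c).
    { intros x n. induction n as [|n IH]; [simpl; ring|]. rewrite iter_S, IH, S_INR.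
      unfold f. ring. }
    exists f. split; [split; [unfold f; prove_continuity | intros; unfold f; ring]|].
    assert (Hb : forall x n, x + INR n * c - 0 <= Nat.iter n f x <= x + INR n * c + 0).
    { intros x n. rewrite Hiter. lra. }
    split; [exists 0; exact Hb|]. split; [apply (bounded_drift_of_bound f c 0 Hb)|].
    assert (HL : forall s n, ~ Lambda c (Sh s) n).
    { intros s n (p & q & Hq & Hpq & E & _). apply Hirr. exists p, q. easy. }
    intros n; split.
    + intros (z & Hn & [k Hk] & _). exfalso. apply Hirr.
      destruct (reduce_fraction n k Hn) as (m & q & p & Hm & Hq & En & Ek & Hpq).
      exists p, q. split; [exact Hq|]. split; [exact Hpq|].
      assert (HmR : 0 < INR m) by (apply lt_0_INR, Hm).
      assert (HqR : 0 < INR q) by (apply lt_0_INR, Hq).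
      rewrite Hiter, Ek, En, mult_INR, mult_IZR, <- INR_IZR_INZ in Hk.
      apply (Rmult_eq_reg_l (INR q * INR m)); [|nra].
      replace (INR q * INR m * (IZR p / INR q)) with (INR m * IZR p) by (field; lra). lra.
    + intros [H|[H|H]]; exfalso; [apply (HL _ _ H) | apply (M_degenerate _ _ H) | apply (HL _ _ H)].
Qed.

Theorem circle_realization : forall c d s_c s_d, c <= d -> exists f, realizes c d s_c s_d f.
Proof.
  intros c d s_c s_d [H| ->].
  - apply nondegenerate_realization, H.
  - apply degenerate_realization.
Qed.

(** * From the circle to S *)

(** The projection to the axis is a retraction of S. *)
Definition over_axis (f : R -> R) (z : C) : C := RtoC (f (Re z)).

Lemma iter_over_axis : forall f n z,
  Nat.iter (S n) (over_axis f) z = RtoC (Nat.iter (S n) f (Re z)).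
Proof.
  intros f n z. induction n as [|n IH]; [easy|].
  rewrite iter_S, IH. easy.
Qed.

Lemma Re_iter_over_axis : forall f n z,
  Re (Nat.iter n (over_axis f) z) = Nat.iter n f (Re z).
Proof. intros f [|n] z; [easy | rewrite iter_over_axis; easy]. Qed.

Lemma over_axis_degree_one : forall f, lift f -> degree_one_map (over_axis f).
Proof.
  intros f [Hc Hf]. split.
  - intros z _. left. easy.
  - apply continuous_on_forall. intros z _. apply filterlim_locally. intros eps.
    destruct (continuity_near f (Re z) eps Hc (cond_pos eps)) as (del & Hd & H).
    exists (mkposreal del Hd). intros w [Hw _]. split.
    + apply H, Hw.
    + apply ball_center.
  - intros z _. unfold over_axis. simpl. rewrite Hf. unfold RtoC, Cplus. simpl.
    f_equal; ring.
Qed.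

Lemma over_axis_returns : forall f n z, (0 < n)%nat ->
  returns_mod1 (over_axis f) z n <->
  Im z = 0 /\ exists k, Nat.iter n f (Re z) = Re z + IZR k.
Proof.
  intros f [|n] z Hn; [lia|]. unfold returns_mod1. rewrite iter_over_axis. split.
  - intros [k Hk]. destruct z as [x y]. unfold RtoC, Cplus in Hk. simpl fst in Hk; simpl snd in Hk.
    assert (H1 := f_equal fst Hk). assert (H2 := f_equal snd Hk). simpl fst in H1. simpl snd in H2.
    split; [simpl; lra | exists k; exact H1].
  - intros [Hy [k Hk]]. exists k. rewrite Hk. destruct z as [x y]. simpl in Hy |- *. subst y.
    unfold RtoC, Cplus. simpl. f_equal; ring.
Qed.

Lemma over_axis_Per : forall f n,
  Per (over_axis f) n <-> exists x, circle_period f x n.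
Proof.
  intros f n; split.
  - intros (z & _ & Hn & Hret & Hmin). apply over_axis_returns in Hret; [|exact Hn].
    destruct Hret as [Hy Hret]. exists (Re z). split; [exact Hn|]. split; [exact Hret|].
    intros m Hm H. apply (Hmin m Hm). apply over_axis_returns; [lia | easy].
  - intros (x & Hn & Hret & Hmin). exists (RtoC x). split; [left; easy|].
    split; [exact Hn|]. split.
    + apply over_axis_returns; easy.
    + intros m Hm H. apply over_axis_returns in H; [|lia]. apply (Hmin m Hm), H.
Qed.

Lemma over_axis_rotation : forall f z rho,
  is_rotation_number (over_axis f) z rho <->
  is_lim_seq (fun n => (Nat.iter n f (Re z) - Re z) / INR n) rho.
Proof.
  intros f z rho. unfold is_rotation_number.
  split; apply is_lim_seq_ext; intros n; rewrite Re_iter_over_axis; easy.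
Qed.

Lemma over_axis_Rot_R : forall f rho, Rot_R (over_axis f) rho <-> Rot (over_axis f) rho.
Proof.
  intros f rho; split.
  - intros [x Hx]. exists (RtoC x). split; [left; easy | exact Hx].
  - intros (z & _ & Hz). exists (Re z). apply over_axis_rotation.
    apply over_axis_rotation in Hz. exact Hz.
Qed.

Lemma lim_perturbed : forall r K, is_lim_seq (fun n => r + K * / INR n) r.
Proof.
  intros r K. replace (Finite r) with (Rbar_plus r (Rbar_mult K 0)).
  - apply is_lim_seq_plus'; [apply is_lim_seq_const|].
    apply (is_lim_seq_scal_l (fun n => / INR n) K 0).
    apply (is_lim_seq_inv INR p_infty is_lim_seq_INR). discriminate.
  - simpl. f_equal. ring.
Qed.

Lemma rotation_bounds : forall f c d K x (rho : R),
  (forall n, x + INR n * c - K <= Nat.iter n f x <= x + INR n * d + K) ->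
  is_lim_seq (fun n => (Nat.iter n f x - x) / INR n) rho -> c <= rho <= d.
Proof.
  intros f c d K x rho H Hlim.
  assert (Hev : forall n, (1 <= n)%nat ->
            c + - K * / INR n <= (Nat.iter n f x - x) / INR n <= d + K * / INR n).
  { intros n Hn. assert (HnR : 0 < INR n) by (apply lt_0_INR; lia). specialize (H n).
    split; [apply Rle_div_r | apply Rle_div_l]; try exact HnR;
      rewrite Rmult_plus_distr_r, Rmult_assoc, Rinv_l; lra. }
  split.
  - apply (is_lim_seq_le_loc (fun n => c + - K * / INR n)
             (fun n => (Nat.iter n f x - x) / INR n) c rho).
    + exists 1%nat. intros n Hn. apply Hev, Hn.
    + apply lim_perturbed.
    + exact Hlim.
  - apply (is_lim_seq_le_loc (fun n => (Nat.iter n f x - x) / INR n)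
             (fun n => d + K * / INR n) rho d).
    + exists 1%nat. intros n Hn. apply Hev, Hn.
    + exact Hlim.
    + apply lim_perturbed.
Qed.

Lemma bounded_drift_rotation : forall f x (rho : R), bounded_drift f x rho ->
  is_lim_seq (fun n => (Nat.iter n f x - x) / INR n) rho.
Proof.
  intros f x rho [K HK].
  apply (is_lim_seq_le_le_loc (fun n => rho + - K * / INR n) _ (fun n => rho + K * / INR n)).
  - exists 1%nat. intros n Hn. assert (HnR : 0 < INR n) by (apply lt_0_INR; lia).
    specialize (HK n). apply Rabs_le_between in HK.
    split; [apply Rle_div_r | apply Rle_div_l]; try exact HnR;
      rewrite Rmult_plus_distr_r, Rmult_assoc, Rinv_l; lra.
  - apply lim_perturbed.
  - apply lim_perturbed.
Qed.

Theorem corollary2 :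
  forall (c d : R) (s_c s_d : NSh),
    c <= d ->
    exists F : C -> C,
      degree_one_map F /\
      (forall rho : R, Rot_R F rho <-> Rot F rho) /\
      (forall rho : R, Rot F rho <-> c <= rho <= d) /\
      (forall n : nat,
          Per F n <->
          (Lambda c (Sh s_c) n \/ M c d n \/ Lambda d (Sh s_d) n)).
Proof.
  intros c d s_c s_d Hcd.
  destruct (circle_realization c d s_c s_d Hcd) as (f & Hf & [K HK] & Hdrift & Hper).
  exists (over_axis f). split; [apply over_axis_degree_one, Hf|].
  split; [apply over_axis_Rot_R|]. split.
  - intros rho; split.
    + intros (z & _ & Hz). apply over_axis_rotation in Hz.
      apply (rotation_bounds f c d K (Re z)); [intros n; apply HK | exact Hz].
    + intros Hrho. destruct (Hdrift rho Hrho) as [x Hx]. apply over_axis_Rot_R.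
      exists x. apply over_axis_rotation, bounded_drift_rotation, Hx.
  - intros n. rewrite over_axis_Per. apply Hper.
Qed.
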